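(* Let $\sigma$ be a critical permutation of size $n$. Then $\Gamma_\sigma$ is connected but not a pseudotree, i.e. $$|\mathrm{Cov}(\sigma)|\ \ge\ n+1.$$ Consequently $\sigma$ is not pseudorigid.
   Context: **Cover graph.** For $\sigma=\sigma_1\cdots\sigma_n\in S_n$ an inversion is a pair of positions $i<k$ with $\sigma_i>\sigma_k$; it is minimal if there is no $j$ with $i<j<k$ and $\sigma_i>\sigma_j>\sigma_k$. $\mathrm{Cov}(\sigma)$ is the set of minimal inversions and the cover graph $\Gamma_\sigma$ is the undirected graph on $\{1,\dots,n\}$ with edge set $\mathrm{Cov}(\sigma)$. A pseudotree is a connected graph with at most one cycle. **Pseudosmooth and critical permutations.** The direct sum $\alpha\oplus\beta$ of $\alpha\in S_a,\beta\in S_b$ is $(\alpha\oplus\beta)_i=\alpha_i$ for $i\le a$, $=\beta_{i-a}+a$ for $i>a$. A permutation is decomposable if it is a direct sum of two nonempty permutations, indecomposable otherwise; every permutation is uniquely a direct sum of (nonempty) indecomposable summands. For a position $d$, $\sigma-d$ is the permutation of size $n-1$ order-isomorphic to $\sigma$ with the entry at position $d$ removed. The four corners of $\sigma$ are the positions W $=1$, N $=\sigma^{-1}(n)$, S $=\sigma^{-1}(1)$, E $=n$. The window of the W or N corner at position $d$ is $\{k>d:\sigma_k<\sigma_d\}$; the window of the S or E corner at position $d$ is $\{k<d:\sigma_k>\sigma_d\}$. A corner is good if $\sigma$ restricted to its window is decreasing. For $q\in S_k$ and positive integers $\ell=(\ell_1,\dots,\ell_k)$, the inflation $q[\ell]$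 replaces the $i$-th entry of $q$ by a block of $\ell_i$ consecutive values in decreasing order, blocks placed left to right with value intervals ordered according to $q$. A tower is an inflation of one of $3412$, $4231$, $35142$, $42513$, $45312$, $426153$, $463152$, $526413$. Recursively: the empty permutation and $1\in S_1$ are pseudosmooth; an indecomposable $\sigma$ with $|\sigma|>1$ is pseudosmooth if it is a tower or has a good corner $\mathbf c$ with $\sigma-\mathbf c$ pseudosmooth; a general permutation is pseudosmooth if all its indecomposable summands are. A permutation is critical if it is not pseudosmooth but every proper pattern of it is. **Pseudorigid permutations.** Let $\Bbbk$ be an algebraically closed field of arbitrary characteristic, $Q$ the quiver $1\to2\to\cdots\to 2n-1$ with preprojective algebra $\Pi$, $M([a,b])$ the representation of $Q$ with a one-dimensional space at each vertex of $[a,b]$, zero elsewhere, and nonzero maps along all arrows inside $[a,b]$, and $M=\bigoplus_{i=1}^nM([i,2n-\sigma_i])$ with underlying graded space $V$. Let $\Lambda(V)$ be the variety of $\Pi$-module structures on $V$, i.e. pairs $(T,B)$, $T_v:V_v\to V_{v+1}$, $B_v:V_{v+1}\to V_v$, with $T_{v-1}B_{v-1}=B_vT_v$ for all $1\le v\le 2n-1$ (maps involving $V_0=V_{2n}=0$ being zero), and $C_\sigma$ the closure of $\{(T,B)\in\Lambda(V):T\cong M\}$, an irreducible component of $\Lambda(V)$. Then $\sigma$ is pseudorigid if there are $x,y\in C_\sigma$ with $\mathrm{Ext}^1_\Pi(x,y)=0$. *)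

(* Defs.v *)
From HB Require Import structures.
From mathcomp Require Import all_boot all_order all_fingroup all_algebra.
From mathcomp Require Import mpoly.

Set Implicit Arguments.
Unset Strict Implicit.
Unset Printing Implicit Defensive.

Import GRing.Theory.

(* Permutations of size n are elements of 'S_n, so positions and values run    *)
(* over 0, ..., n-1; one_line is the usual 1-based one-line notation.          *)

Section CoverGraph.
Local Open Scope nat_scope.
Variables (n : nat) (s : 'S_n).

Definition inversion (i k : 'I_n) : bool := (i < k) && (s k < s i).

Definition minimal_inversion (i k : 'I_n) : bool :=
  inversion i k && ~~ [exists j : 'I_n, (i < j < k) && (s k < s j < s i)].

Definition Cov : {set 'I_n * 'I_n} :=
  [set p : 'I_n * 'I_n | minimal_inversion p.1 p.2].

Definition cover_graph : rel 'I_n :=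
  [rel i k | ((i, k) \in Cov) || ((k, i) \in Cov)].

End CoverGraph.

Section Graphs.
Variables (V : finType) (e : rel V).

Definition connected_graph : Prop := forall x y : V, connect e x y.

Definition graph_cycle (c : seq V) : bool := (2 < size c)%N && ucycleb e c.

(* Two graph_cycle sequences describe the same cycle (up to choice of starting *)
(* point and orientation) exactly when they have the same edges.               *)
Definition cycle_edges (c : seq V) : {set {set V}} :=
  [set [set x; next c x] | x in c].

Definition pseudotree : Prop :=
  connected_graph /\
  forall c1 c2 : seq V,
    graph_cycle c1 -> graph_cycle c2 -> cycle_edges c1 = cycle_edges c2.

End Graphs.

Section Permutations.
Local Open Scope nat_scope.

Definition one_line n (s : 'S_n) : seq nat := [seq (s i).+1 | i <- enum 'I_n].

Definition is_direct_sum a b n (al : 'S_a) (be : 'S_b) (s : 'S_n) : Prop :=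
  one_line s = one_line al ++ [seq v + a | v <- one_line be].

Definition decomposable n (s : 'S_n) : Prop :=
  exists (a b : nat) (al : 'S_a) (be : 'S_b),
    [/\ 0 < a, 0 < b & is_direct_sum al be s].

Definition indecomposable n (s : 'S_n) : Prop := ~ decomposable s.

(* The decomposition s = al (+) t (+) be, where al and be may be empty.        *)
Definition indecomposable_summand m n (t : 'S_m) (s : 'S_n) : Prop :=
  [/\ 0 < m, indecomposable t &
      exists (a b c : nat) (al : 'S_a) (be : 'S_b) (ga : 'S_c),
        is_direct_sum t be ga /\ is_direct_sum al ga s].

Definition occurrence m n (t : 'S_m) (s : 'S_n) (f : 'I_m -> 'I_n) : Prop :=
  {homo f : x y / x < y} /\
  forall x y : 'I_m, (t x < t y) = (s (f x) < s (f y)).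

Definition is_pattern m n (t : 'S_m) (s : 'S_n) : Prop :=
  exists f : 'I_m -> 'I_n, occurrence t s f.

Definition is_deletion n (s : 'S_n.+1) (d : 'I_n.+1) (t : 'S_n) : Prop :=
  occurrence t s (lift d).

Definition decreasing_on n (s : 'S_n) (A : {set 'I_n}) : bool :=
  [forall k in A, forall l in A, (k < l) ==> (s l < s k)].

Definition window_WN n (s : 'S_n) (d : 'I_n) : {set 'I_n} :=
  [set k : 'I_n | (d < k) && (s k < s d)].

Definition window_SE n (s : 'S_n) (d : 'I_n) : {set 'I_n} :=
  [set k : 'I_n | (k < d) && (s d < s k)].

Definition good_corner n (s : 'S_n.+1) (d : 'I_n.+1) : bool :=
     ((d == ord0) || (s d == ord_max)) && decreasing_on s (window_WN s d)
  || ((s d == ord0) || (d == ord_max)) && decreasing_on s (window_SE s d).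

(* The block of i occupies the values following the total size of the blocks   *)
(* of all j with q j < q i.                                                    *)
Definition inflation k (q : 'S_k) (l : 'I_k -> nat) : seq nat :=
  flatten [seq rev (iota (\sum_(j < k | q j < q i) l j).+1 (l i))
          | i <- enum 'I_k].

Definition tower_bases : seq (seq nat) :=
  [:: [:: 3; 4; 1; 2]; [:: 4; 2; 3; 1];
      [:: 3; 5; 1; 4; 2]; [:: 4; 2; 5; 1; 3]; [:: 4; 5; 3; 1; 2];
      [:: 4; 2; 6; 1; 5; 3]; [:: 4; 6; 3; 1; 5; 2]; [:: 5; 2; 6; 4; 1; 3]].

Definition tower n (s : 'S_n) : Prop :=
  exists (k : nat) (q : 'S_k) (l : 'I_k -> nat),
    [/\ one_line q \in tower_bases, (forall i, 0 < l i)
      & one_line s = inflation q l].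

Inductive pseudosmooth : forall n, 'S_n -> Prop :=
| Pseudosmooth_empty (s : 'S_0) : pseudosmooth s
| Pseudosmooth_one (s : 'S_1) : pseudosmooth s
| Pseudosmooth_tower n (s : 'S_n) of
    1 < n & indecomposable s & tower s : pseudosmooth s
| Pseudosmooth_corner n (s : 'S_n.+1) (c : 'I_n.+1) (t : 'S_n) of
    1 < n.+1 & indecomposable s & good_corner s c & is_deletion s c t
    & pseudosmooth t : pseudosmooth s
| Pseudosmooth_sum n (s : 'S_n) of
    decomposable s
    & (forall m (t : 'S_m), indecomposable_summand t s -> pseudosmooth t) :
    pseudosmooth s.

Definition critical n (s : 'S_n) : Prop :=
  ~ pseudosmooth s /\
  forall m (t : 'S_m), m < n -> is_pattern t s -> pseudosmooth t.

End Permutations.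

Section QuiverRepresentations.
Local Open Scope ring_scope.
Variable K : fieldType.

(* The vertices are 1, ..., 2n-1. Graded spaces are given by a dimension       *)
(* vector nat -> nat, zero outside this range; the spaces are spaces of column *)
(* vectors and the components of a representation at out-of-range indices are  *)
(* empty matrices.                                                             *)
Definition qrep (d : nat -> nat) : Type := forall v : nat, 'M[K]_(d v.+1, d v).

Definition qrep_iso d (T U : qrep d) : Prop :=
  exists2 g : forall v, 'M[K]_(d v),
    (forall v, g v \in unitmx) & (forall v, g v.+1 *m T v = U v *m g v).

Definition interval_dim (a b v : nat) : nat := (a <= v <= b)%N.

Definition interval_rep (a b : nat) : qrep (interval_dim a b) :=
  fun v => const_mx 1.
Arguments interval_rep : clear implicits.

Definition qsum_dim n (d : 'I_n -> nat -> nat) (v : nat) : nat :=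
  (\sum_(i < n) d i v)%N.

(* conform_mx only transports the diagonal block to the dimensions of (i, j).  *)
Definition qsum n (d : 'I_n -> nat -> nat) (M : forall i, qrep (d i)) :
    qrep (qsum_dim d) :=
  fun v => \mxblock_(i < n, j < n)
    (if i == j then conform_mx (0 : 'M[K]_(d i v.+1, d j v)) (M i v) else 0).

(* In 0-based terms the interval [i, 2n - s_i] is [i + 1, 2n - (s i + 1)].     *)
Definition Vdim n (s : 'S_n) : nat -> nat :=
  qsum_dim (fun i : 'I_n => interval_dim i.+1 (n.*2 - (s i).+1)).

Definition Mrep n (s : 'S_n) : qrep (Vdim s) :=
  qsum (fun i : 'I_n => interval_rep i.+1 (n.*2 - (s i).+1)).

Record dblrep (d : nat -> nat) : Type := DblRep {
  mapT : qrep d;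
  mapB : forall v : nat, 'M[K]_(d v, d v.+1)
}.

(* The equation at index v is the relation at vertex v+1; it is empty for      *)
(* v+1 > 2n-1.                                                                 *)
Definition Lambda d (x : dblrep d) : Prop :=
  forall v, mapT x v *m mapB x v = mapB x v.+1 *m mapT x v.+1.

Inductive coordinate (d : nat -> nat) : Type :=
| CoordT (v : nat) of 'I_(d v.+1) & 'I_(d v)
| CoordB (v : nat) of 'I_(d v) & 'I_(d v.+1).

Definition coord_val d (x : dblrep d) (c : coordinate d) : K :=
  match c with
  | CoordT v i j => mapT x v i j
  | CoordB v i j => mapB x v i j
  end.

(* A polynomial function is a polynomial in finitely many of the coordinates.  *)
Definition polyfun d m (p : {mpoly K[m]}) (c : 'I_m -> coordinate d)
    (x : dblrep d) : K :=
  p.@[fun i => coord_val x (c i)].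

Definition zariski_closure d (S : dblrep d -> Prop) (x : dblrep d) : Prop :=
  forall m (p : {mpoly K[m]}) (c : 'I_m -> coordinate d),
    (forall y, S y -> polyfun p c y = 0) -> polyfun p c x = 0.

Definition component n (s : 'S_n) (x : dblrep (Vdim s)) : Prop :=
  Lambda x /\
  zariski_closure (fun y => Lambda y /\ qrep_iso (mapT y) (@Mrep n s)) x.

Definition pihom d e (x : dblrep d) (y : dblrep e)
    (f : forall v, 'M[K]_(e v, d v)) : Prop :=
  (forall v, f v.+1 *m mapT x v = mapT y v *m f v) /\
  (forall v, f v *m mapB x v = mapB y v *m f v.+1).

(* 0 -> y -f-> E -g-> x -> 0 is a short exact sequence of modules.             *)
Definition short_exact dx dy de
    (y : dblrep dy) (E : dblrep de) (x : dblrep dx)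
    (f : forall v, 'M[K]_(de v, dy v)) (g : forall v, 'M[K]_(dx v, de v)) :
    Prop :=
  [/\ pihom y E f, pihom E x g,
      (forall v, injective (fun u : 'cV[K]_(dy v) => f v *m u)),
      (forall v (w : 'cV[K]_(dx v)), exists u : 'cV[K]_(de v), g v *m u = w)
    & (forall v (u : 'cV[K]_(de v)),
        g v *m u = 0 <-> exists w : 'cV[K]_(dy v), u = f v *m w)].

Definition dbl_sum dy dx (y : dblrep dy) (x : dblrep dx) :
    dblrep (fun v => (dy v + dx v)%N) :=
  @DblRep (fun v => (dy v + dx v)%N)
    (fun v => block_mx (mapT y v) 0 0 (mapT x v))
    (fun v => block_mx (mapB y v) 0 0 (mapB x v)).

Definition ext_equiv dx dy d1 d2 (E1 : dblrep d1) (E2 : dblrep d2)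
    (f1 : forall v, 'M[K]_(d1 v, dy v)) (g1 : forall v, 'M[K]_(dx v, d1 v))
    (f2 : forall v, 'M[K]_(d2 v, dy v)) (g2 : forall v, 'M[K]_(dx v, d2 v)) :
    Prop :=
  exists h : forall v, 'M[K]_(d2 v, d1 v),
    [/\ pihom E1 E2 h, (forall v, h v *m f1 v = f2 v)
      & (forall v, g2 v *m h v = g1 v)].

(* Ext^1(x, y) is the set of equivalence classes of extensions of x by y; its  *)
(* zero element is the class of y (+) x. A middle term E is automatically zero *)
(* outside the range of vertices, by exactness.                                *)
Definition Ext1_eq0 dx dy (x : dblrep dx) (y : dblrep dy) : Prop :=
  forall de (E : dblrep de)
    (f : forall v, 'M[K]_(de v, dy v)) (g : forall v, 'M[K]_(dx v, de v)),
    Lambda E -> short_exact y E x f g ->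
    ext_equiv E (dbl_sum y x) f g
      (fun v => col_mx 1%:M 0) (fun v => row_mx 0 1%:M).

End QuiverRepresentations.

Definition pseudorigid (K : closedFieldType) n (s : 'S_n) : Prop :=
  exists x y : dblrep K (Vdim s),
    [/\ component x, component y & Ext1_eq0 x y].

(* Main.v *)
From HB Require Import structures.
Require Import Defs.
From mathcomp Require Import all_boot all_order all_fingroup all_algebra.
From mathcomp Require Import zify.
From mathcomp Require mpoly.

Set Implicit Arguments.
Unset Strict Implicit.
Unset Printing Implicit Defensive.

(** The statement has a combinatorial half, the inequality n < |Cov s| together
    with connectedness ([critical_covers]), and an algebraic half, which deduces
    from this inequality that no Ext^1 vanishes ([not_pseudorigid_pair]).

    Combinatorics.  View s as a set of points, and call a subset a core if it
    contains the four corners W, N, S, E, is indecomposable, and has none of its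
    corners good.  A critical permutation is indecomposable, is not a tower and
    has no good corner, since otherwise it would be built from smaller
    pseudosmooth permutations; so the whole point set is a core and not a tower
    ([critical_core]).  Every proper core is a pseudosmooth indecomposable
    permutation without good corners, hence a tower ([critical_sub]).  Indecomposability makes the inversion
    graph connected, and every inversion is a chain of minimal ones, so the cover
    graph is connected too ([connected_covers]).

    If n <= 8 there are finitely many cases, which are computed
    ([small_covers]).  Let n >= 9.  Suppose first that S is not to the left of N,
    or that W is not below E.  Then no subset that contains the four corners can
    be decomposable ([no_cut]), so such a subset of at most 8 points is a tower
    as soon as its corners are bad.  Corners and at most four witnesses of their
    badness make such a subset; comparing the corners of s with the corners of
    a tower leaves two arrangements, in which the corners form the base 3412, or
    the corners and an ascent the base 4231.  Take a base Q that contains the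
    corners and is as large as possible.  Adding one or two points to Q gives
    a tower that is not a base, in which two points are twins, that is adjacent in
    position and in value and in decreasing order.  So each outside point is a
    twin of a point of Q, any two outside points are placed relative to each
    other as their twins are, and s itself is a tower ([tower_of_base]), which is
    absurd.  This is [not_separated].

    In the separated case S is to the left of N and W is below E.  A tower never has
    this shape, so the proper cores are excluded: deleting a point outside two
    quadruples A, around W and S, and B, around N and E, that witness the badness
    of the corners makes s decomposable.  Hence every point outside A and B is a
    cut vertex of the inversion graph separating A from B.  It follows that A has
    a unique neighbour outside A, and that A with this neighbour supports a
    cycle of minimal inversions ([quad_cycle], [side_cycle]).  The same holds for
    B after a half turn.  The two cycles share at most one vertex, and a
    connected graph with two such cycles has more edges than vertices
    ([two_cycles_card], [separated_covers]).

    Algebra.  For modules x and y over the preprojective algebra with the same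
    dimension vector d, consider the complex
      (+)_v Hom(x_v, y_v) -> (+)_v Hom(x_v, y_{v+1}) (+) Hom(x_{v+1}, y_v)
        -> (+)_v Hom(x_{v+1}, y_{v+1})
    whose kernel on the left is Hom(x, y) and whose middle homology embeds
    in Ext^1(x, y).  By trace duality its cokernel on the right is dual to
    Hom(y, x).  The middle term has dimension 2 (sum of d_v^2) - 2 n, because the
    Tits form of d = (1, 2, ..., n, ..., 2, 1) is n ([Vdim_tits]).  If
    Ext^1(x, y) = 0, exactness in the middle forces the two ranks to add up to at
    least this number ([ext_rank]).  When the underlying representations of x and
    y are isomorphic to M, the backward maps only connect an interval to intervals
    that form an inversion with it, and the endomorphisms of M supported on
    inversions fail to commute with the backward maps only along products of two
    inversions, that is at non-minimal inversions.  There remain at least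
    |inversions| - |non-minimal inversions| = |Cov s| independent homomorphisms
    x -> y ([hom_space]), so that both ranks are at most the sum of the d_v^2
    minus |Cov s|.  An upper bound on a rank is the vanishing of minors and passes
    to the Zariski closure ([closure_rank]), so it holds for all x and y in the
    component.  If |Cov s| > n, the two ranks are too small. *)

(** * Connected graphs with many edges *)

Section OrientedGraph.
Variable T : finType.
Implicit Types (E F : {set T * T}) (x y z : T) (c : seq T).

(** Edges are stored with one of their two orientations, so that [#|E|] counts
    them; this is how minimal inversions are stored as pairs of positions. *)
Definition edge_rel E : rel T := [rel x y | ((x, y) \in E) || ((y, x) \in E)].

Definition oriented E := forall x y, (x, y) \in E -> (y, x) \notin E.

Lemma edge_rel_sym E : symmetric (edge_rel E).
Proof. by move=> x y; rewrite /edge_rel /= orbC. Qed.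

Lemma edge_rel_csym E : connect_sym (edge_rel E).
Proof. exact: sym_connect_sym (@edge_rel_sym E). Qed.

Lemma edge_relS E F : E \subset F -> subrel (edge_rel E) (edge_rel F).
Proof. by move=> /subsetP sEF x y /orP[] /sEF e; rewrite /edge_rel /= e ?orbT. Qed.

Lemma oriented_irr E x : oriented E -> edge_rel E x x = false.
Proof.
move=> oE; rewrite /edge_rel /= orbb; apply/negP => e.
by move: (oE _ _ e); rewrite e.
Qed.

Lemma orientedS E F : F \subset E -> oriented E -> oriented F.
Proof.
move=> /subsetP sFE oE x y /sFE /oE; apply: contra; exact: sFE.
Qed.

(** Grow a connected vertex set one vertex and one edge at a time: an edge
    leaves every proper vertex set that is not empty. *)
Lemma spanning_tree E : 0 < #|T| -> connected_graph (edge_rel E) ->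
  exists F, [/\ F \subset E, #|F| = #|T|.-1 & connected_graph (edge_rel F)].
Proof.
move=> T0 cE.
suff grow m : m < #|T| -> exists (X : {set T}) F,
    [/\ F \subset E, #|X| = m.+1, #|F| = m, F \subset setX X X
      & {in X &, forall x y, connect (edge_rel F) x y}].
  have [|X [F [sFE cX cF _ conF]]] := grow #|T|.-1; first by rewrite prednK.
  exists F; split=> // x y.
  have XT : X = setT.
    by apply/eqP; rewrite eqEcard subsetT /= cardsT cX prednK.
  by apply: conF; rewrite XT inE.
elim: m => [_ | m IHm ltmT].
  have /card_gt0P[r _] := T0.
  exists [set r], set0; split; rewrite ?sub0set ?cards1 ?cards0 //.
  by move=> x y /set1P-> /set1P->; apply: connect0.
have [X [F [sFE cX cF sFX conF]]] := IHm (ltnW ltmT).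
have [a aX [b bX eab]] : exists2 a, a \in X & exists2 b, b \notin X & edge_rel E a b.
  have /card_gt0P[r rX] : 0 < #|X| by rewrite cX.
  have /subsetPn[y _ yX] : ~~ ([set: T] \subset X).
    apply: contraL ltmT => /subset_leq_card; rewrite cardsT cX.
    by rewrite -leqNgt.
  case: (altP (@forallP _ (fun a => [forall b, (a \in X) && (edge_rel E a b) ==> (b \in X)]))).
    move=> clX; suff: y \in X by rewrite (negbTE yX).
    have clo : closed (edge_rel E) (mem X).
      apply: (intro_closed (@edge_rel_csym E)) => u w euw uX.
      by have /forallP/(_ w) := clX u; rewrite uX euw.
    by have := closed_connect clo (cE r y); rewrite rX => <-.
  rewrite negb_forall => /existsP[a]; rewrite negb_forall => /existsP[b].
  rewrite negb_imply => /andP[/andP[aX eab] bX].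
  by exists a => //; exists b.
have [f fE fab] : exists2 f, f \in E & f = (a, b) \/ f = (b, a).
  by case/orP: eab => e; [exists (a, b) | exists (b, a)] => //; [left|right].
have fF : f \notin F.
  by apply/negP => /(subsetP sFX); case: fab => ->; rewrite !inE /= (negbTE bX) ?andbF.
exists (b |: X), (f |: F); split.
- by rewrite subUset sub1set fE.
- by rewrite cardsU1 bX cX.
- by rewrite cardsU1 fF cF.
- rewrite subUset sub1set; apply/andP; split.
    by case: fab => ->; rewrite !inE /= eqxx aX ?orbT.
  apply: (subset_trans sFX); apply/subsetP=> -[u w]; rewrite !inE /=.
  by case/andP=> -> ->; rewrite !orbT.
have sub : subrel (connect (edge_rel F)) (connect (edge_rel (f |: F))).
  apply: connect_sub => x y exy; apply: connect1.
  by apply: edge_relS exy; rewrite subsetUr.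
have cab : connect (edge_rel (f |: F)) a b.
  by apply: connect1; rewrite /edge_rel /= !inE; case: fab => ->; rewrite eqxx ?orbT.
have ca x : x \in b |: X -> connect (edge_rel (f |: F)) a x.
  by case/setU1P => [-> // | xX]; apply/sub/conF.
move=> x y xX yX; apply: connect_trans (ca _ yX).
by rewrite edge_rel_csym; apply: ca.
Qed.

Lemma connected_card E : connected_graph (edge_rel E) -> #|T|.-1 <= #|E|.
Proof.
move=> cE; have [T0|] := posnP #|T|; first by rewrite T0.
by move=> /spanning_tree/(_ cE)[F [sFE <- _]]; apply: subset_leq_card.
Qed.

Lemma non_bridge_cycle E e : oriented E -> e \in E ->
  connect (edge_rel (E :\ e)) e.1 e.2 -> exists c, graph_cycle (edge_rel E) c.
Proof.
case: e => u w oE eE /= /connectP[p pth wp].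
case/shortenP: pth wp => p' pth' up' _ wp.
exists (u :: p'); rewrite /graph_cycle /ucycleb up' andbT.
have sub : subrel (edge_rel (E :\ (u, w))) (edge_rel E) by apply: edge_relS; rewrite subsetDl.
have -> /= : path.cycle (edge_rel E) (u :: p').
  rewrite /= rcons_path (sub_path sub pth') /= -wp /edge_rel /=.
  by rewrite eE orbT.
case: p' pth' up' wp => [|a [|b p']] //= pth' up' wp.
  by subst w; move: (oE _ _ eE); rewrite eE.
move: pth'; rewrite andbT -wp /edge_rel /= !in_setD1 eqxx /=.
by rewrite (negbTE (oE _ _ eE)) andbF.
Qed.

(** The rest of the cycle joins the ends of the deleted edge. *)
Lemma cycle_edge_connect E c x (e : T * T) : oriented E ->
  graph_cycle (edge_rel E) c -> x \in c ->
  e = (x, next c x) \/ e = (next c x, x) ->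
  connect (edge_rel (E :\ e)) x (next c x).
Proof.
move=> oE /andP[szc /andP[cyc uc]] xc De.
have [i p Dc] := rot_to xc.
have cyc' : path.cycle (edge_rel E) (x :: p) by rewrite -Dc rot_cycle.
have uc' : uniq (x :: p) by rewrite -Dc rot_uniq.
have szp : 2 < size (x :: p) by rewrite -Dc size_rot.
have nx : next c x = next (x :: p) x by rewrite -Dc next_rot.
case: p {Dc} => [|y p] // in nx cyc' uc' szp *.
rewrite /= eqxx in nx; rewrite nx in De *.
move: cyc' => /= /andP[exy]; rewrite rcons_path => /andP[pth elx].
have [xp yp] : x \notin y :: p /\ y \notin p.
  by move: uc' => /= /andP[-> /andP[-> _]].
have inE2 a b : edge_rel E a b -> (a, b) != (x, y) -> (a, b) != (y, x) ->
    edge_rel (E :\ e) a b.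
  move=> eab n1 n2; have [n3 n4] : (a, b) != e /\ (b, a) != e.
    by case: De => ->; rewrite ?n1 ?n2 !xpair_eqE /= ![(b == _) && _]andbC -!xpair_eqE ?n1 ?n2.
  by rewrite /edge_rel /= !in_setD1 n3 n4.
have cyl q a : path (edge_rel E) a q -> x \notin a :: q ->
    connect (edge_rel (E :\ e)) a (last a q).
  elim: q a => [|b q IHq] a /=; first by rewrite connect0.
  move=> /andP[eab pq]; rewrite inE negb_or => /andP[xa xq].
  apply: connect_trans (IHq _ pq xq); apply/connect1/inE2 => //.
    by rewrite xpair_eqE eq_sym (negbTE xa).
  have /negbTE xb : b != x by apply: contraNneq xq => ->; rewrite mem_head.
  by rewrite xpair_eqE xb andbF.
rewrite edge_rel_csym; apply: connect_trans (cyl _ _ pth xp) _.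
apply/connect1/inE2 => //; rewrite xpair_eqE.
  have /negbTE-> // : last y p != x by apply: contraNneq xp => <-; rewrite mem_last.
rewrite eqxx andbT.
case: p yp {xp pth elx cyl uc' szc cyc} szp => // a p yp _ /=; case: eqP => // Dl.
by move: yp; rewrite -Dl mem_last.
Qed.

Lemma connected_remove E e : connected_graph (edge_rel E) ->
  connect (edge_rel (E :\ e)) e.1 e.2 -> connected_graph (edge_rel (E :\ e)).
Proof.
move=> cE ce x y; have := cE x y.
apply: connect_sub => {x y} x y exy.
have [exy'|] := boolP (edge_rel (E :\ e) x y); first exact: connect1.
move: exy; rewrite /edge_rel /= !in_setD1 => /orP[] ->; rewrite andbT negb_or negbK.
  by case/andP=> /eqP De _; rewrite -De in ce *.
by case/andP=> _ /eqP De; rewrite edge_rel_csym; rewrite -De in ce *.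
Qed.

Lemma cycle_of_card E : 0 < #|T| -> oriented E -> connected_graph (edge_rel E) ->
  #|T| <= #|E| -> exists c, graph_cycle (edge_rel E) c.
Proof.
move=> T0 oE cE leTE; have [F [sFE cF conF]] := spanning_tree T0 cE.
have /subsetPn[e eE eF] : ~~ (E \subset F).
  apply: contraL leTE => /subset_leq_card; rewrite cF -ltnNge => leEF.
  by apply: leq_ltn_trans leEF _; rewrite prednK.
apply: (non_bridge_cycle oE eE).
have : connect (edge_rel F) e.1 e.2 by apply: conF.
apply: connect_sub => x y exy; apply: connect1; apply: edge_relS exy.
apply/subsetP=> f fF; rewrite in_setD1 (subsetP sFE) // andbT.
by apply: contraNneq eF => <-.
Qed.

Lemma cycle_edge_of E c x : graph_cycle (edge_rel E) c -> x \in c ->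
  exists2 e, e \in E & e = (x, next c x) \/ e = (next c x, x).
Proof.
move=> /andP[_ /andP[cyc _]] xc; have := next_cycle cyc xc.
by rewrite /edge_rel /= => /orP[] eE; [exists (x, next c x)|exists (next c x, x)] => //; [left|right].
Qed.

(** A cycle exists, and after one of its edges is deleted the graph is still
    connected with at least as many edges as vertices: it has another cycle,
    which avoids that edge. *)
Lemma not_pseudotree E : 0 < #|T| -> oriented E -> connected_graph (edge_rel E) ->
  #|T| < #|E| -> ~ pseudotree (edge_rel E).
Proof.
move=> T0 oE cE ltTE [_ onec].
have [c1 c1P] := cycle_of_card T0 oE cE (ltnW ltTE).
have [x xc] : exists x, x \in c1.
  by case: (c1) c1P => // a c _; exists a; rewrite mem_head.
have [e eE De] := cycle_edge_of c1P xc.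
have sE : E :\ e \subset E by rewrite subsetDl.
have ce : connected_graph (edge_rel (E :\ e)).
  apply: connected_remove cE _; have cn := cycle_edge_connect oE c1P xc De.
  by case: De cn => -> //=; rewrite edge_rel_csym.
have [c2 c2P] : exists c, graph_cycle (edge_rel (E :\ e)) c.
  apply: cycle_of_card => //; first exact: orientedS oE.
  by rewrite (cardsD1 e E) eE add1n ltnS in ltTE.
have c2P' : graph_cycle (edge_rel E) c2.
  move: c2P => /andP[sz /andP[cyc uc]]; rewrite /graph_cycle /ucycleb sz uc andbT /=.
  by apply: sub_cycle cyc; apply: edge_relS.
have : [set x; next c1 x] \in cycle_edges c1 by apply: imset_f.
rewrite (onec _ _ c1P c2P') => /imsetP[y yc2 Dxy].
have [f fE Df] := cycle_edge_of c2P yc2.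
have fE' := subsetP sE _ fE.
suff [Def|Def] : f = e \/ f = (e.2, e.1).
- by rewrite Def !inE eqxx in fE.
- by move: fE' (oE e.1 e.2); rewrite Def -surjective_pairing eE => -> /(_ isT).
have nxy (a b a' b' : T) : [set a; b] = [set a'; b'] ->
   (a' = a /\ b' = b) \/ (a' = b /\ b' = a).
  move=> eqs; have : a \in [set a'; b'] by rewrite -eqs !inE eqxx.
  have : b \in [set a'; b'] by rewrite -eqs !inE eqxx orbT.
  have : a' \in [set a; b] by rewrite eqs !inE eqxx.
  have : b' \in [set a; b] by rewrite eqs !inE eqxx orbT.
  by rewrite !inE => /orP[]/eqP-> /orP[]/eqP-> /orP[]/eqP Eb /orP[]/eqP Ea; rewrite ?Ea ?Eb; auto.
by case: (nxy _ _ _ _ Dxy) => -[y1 y2]; move: Df De; rewrite y2 y1 => -[] -> [] ->; auto.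
Qed.

(** Deleting an edge of the first cycle leaves the second one intact, because an
    edge of both would give two common vertices.  Deleting an edge of the second
    cycle too leaves a connected graph, with at least [#|T|.-1] edges. *)
Lemma two_cycles_card E c1 c2 : 0 < #|T| -> oriented E ->
  connected_graph (edge_rel E) ->
  graph_cycle (edge_rel E) c1 -> graph_cycle (edge_rel E) c2 ->
  {in c1 & c1, forall x y, x \in c2 -> y \in c2 -> x = y} ->
  #|T| < #|E|.
Proof.
move=> T0 oE cE c1P c2P share.
have [x xc] : exists x, x \in c1.
  by case: (c1) c1P => // a c _; exists a; rewrite mem_head.
have [y yc] : exists y, y \in c2.
  by case: (c2) c2P => // a c _; exists a; rewrite mem_head.
have [e eE De] := cycle_edge_of c1P xc.
have ce : connected_graph (edge_rel (E :\ e)).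
  apply: connected_remove cE _; have cn := cycle_edge_connect oE c1P xc De.
  by case: De cn => -> //=; rewrite edge_rel_csym.
have oe : oriented (E :\ e) by apply: orientedS oE; rewrite subsetDl.
have c2P' : graph_cycle (edge_rel (E :\ e)) c2.
  move: (c2P) => /andP[sz /andP[cyc uc]]; rewrite /graph_cycle /ucycleb sz uc andbT /=.
  apply: (cycle_from_next uc) => z zc2.
  have nz : next c2 z \in c2 by rewrite mem_next.
  have ezn := next_cycle cyc zc2.
  have nzz : z != next c2 z.
    by apply: contraTneq ezn => <-; rewrite oriented_irr.
  have nc1 : next c1 x \in c1 by rewrite mem_next.
  have notboth u w : (u, w) \in [:: (x, next c1 x); (next c1 x, x)] ->
      u \in c2 -> w \in c2 -> u = w.
    by rewrite !inE => /orP[]/eqP[-> ->]; apply: share.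
  have De' : e \in [:: (x, next c1 x); (next c1 x, x)].
    by case: De => ->; rewrite !inE eqxx ?orbT.
  have [n1 n2] : (z, next c2 z) != e /\ (next c2 z, z) != e.
    split; apply: contraNneq nzz => Dz; [|rewrite eq_sym]; apply/eqP;
      by apply: notboth; rewrite ?Dz.
  by rewrite /edge_rel /= !in_setD1 n1 n2.
have [f fE Df] := cycle_edge_of c2P' yc.
have oe' : oriented ((E :\ e) :\ f) by apply: orientedS oe; rewrite subsetDl.
have cef : connected_graph (edge_rel ((E :\ e) :\ f)).
  apply: connected_remove ce _; have cn := cycle_edge_connect oe c2P' yc Df.
  by case: Df cn => -> //=; rewrite edge_rel_csym.
have := connected_card cef.
rewrite (cardsD1 e E) eE (cardsD1 f (E :\ e)) fE !add1n.
by rewrite -{2}(prednK T0) !ltnS.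
Qed.
End OrientedGraph.

(** * Point sets, towers and twins *)

Section Points.
Variables (T : finType) (p v : T -> nat).
Implicit Types (A D Q : {set T}) (x y z r : T).

(** A point [x] has position [p x] and value [v x].  Working with point sets
    rather than permutations makes sub-patterns mere subsets, and a half turn
    a change of [p] and [v]. *)
Definition dominates x y := (p x < p y) && (v y < v x).
Definition inverted x y := dominates x y || dominates y x.

(** [D] cuts [A] when the pattern on [A] is the direct sum of the parts inside
    and outside [D]. *)
Definition cut A D :=
  [/\ exists2 x, x \in A & x \in D, exists2 y, y \in A & y \notin D
    & {in A &, forall x y, x \in D -> y \notin D -> (p x < p y) && (v x < v y)}].

(** The window of a corner fails to be decreasing, that is the corner fails to be
    good, exactly when there is an ascent in it; [bad_low] concerns the corners W
    and N, [bad_high] the corners S and E. *)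
Definition ascent A (P : pred T) :=
  exists x y, [/\ x \in A, y \in A, P x, P y & (p x < p y) && (v x < v y)].

Definition bad_low A d := ascent A (dominates d).
Definition bad_high A d := ascent A (dominates^~ d).

Lemma ascentS A Q P : A \subset Q -> ascent A P -> ascent Q P.
Proof.
move=> /subsetP sAQ [x [y [xA yA Px Py lt]]].
by exists x, y; split=> //; apply: sAQ.
Qed.

(** [b] tells for each point of [A] from which entry of [q] it is inflated; two
    points with the same label are in decreasing order because
    [nth 0 q (b x) < nth 0 q (b y)] is then false. *)
Definition blocks A (q : seq nat) (b : T -> nat) :=
  [/\ forall x, x \in A -> b x < size q,
      forall j, j < size q -> exists2 x, x \in A & b x = j
    & {in A &, forall x y, p x < p y ->
        b x <= b y /\ (v x < v y) = (nth 0 q (b x) < nth 0 q (b y))}].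

Definition tower_on A := exists2 q, q \in tower_bases & exists b, blocks A q b.

Definition base_on A :=
  exists2 q, q \in tower_bases & exists2 b, blocks A q b & {in A &, injective b}.

(** Twins are two points that could belong to the same block of an inflation:
    they form an inversion, and no point of [A] separates them in position or in
    value. *)
Definition twin A x y := inverted x y &&
  [forall r in A, (r != x) && (r != y) ==>
     ((p r < p x) == (p r < p y)) && ((v r < v x) == (v r < v y))].

Hypotheses (p_inj : injective p) (v_inj : injective v).

Lemma twinP A x y : reflect (inverted x y /\ forall r, r \in A -> r <> x -> r <> y ->
   (p r < p x) = (p r < p y) /\ (v r < v x) = (v r < v y)) (twin A x y).
Proof.
apply: (iffP andP) => -[ixy H]; split=> //.
  move=> r rA /eqP rx /eqP ry; move/forall_inP/(_ r rA): H.
  by rewrite rx ry /= => /andP[/eqP-> /eqP->].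
apply/forall_inP=> r rA; apply/implyP => /andP[/eqP rx /eqP ry].
by have [-> ->] := H r rA rx ry; rewrite !eqxx.
Qed.

Lemma inv_sym x y : inverted x y = inverted y x.
Proof. by rewrite /inverted orbC. Qed.

Lemma inv_irr x : inverted x x = false.
Proof. by rewrite /inverted /dominates ltnn. Qed.

Lemma twin_sym A x y : twin A x y -> twin A y x.
Proof.
move=> /twinP[ixy H]; apply/twinP; rewrite inv_sym; split=> // r rA ry rx.
by have [-> ->] := H r rA rx ry.
Qed.

Lemma twinS A Q x y : Q \subset A -> twin A x y -> twin Q x y.
Proof.
move=> /subsetP sQA /twinP[ixy H]; apply/twinP; split=> // r /sQA; exact: H.
Qed.

Lemma twin_rel A x y r : twin A x y -> r \in A -> r <> x -> r <> y ->
  [/\ (p r < p x) = (p r < p y), (v r < v x) = (v r < v y),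
      (p x < p r) = (p y < p r) & (v x < v r) = (v y < v r)].
Proof.
move=> /twinP[_ H] rA rx ry; have [h1 h2] := H r rA rx ry.
have px : p r <> p x by move/p_inj.
have py : p r <> p y by move/p_inj.
have vx : v r <> v x by move/v_inj.
have vy : v r <> v y by move/v_inj.
by split=> //; lia.
Qed.

Lemma pneq x y : x <> y -> p x <> p y. Proof. by move=> n /p_inj. Qed.
Lemma vneq x y : x <> y -> v x <> v y. Proof. by move=> n /v_inj. Qed.

Lemma base_uniq q : q \in tower_bases -> uniq q.
Proof. by move: q; apply/allP. Qed.

Lemma base_size q : q \in tower_bases -> 4 <= size q <= 6.
Proof. by move: q; apply/allP. Qed.

Lemma blocks_mono A q b x y : blocks A q b -> x \in A -> y \in A ->
  p x <= p y -> b x <= b y.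
Proof.
move=> [_ _ H] xA yA; rewrite leq_eqVlt => /orP[/eqP/p_inj-> //|].
by move=> /(H _ _ xA yA)[].
Qed.

Lemma blocks_val A q b x y : q \in tower_bases ->
  blocks A q b -> x \in A -> y \in A ->
  v x <= v y -> nth 0 q (b x) <= nth 0 q (b y).
Proof.
move=> qb [bs _ H] xA yA; rewrite leq_eqVlt => /orP[/eqP/v_inj-> //|lt].
case: (ltngtP (p x) (p y)) => [pl|pl|/p_inj->//].
  by have [_ e] := H _ _ xA yA pl; rewrite lt in e; apply/ltnW.
have [_ e] := H _ _ yA xA pl.
by rewrite leqNgt -e -leqNgt ltnW.
Qed.

Lemma blocks_eq A q b x y : blocks A q b -> x \in A -> y \in A ->
  p x < p y -> b x = b y -> v y < v x.
Proof.
move=> [_ _ H] xA yA lt e; have [_] := H _ _ xA yA lt; rewrite e ltnn => /negbT.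
rewrite -leqNgt leq_eqVlt => /orP[/eqP/v_inj yx|//].
by rewrite yx ltnn in lt.
Qed.

Lemma blocks_neq A q b x y : q \in tower_bases -> blocks A q b ->
  x \in A -> y \in A -> b x <> b y ->
  (p x < p y) = (b x < b y) /\ (v x < v y) = (nth 0 q (b x) < nth 0 q (b y)).
Proof.
move=> qb B xA yA neq; have [bs _ H] := B.
have nq : nth 0 q (b x) <> nth 0 q (b y).
  by move/eqP; rewrite nth_uniq ?bs ?base_uniq // => /eqP.
case: (ltngtP (p x) (p y)) => [pl|pl|/p_inj xy].
- by have [? ?] := H _ _ xA yA pl; lia.
- have [? ?] := H _ _ yA xA pl.
  have := @vneq x y; have ? : x <> y by move=> e; rewrite e ltnn in pl.
  by move/(_ ltac:(done)); lia.
- by rewrite xy in neq.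
Qed.

Lemma base_neq_lt Q q b x y : q \in tower_bases -> blocks Q q b ->
  {in Q &, injective b} -> x \in Q -> y \in Q ->
  (p x < p y) = (b x < b y) /\ (v x < v y) = (nth 0 q (b x) < nth 0 q (b y)).
Proof.
move=> qb B inj xQ yQ; have [->|/eqP ne] := eqVneq x y; first by rewrite !ltnn.
by apply: blocks_neq B _ _ _ => // /(inj _ _ xQ yQ).
Qed.

(** A form of [base_no_twin] that can be computed. *)
Definition twin_free (q : seq nat) :=
  all (fun j => all (fun i => (nth 0 q i < nth 0 q j) ||
     has (fun r : nat => [&& r != i, r != j & ((r < i) != (r < j)) ||
        ((nth 0 q r < nth 0 q i) != (nth 0 q r < nth 0 q j))]) (iota 0 (size q)))
   (iota 0 j)) (iota 0 (size q)).

Lemma base_twin_free q : q \in tower_bases -> twin_free q.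
Proof. by move: q; apply/allP. Qed.

(** No tower base has two adjacent entries with consecutive decreasing values. *)
Lemma base_no_twin Q x y : base_on Q -> x \in Q -> y \in Q -> ~ twin Q x y.
Proof.
move=> [q qb [b B inj]] xQ yQ.
wlog dxy : x y xQ yQ / dominates x y => [IH tw|].
  have /twinP[/orP[dxy|dyx] _] := tw; first exact: (IH x y).
  by apply: (IH y x) => //; apply: twin_sym.
move=> /twinP[_ H]; have [px vx] := andP dxy.
have [e1 e2] := base_neq_lt qb B inj xQ yQ; rewrite px in e1.
have [bs sur _] := B.
have /allP/(_ (b y)) := base_twin_free qb; rewrite mem_iota bs // => /(_ isT).
move=> /allP/(_ (b x)); rewrite mem_iota -e1 -e2 => /(_ isT).
rewrite ltnNge (ltnW vx) /= => /hasP[r]; rewrite mem_iota /= => rs.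
have [z zQ bz] := sur r rs; rewrite -bz => /and3P[/eqP zx /eqP zy].
have [||h1 h2] := H z zQ; try by move=> e; rewrite e in zx zy.
have [a1 a2] := base_neq_lt qb B inj zQ xQ.
have [b1 b2] := base_neq_lt qb B inj zQ yQ.
by rewrite -a1 -b1 -a2 -b2 h1 h2 !eqxx.
Qed.

(** Of the pairs of points in a common block, one at the smallest distance
    consists of twins. *)
Lemma tower_twin A : tower_on A -> ~ base_on A ->
  exists x y, [/\ x \in A, y \in A & twin A x y].
Proof.
move=> [q qb [b B]] nb.
have [d dP] : exists d, [exists x in A, exists y in A,
    [&& b x == b y, p x < p y & p y == p x + d]].
  have : ~~ [forall x in A, forall y in A, (b x == b y) ==> (x == y)].
    apply/negP => inj; apply: nb; exists q => //; exists b => // x y xA yA bxy.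
    move: inj => /forall_inP/(_ x xA)/forall_inP/(_ y yA).
    by rewrite bxy eqxx => /eqP.
  rewrite negb_forall => /existsP[x]; rewrite negb_imply => /andP[xA].
  rewrite negb_forall => /existsP[y]; rewrite negb_imply => /andP[yA].
  rewrite negb_imply => /andP[bxy /eqP/pneq nxy].
  have [lt|lt|//] := ltngtP (p x) (p y).
    exists (p y - p x); apply/exists_inP; exists x => //.
    by apply/exists_inP; exists y => //; rewrite bxy lt /=; lia.
  exists (p x - p y); apply/exists_inP; exists y => //.
  by apply/exists_inP; exists x => //; rewrite eq_sym bxy lt /=; lia.
have ex : exists d, [exists x in A, exists y in A,
    [&& b x == b y, p x < p y & p y == p x + d]] by exists d.
case: (ex_minnP ex) => {dP ex}d /exists_inP[x xA /exists_inP[y yA]].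
move=> /and3P[/eqP bxy pxy /eqP Dd] dmin.
have vyx := blocks_eq B xA yA pxy bxy.
have closer x' y' : x' \in A -> y' \in A -> b x' = b y' -> p x' < p y' ->
    p y - p x <= p y' - p x'.
  move=> xA' yA' bxy' lt'; have := dmin (p y' - p x').
  rewrite Dd addKn; apply; apply/exists_inP; exists x' => //.
  by apply/exists_inP; exists y' => //; rewrite bxy' eqxx lt' /=; lia.
exists x, y; split=> //; apply/twinP; rewrite /inverted /dominates pxy vyx; split=> // r rA rx ry.
have := pneq rx; have := pneq ry; have := vneq rx; have := vneq ry => vry vrx pry prx.
have [bre|/eqP bre] := eqVneq (b r) (b x).
  have bry : b r = b y by rewrite bre.
  have := closer r y rA yA bry; have := closer x r xA rA (esym bre).
  have := @blocks_eq _ _ _ x r B xA rA; have := @blocks_eq _ _ _ r x B rA xA.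
  have := @blocks_eq _ _ _ y r B yA rA; have := @blocks_eq _ _ _ r y B rA yA.
  rewrite bre bxy; lia.
have [-> ->] := blocks_neq qb B rA xA bre.
by have [|-> ->] := blocks_neq qb B rA yA; rewrite -bxy.
Qed.

(** Each outside point [x] is a twin, inside [x |: Q], of a point [par x] of [Q].
    The tower on [x |: (y |: Q)] contains twins as well, and the fact that [Q] has
    none shows that [x] and [y] are placed relative to each other as [par x] and
    [par y] are, or form an inversion if [par x = par y].  Then the labelling of
    [Q] composed with [par] labels all points. *)
Lemma tower_of_base Q : base_on Q ->
  (forall x, x \notin Q -> tower_on (x |: Q) /\ ~ base_on (x |: Q)) ->
  (forall x y, x \notin Q -> y \notin Q -> x != y ->
     tower_on (x |: (y |: Q)) /\ ~ base_on (x |: (y |: Q))) ->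
  tower_on setT.
Proof.
move=> baseQ one two.
have nt := fun x y => @base_no_twin Q x y baseQ.
have ex_par x : exists a, (a \in Q) && (if x \in Q then x == a else twin (x |: Q) x a).
  have [xQ|xQ] := boolP (x \in Q); first by exists x; rewrite xQ eqxx.
  have [tx nbx] := one x xQ.
  have [u [w [uX wX tw]]] := tower_twin tx nbx.
  have sQ : Q \subset x |: Q by rewrite subsetUr.
  case/setU1P: uX wX tw => [->|uQ] /setU1P[->|wQ] tw.
  - by move: tw => /twinP[]; rewrite inv_irr.
  - by exists w; rewrite wQ.
  - by exists u; rewrite uQ; apply: twin_sym.
  - by case: (nt _ _ uQ wQ); apply: twinS tw.
have [par parP] := fin_all_exists ex_par.
have parQ x : par x \in Q by have /andP[] := parP x.
have parid x : x \in Q -> par x = x.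
  by move=> xQ; have /andP[_] := parP x; rewrite xQ => /eqP.
have part x : x \notin Q -> twin (x |: Q) x (par x).
  by move=> xQ; have /andP[_] := parP x; rewrite (negbTE xQ).
have part1 x y : x \notin Q -> y \in Q -> y <> par x ->
    [/\ (p y < p x) = (p y < p (par x)), (v y < v x) = (v y < v (par x)),
        (p x < p y) = (p (par x) < p y) & (v x < v y) = (v (par x) < v y)].
  move=> xQ yQ ya; have yx : y <> x by move=> e; rewrite -e yQ in xQ.
  by apply: twin_rel (part x xQ) _ yx ya; rewrite inE yQ orbT.
have key1 x y : x \notin Q -> y \in Q -> if par x == y then is_true (inverted x y)
  else (p x < p y) = (p (par x) < p y) /\ (v x < v y) = (v (par x) < v y).
  move=> xQ yQ; case: eqP => [<-|ne]; first by have /twinP[] := part x xQ.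
  by have [|//] := part1 x y xQ yQ; move=> e; rewrite e in ne.
(* Twins [x] and [z] in [x |: (y |: Q)] with [z] in [Q] force [z = par x], as
   otherwise [z] and [par x] would be twins in [Q]. *)
have key2 x y z : x \notin Q -> y \notin Q -> x <> y -> z \in Q ->
  twin (x |: (y |: Q)) x z ->
  if par x == par y then is_true (inverted x y)
  else (p x < p y) = (p (par x) < p (par y)) /\ (v x < v y) = (v (par x) < v (par y)).
  move=> xQ yQ xy zQ tw.
  have [ez|/eqP nz] := eqVneq z (par x); last first.
    case: (nt (par x) z (parQ x) zQ).
    have zx : z <> x by move=> e; rewrite -e zQ in xQ.
    have [i1 _] := twinP _ _ _ tw; have [a1 a2 a3 a4] := part1 x z xQ zQ nz.
    apply/twinP; split; first by move: i1; rewrite /inverted /dominates a1 a2 a3 a4.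
    move=> r rQ ra rz; have [b1 b2 b3 b4] := part1 x r xQ rQ ra.
    have rx : r <> x by move=> e; rewrite -e rQ in xQ.
    have [|c1 c2 _ _] := twin_rel tw _ rx rz; first by rewrite !inE rQ !orbT.
    by rewrite -b1 -b2.
  rewrite {}ez in tw.
  have yx : y <> x by move=> e; apply: xy; rewrite e.
  have ypx : y <> par x by move=> e; move: yQ; rewrite e parQ.
  have [|c1 c2 c3 c4] := twin_rel tw _ yx ypx; first by rewrite !inE eqxx orbT.
  have := key1 y (par x) yQ (parQ x); rewrite [par y == _]eq_sym.
  case: eqP => [_|ne]; first by rewrite /inverted /dominates c1 c2 c3 c4 orbC.
  rewrite c3 c4 => -[d1 d2].
  have ? := pneq ypx; have ? := vneq ypx; have ? := pneq ne; have ? := vneq ne; split; lia.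
have key x y : x != y ->
  if par x == par y then is_true (inverted x y)
  else (p x < p y) = (p (par x) < p (par y)) /\ (v x < v y) = (v (par x) < v (par y)).
  move=> xy; have [xQ|xQ] := boolP (x \in Q); have [yQ|yQ] := boolP (y \in Q).
  - by rewrite !parid // (negbTE xy).
  - have := key1 y x yQ xQ; rewrite (parid x xQ) eq_sym; case: eqP => [e|ne [a1 a2]].
      by rewrite inv_sym.
    have ? : x <> y by apply/eqP.
    have ? : p x <> p y by apply: pneq.
    have ? : v x <> v y by apply: vneq.
    have := pneq ne; have := vneq ne; lia.
  - by have := key1 x y xQ yQ; rewrite (parid y yQ).
  have [txy nbxy] := two x y xQ yQ xy.
  have [u [w [uX wX tw]]] := tower_twin txy nbxy.
  have xy' : x <> y by apply/eqP.
  have yx' : y <> x by move=> e; apply: xy'; rewrite e.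
  have comm : y |: (x |: Q) = x |: (y |: Q) by rewrite setUCA.
  have sQ : Q \subset x |: (y |: Q) by rewrite setUA subsetUr.
  have k2x z : z \in Q -> twin (x |: (y |: Q)) x z -> _ := key2 x y z xQ yQ xy'.
  have k2y z : z \in Q -> twin (x |: (y |: Q)) y z ->
    if par x == par y then is_true (inverted x y)
    else (p x < p y) = (p (par x) < p (par y)) /\ (v x < v y) = (v (par x) < v (par y)).
    move=> zQ; rewrite -comm => /(key2 y x z yQ xQ yx' zQ); rewrite eq_sym.
    case: eqP => [_|ne [a1 a2]]; first by rewrite inv_sym.
    have := pneq xy'; have := vneq xy'; have := pneq ne; have := vneq ne; lia.
  have txy2 : twin (x |: (y |: Q)) x y ->
    if par x == par y then is_true (inverted x y)
    else (p x < p y) = (p (par x) < p (par y)) /\ (v x < v y) = (v (par x) < v (par y)).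
    move=> t; case: eqP => [_|ne]; first by have /twinP[] := t.
    case: (nt (par x) (par y) (parQ x) (parQ y)).
    have h z : z \in Q -> z <> x /\ z <> y.
      by move=> zQ; split=> e; rewrite e in zQ; rewrite ?(negbTE xQ) ?(negbTE yQ) in zQ.
    have ne' : par y <> par x by move=> e; apply: ne.
    have [a1 a2 a3 a4] := part1 x (par y) xQ (parQ y) ne'.
    have [hx hy] := h _ (parQ y).
    have [|b1 b2 b3 b4] := twin_rel t _ hx hy; first by rewrite !inE parQ !orbT.
    have /twinP[iy _] := part y yQ.
    apply/twinP; split; first by move: iy; rewrite /inverted /dominates -a1 -a2 -a3 -a4 b1 b2 b3 b4.
    move=> r rQ rx ry; have [hrx hry] := h r rQ.
    have [c1 c2 _ _] := part1 x r xQ rQ rx; have [d1 d2 _ _] := part1 y r yQ rQ ry.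
    have [|e1 e2 _ _] := twin_rel t _ hrx hry; first by rewrite !inE rQ !orbT.
    by rewrite -c1 -c2 -d1 -d2.
  move: uX wX; rewrite !inE => /or3P[/eqP uE|/eqP uE|uQ] /or3P[/eqP wE|/eqP wE|wQ].
  - by move: tw; rewrite uE wE => /twinP[]; rewrite inv_irr.
  - by rewrite uE wE in tw; apply: txy2.
  - by rewrite uE in tw; apply: (k2x w).
  - by rewrite uE wE in tw; apply/txy2/twin_sym.
  - by move: tw; rewrite uE wE => /twinP[]; rewrite inv_irr.
  - by rewrite uE in tw; apply: (k2y w).
  - by rewrite wE in tw; apply: (k2x u) => //; apply: twin_sym.
  - by rewrite wE in tw; apply: (k2y u) => //; apply: twin_sym.
  - by case: (nt _ _ uQ wQ); apply: twinS tw.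
have [q qb [b B inj]] := baseQ; have [bs sur mon] := B.
exists q => //; exists (b \o par); split=> [x _|j js|x y _ _ pxy] /=.
- exact: bs.
- by have [x xQ bx] := sur j js; exists x; rewrite ?inE //= parid.
have xy : x != y by apply: contraTneq pxy => ->; rewrite ltnn.
have := key x y xy; case: eqP => [-> | npar [k1 k2]].
  by rewrite ltnn leqnn /inverted /dominates; lia.
have [e1 e2] := base_neq_lt qb B inj (parQ x) (parQ y).
by rewrite k2 -e2; split=> //; rewrite ltnW // -e1 -k1.
Qed.
End Points.

(** * Corners and large permutations that are not separated *)

Section Corners.
Variables (T : finType) (p v : T -> nat).
Hypotheses (p_inj : injective p) (v_inj : injective v).
Variables W N S E : T.
Hypotheses (Wmin : forall x, p W <= p x) (Emax : forall x, p x <= p E).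
Hypotheses (Smin : forall x, v S <= v x) (Nmax : forall x, v x <= v N).
Implicit Types (A D Q : {set T}) (x y z r : T).
Local Notation dom := (dominates p v).
Local Notation inv := (inverted p v).

Definition corners_in A := [&& W \in A, N \in A, S \in A & E \in A].

Definition bad_corners A :=
  [/\ bad_low p v A W, bad_low p v A N, bad_high p v A S & bad_high p v A E].

Definition core A :=
  [/\ corners_in A, bad_corners A & forall D, ~ cut p v A D].

Lemma bad_cornersS A Q : A \subset Q -> bad_corners A -> bad_corners Q.
Proof. by move=> sAQ [? ? ? ?]; split; apply: ascentS sAQ _. Qed.

Lemma corners_inS A Q : A \subset Q -> corners_in A -> corners_in Q.
Proof. by move=> /subsetP s /and4P[? ? ? ?]; apply/and4P; split; apply: s. Qed.

(** The part below a cut contains the leftmost and the lowest point, the part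
    above it the rightmost and the highest. *)
Lemma cut_corners A D : corners_in A -> cut p v A D ->
  [/\ W \in D, S \in D, N \notin D & E \notin D].
Proof.
move=> /and4P[WA NA SA EA] [[x xA xD] [y yA yD] H].
have /andP[? ?] := H x y xA yA xD yD; split.
- by apply/idPn => WD; have := H x W xA WA xD WD; have := Wmin x; lia.
- by apply/idPn => WD; have := H x S xA SA xD WD; have := Smin x; lia.
- by apply/negP => WD; have := H N y NA yA WD yD; have := Nmax y; lia.
- by apply/negP => WD; have := H E y EA yA WD yD; have := Emax y; lia.
Qed.

Definition separated := (p S < p N) && (v W < v E).

Lemma no_cut A D : corners_in A -> ~~ separated -> ~ cut p v A D.
Proof.
move=> cA nsep cutD; have [WD SD ND ED] := cut_corners cA cutD.
have [_ _ H] := cutD; case/and4P: cA => WA NA SA EA; case/negP: nsep.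
by rewrite /separated; have := H S N SA NA SD ND; have := H W E WA EA WD ED; lia.
Qed.

(** The indices [i] and [j] are those of the largest and the smallest entry, that is
    of the corners N and S, while W and E have the indices [0] and [k.-1]. *)
Definition base_corners (q : seq nat) :=
  let k := size q in all (fun i => all (fun j =>
    all (fun l => nth 0 q j <= nth 0 q l <= nth 0 q i) (iota 0 k) ==>
    [&& i < j, nth 0 q k.-1 < nth 0 q 0 & (i == 0) == (j == k.-1)])
  (iota 0 k)) (iota 0 k).

Lemma bases_corners q : q \in tower_bases -> base_corners q.
Proof. by move: q; apply/allP. Qed.

Lemma tower_corners A : corners_in A -> tower_on p v A ->
  [/\ p N < p S, v E < v W & (W == N) = (S == E)].
Proof.
move=> cA [q qb [b B]]; case/and4P: (cA) => WA NA SA EA.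
have [bs sur mon] := B.
have q0 : 0 < size q by have /andP[] := base_size qb; lia.
have bW : b W = 0.
  have [x xA bx] := sur 0 q0; have := blocks_mono p_inj B WA xA (Wmin x).
  by rewrite bx leqn0 => /eqP.
have bE : b E = (size q).-1.
  have [|x xA bx] := sur (size q).-1; first by rewrite prednK.
  have := blocks_mono p_inj B xA EA (Emax x); have := bs E EA; rewrite bx => h1 h2.
  by apply/eqP; rewrite eqn_leq h2 andbT -ltnS prednK.
have /allP/(_ (b N)) := bases_corners qb; rewrite mem_iota bs // => /(_ isT).
move=> /allP/(_ (b S)); rewrite mem_iota bs // => /(_ isT).
have -> /= : all (fun l => nth 0 q (b S) <= nth 0 q l <= nth 0 q (b N)) (iota 0 (size q)).
  apply/allP => l; rewrite mem_iota => /= ls; have [x xA <-] := sur l ls.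
  by rewrite !(blocks_val p_inj v_inj qb B).
case/and3P=> bNS qEW /eqP bb.
have NS : p N < p S.
  have [|-> _] // := blocks_neq p_inj v_inj qb B NA SA; lia.
have EW : v E < v W.
  have [|_ ->] // := blocks_neq p_inj v_inj qb B EA WA; last by rewrite bE bW.
  by move=> e; move: qEW; rewrite -bE -bW e ltnn.
split=> //; apply/eqP/eqP => e.
- move: bb; rewrite -e bW eqxx -bE => /esym/eqP bSE; apply/eqP.
  apply/idPn => /eqP SE; have pSE : p S < p E.
    by rewrite ltn_neqAle Emax andbT; apply/eqP => /p_inj.
  by have := blocks_eq v_inj B SA EA pSE bSE; have := Smin E; lia.
- move: bb; rewrite e -bE eqxx => /eqP bN0; apply/eqP.
  apply/idPn => /eqP WN; have pWN : p W < p N.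
    by rewrite ltn_neqAle Wmin andbT; apply/eqP => /p_inj.
  by have := blocks_eq v_inj B WA NA pWN; rewrite bW bN0 => /(_ erefl); have := Nmax W; lia.
Qed.

(** Points listed from left to right form the base that they are order-isomorphic
    to. *)
Lemma base_of_seq (q : seq nat) (s : seq T) : q \in tower_bases -> size s = size q ->
  (forall i j, i < j -> j < size q -> p (nth W s i) < p (nth W s j)) ->
  (forall i j, i < j -> j < size q ->
     (v (nth W s i) < v (nth W s j)) = (nth 0 q i < nth 0 q j)) ->
  base_on p v [set x in s].
Proof.
move=> qb ss mon val.
have us : uniq s.
  apply/(uniqP W) => i j; rewrite !inE ss => hi hj e.
  case: (ltngtP i j) => // l.
    by have := mon i j l hj; rewrite e ltnn.
  by have := mon j i l hi; rewrite e ltnn.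
have idx x : x \in [set x in s] -> index x s < size q /\ nth W s (index x s) = x.
  by rewrite inE => xs; rewrite nth_index // -ss index_mem.
exists q => //; exists (fun x => index x s); first split.
- by move=> x /idx[].
- move=> j js; exists (nth W s j); first by rewrite inE mem_nth ?ss.
  by rewrite index_uniq ?ss.
- move=> x y /idx[ix nx] /idx[iy ny] pxy.
  case: (ltngtP (index x s) (index y s)) => l.
  + by split; rewrite // -(val _ _ l iy) nx ny.
  + by have := mon _ _ l ix; rewrite nx ny; lia.
  + by rewrite -nx l ny ltnn in pxy.
- by move=> x y /idx[_ nx] /idx[_ ny] e; rewrite -nx -ny e.
Qed.

Hypothesis WE : W <> E.
Hypothesis (coreT : core setT) (ntowerT : ~ tower_on p v setT).
Hypothesis crit : forall A, A != setT -> core A -> tower_on p v A.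
Hypothesis bigT : 9 <= #|T|.

Lemma small_proper A : #|A| <= 8 -> A != setT.
Proof. by move=> cA; apply/negP => /eqP AT; move: cA; rewrite AT cardsT leqNgt bigT. Qed.

Lemma NS_neq : N <> S.
Proof.
move=> NS; apply: WE; apply: v_inj; apply/eqP.
have := Smin W; have := Smin E; have := Nmax W; have := Nmax E; rewrite NS; lia.
Qed.

(** Induction towards larger bases: bases have at most 6 points, so a base can be
    extended by two points and still be proper.  If no such extension is a base,
    all of them are towers, and so is the whole set. *)
Lemma no_core_base Q0 : corners_in Q0 -> bad_corners Q0 -> ~~ separated ->
  base_on p v Q0 -> False.
Proof.
move=> cQ bQ nsep baseQ.
have [m] := ubnP (7 - #|Q0|).
elim: m => // m IHm in Q0 cQ bQ baseQ *; rewrite ltnS => lem.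
have cardQ : #|Q0| <= 6.
  have [q qb [b [bs _ _] inj]] := baseQ; have [m0 l6] := andP (base_size qb).
  apply: leq_trans l6; rewrite -(size_iota 0 (size q)) cardE -(size_map b).
  apply: uniq_leq_size.
    by rewrite map_inj_in_uniq ?enum_uniq // => x y; rewrite !mem_enum; apply: inj.
  by move=> j /mapP[x]; rewrite mem_enum => xQ ->; rewrite mem_iota bs.
have next (A : {set T}) : Q0 \subset A -> #|Q0| < #|A| <= 8 ->
    tower_on p v A /\ ~ base_on p v A.
  move=> sQA /andP[ltA leA]; have cA := corners_inS sQA cQ.
  have bA := bad_cornersS sQA bQ; split.
    apply: crit; first exact: small_proper.
    by split=> // D; apply: no_cut.
  by move=> baseA; apply: (IHm A) => //; lia.
apply: ntowerT; apply: tower_of_base baseQ _ _ => //.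
  move=> x xQ; apply: next; first by rewrite subsetUr.
  by rewrite cardsU1 xQ; lia.
move=> x y xQ yQ xy; apply: next; first by rewrite setUA subsetUr.
by rewrite !cardsU1 !inE (negbTE xQ) yQ (negbTE xy) /=; lia.
Qed.

(** The four corners alone form the base 3412, with all corners bad. *)
Lemma no_distinct : W <> N -> S <> E -> p N < p S -> v E < v W -> False.
Proof.
move=> WN SE NS EW.
have pWN : p W < p N by rewrite ltn_neqAle Wmin andbT; apply/eqP => /p_inj.
have pSE : p S < p E by rewrite ltn_neqAle Emax andbT; apply/eqP => /p_inj.
have vSE : v S < v E by rewrite ltn_neqAle Smin andbT; apply/eqP => /v_inj.
have vWN : v W < v N by rewrite ltn_neqAle Nmax andbT; apply/eqP => /v_inj.
apply: (@no_core_base [set x in [:: W; N; S; E]]).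
- by rewrite /corners_in !inE !eqxx ?orbT.
- split.
  + by exists S, E; split; rewrite /dom ?inE ?eqxx ?orbT //; lia.
  + by exists S, E; split; rewrite /dom ?inE ?eqxx ?orbT //; lia.
  + by exists W, N; split; rewrite /dom ?inE ?eqxx ?orbT //; lia.
  + by exists W, N; split; rewrite /dom ?inE ?eqxx ?orbT //; lia.
- rewrite /separated; lia.
- apply: (@base_of_seq [:: 3; 4; 1; 2]) => //.
  + by move=> [|[|[|[|i]]]] [|[|[|[|j]]]] //= _ _; lia.
  + by move=> [|[|[|[|i]]]] [|[|[|[|j]]]] //= _ _; lia.
Qed.

(** The two corners and an ascent in the window of W form the base 4231. *)
Lemma no_4231 : W = N -> S = E -> False.
Proof.
move=> WN SE; have [_ [[a [b [_ _ da db ab]]] _ _ _] _] := coreT.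
move: da db ab; rewrite /dominates => /andP[pa va] /andP[pb vb] /andP[pab vab].
have pbS : p b < p S.
  rewrite SE ltn_neqAle Emax andbT; apply/eqP => /p_inj e.
  by have := Smin a; rewrite SE -e; lia.
have vSa : v S < v a.
  by rewrite ltn_neqAle Smin andbT; apply/eqP => /v_inj e; rewrite e in pbS; lia.
apply: (@no_core_base [set x in [:: W; a; b; S]]).
- by rewrite /corners_in -WN -SE !inE !eqxx ?orbT.
- rewrite /bad_corners -WN -SE; split; exists a, b;
    split; rewrite /dominates ?inE ?eqxx ?orbT //; lia.
- by rewrite /separated -WN -SE; lia.
- apply: (@base_of_seq [:: 4; 2; 3; 1]) => //.
  + by move=> [|[|[|[|i]]]] [|[|[|[|j]]]] //= _ _; lia.
  + by move=> [|[|[|[|i]]]] [|[|[|[|j]]]] //= _ _; lia.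
Qed.

Lemma ascent_witness P : ascent p v setT P ->
  exists a b, forall A, a \in A -> b \in A -> ascent p v A P.
Proof. by move=> [a [b [_ _ Pa Pb ab]]]; exists a, b => A aA bA; exists a, b. Qed.

(** The corners of a tower are arranged as in [tower_corners], whereas a small
    set with bad corners is a tower. *)
Lemma no_small_core s : size s <= 8 -> corners_in [set x in s] ->
  bad_corners [set x in s] -> ~~ separated ->
  ~ [/\ p N < p S, v E < v W & (W == N) = (S == E)] -> False.
Proof.
move=> ss cs bs nsep; apply; apply: tower_corners (cs) _; apply: crit.
  by apply: small_proper; rewrite cardsE; apply: leq_trans (card_size _) ss.
by split=> // D; apply: no_cut.
Qed.

Local Ltac mem := rewrite ?inE ?eqxx ?orbT //.

(** Unless [no_distinct] or [no_4231] applies, two of the corners are bad because of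
    the other corners, so that four more points give a set of at most 8 points
    with bad corners. *)
Lemma not_separated : ~~ separated -> False.
Proof.
move=> nsep; have [_ [bW bN bS bE] _] := coreT.
have [w1 [w2 wP]] := ascent_witness bW; have [n1 [n2 nP]] := ascent_witness bN.
have [s1 [s2 sP]] := ascent_witness bS; have [e1 [e2 eP]] := ascent_witness bE.
have pNS := pneq p_inj NS_neq; have vWE := vneq v_inj WE.
have NWS : p W <= p N /\ p N <= p E /\ p W <= p S /\ p S <= p E by [].
have NWS' : v W <= v N /\ v E <= v N /\ v S <= v E /\ v S <= v W by [].
have xy : (p N < p S) || (v E < v W) by move: nsep; rewrite /separated; lia.
have asc a b A d : a \in A -> b \in A -> (p a < p b) && (v a < v b) ->
    dom d a -> dom d b -> bad_low p v A d by exists a, b.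
have asc' a b A d : a \in A -> b \in A -> (p a < p b) && (v a < v b) ->
    dom a d -> dom b d -> bad_high p v A d by exists a, b.
have [SE|/eqP SE] := eqVneq S E.
  have [WN|/eqP WN] := eqVneq W N; first exact: no_4231.
  have ? := pneq p_inj WN; have ? := vneq v_inj WN.
  apply: (@no_small_core [:: W; N; S; E; w1; w2; n1; n2]) => //.
  - by rewrite /corners_in; apply/and4P; split; mem.
  - split; [apply: wP|apply: nP|apply: (asc' W N)|apply: (asc' W N)]; mem;
      rewrite /dominates; have := congr1 p SE; have := congr1 v SE; lia.
  - by case=> _ _; move/eqP/negbTE: WN => ->; rewrite SE eqxx.
have ? := pneq p_inj SE; have ? := vneq v_inj SE.
have [WN|/eqP WN] := eqVneq W N.
  apply: (@no_small_core [:: W; N; S; E; s1; s2; e1; e2]) => //.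
  - by rewrite /corners_in; apply/and4P; split; mem.
  - split; [apply: (asc S E)|apply: (asc S E)|apply: sP|apply: eP]; mem;
      rewrite /dominates; have := congr1 p WN; have := congr1 v WN; lia.
  - by case=> _ _; move/eqP/negbTE: SE => ->; rewrite WN eqxx.
have ? := pneq p_inj WN; have ? := vneq v_inj WN.
have NE : N <> E by move=> e; have := congr1 p e; have := congr1 v e; lia.
have WS : W <> S by move=> e; have := congr1 p e; have := congr1 v e; lia.
have ? := pneq p_inj NE; have ? := vneq v_inj NE.
have ? := pneq p_inj WS; have ? := vneq v_inj WS.
have ? := vneq v_inj NS_neq; have ? := pneq p_inj WE.
have [X|X] := boolP (p N < p S).
  have [Y|Y] := boolP (v E < v W); first exact: no_distinct.
  apply: (@no_small_core [:: W; N; S; E; w1; w2; e1; e2]) => //.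
  - by rewrite /corners_in; apply/and4P; split; mem.
  - split; [apply: wP|apply: (asc S E)|apply: (asc' W N)|apply: eP]; mem;
      rewrite /dominates; lia.
  - by case=> _; rewrite (negbTE Y).
apply: (@no_small_core [:: W; N; S; E; n1; n2; s1; s2]) => //.
- by rewrite /corners_in; apply/and4P; split; mem.
- split; [apply: (asc S E)|apply: nP|apply: sP|apply: (asc' W N)]; mem;
    rewrite /dominates; lia.
- by case; rewrite (negbTE X).
Qed.

End Corners.

(** * Minimal inversions around a pair of corners *)

Section Covers.
Variables (T : finType) (p v : T -> nat).
Implicit Types (A B D L : {set T}) (x y z r : T).
Local Notation dom := (dominates p v).
Local Notation inv := (inverted p v).

(** Minimal inversions are the covering pairs of the relation [dominates]. *)
Definition covers : {set T * T} :=
  [set e : T * T | dom e.1 e.2 && ~~ [exists z, dom e.1 z && dom z e.2]].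

Local Notation cov := (edge_rel covers).

Lemma covers_oriented : oriented covers.
Proof.
move=> x y; rewrite !inE /= => /andP[dxy _].
by rewrite negb_and; apply/orP; left; move: dxy; rewrite /dominates; lia.
Qed.

Lemma cov_inv x y : cov x y -> inv x y.
Proof. by rewrite /inverted /edge_rel /= !inE /= => /orP[]/andP[-> _]; rewrite ?orbT. Qed.

(** An inversion that is not minimal splits into two shorter ones. *)
Lemma inv_connect x y : inv x y -> connect cov x y.
Proof.
suff dc z t : dom z t -> connect cov z t.
  by case/orP=> /dc //; rewrite edge_rel_csym.
have [m] := ubnP (p t - p z); elim: m => // m IHm in z t *; rewrite ltnS => lem dzt.
have [zt|] := boolP ((z, t) \in covers).
  by apply: connect1; rewrite /edge_rel /= zt.
rewrite inE /= dzt /= negbK => /existsP[r /andP[dzr drt]].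
have /andP[? ?] := dzr; have /andP[? ?] := drt.
by apply: (@connect_trans _ _ r); apply: IHm => //; lia.
Qed.

(** Let [y] be the leftmost point not connected to [W].  If a point [a] to the left
    of [y] forms an inversion with a point [b] that is not, both are connected
    to [W], so neither forms an inversion with [y]; then [a] is below [y] and [y]
    below [b], which is absurd.  So there is a cut just before [y]. *)
Lemma connected_covers W : (forall x, p W <= p x) -> injective p -> injective v ->
  (forall D, ~ cut p v setT D) -> connected_graph cov.
Proof.
move=> Wmin p_inj v_inj nocut.
suff cW x : connect cov W x.
  by move=> x y; apply: connect_trans (cW y); rewrite edge_rel_csym.
apply/idPn => xC; have ex : exists m, [exists y, ~~ connect cov W y && (p y == m)].
  by exists (p x); apply/existsP; exists x; rewrite xC eqxx.
case: (ex_minnP ex) => m /existsP[y /andP[yC /eqP Dm]] ymin; subst m.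
have inC z : p z < p y -> connect cov W z.
  move=> lt; apply/idPn => zC; have := ymin (p z); rewrite leqNgt lt; case/(_ _)/negP => //.
  by apply/existsP; exists z; rewrite zC eqxx.
have Wy : p W < p y.
  by rewrite ltn_neqAle Wmin andbT; apply: contraNneq yC => /p_inj->.
case: (nocut [set z | p z < p y]); split.
- by exists W; rewrite ?inE.
- by exists y; rewrite ?inE ?ltnn.
move=> a b _ _; rewrite !inE -leqNgt => pay pyb.
rewrite (leq_trans pay pyb) /= ltnNge leq_eqVlt; apply/negP => /orP[/eqP/v_inj e|vba].
  by have := congr1 p e; lia.
have aC := inC a pay.
have bC : connect cov W b.
  by apply: connect_trans aC _; apply: inv_connect; rewrite /inverted /dominates; lia.
have by_ : b <> y by move=> e; rewrite -e bC in yC.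
have nia : ~~ inv a y.
  by apply: contra yC => /inv_connect; apply: connect_trans.
have nib : ~~ inv b y.
  by apply: contra yC => /inv_connect; apply: connect_trans.
have ay : a <> y by move=> e; rewrite e ltnn in pay.
move: nia nib; rewrite /inverted /dominates.
have := pneq p_inj by_; have := vneq v_inj by_; have := vneq v_inj ay; lia.
Qed.

End Covers.

Section Side.
Variables (T : finType) (p v : T -> nat).
Hypotheses (p_inj : injective p) (v_inj : injective v).
Implicit Types (A B D L : {set T}) (x y z r W S a b : T).
Local Notation dom := (dominates p v).
Local Notation inv := (inverted p v).
Local Notation cov := (edge_rel (covers p v)).

(** [W], [S] and two more points forming a pattern 3412 or 4231 in which [W] and
    [S] are the leftmost and the lowest point: the smallest sets in which both
    corners are bad. *)
Definition quad3412 W S a b :=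
  [&& p W < p a, p a < p S, p S < p b, v S < v b, v b < v W & v W < v a].
Definition quad4231 W S a b :=
  [&& p W < p a, p a < p b, p b < p S, v S < v a, v a < v b & v b < v W].
Definition quad W S a b := quad3412 W S a b || quad4231 W S a b.

Definition quad_set W S a b : {set T} := [set x in [:: W; S; a; b]].

Lemma quad_exists W S : (forall x, p W <= p x) -> (forall x, v S <= v x) ->
  bad_low p v setT W -> bad_high p v setT S -> exists a b, quad W S a b.
Proof.
move=> Wmin Smin [j [k [_ _ /andP[pj vj] /andP[pk vk] /andP[pjk vjk]]]].
move=> [a [b [_ _ /andP[pa va] /andP[pb vb] /andP[pab vab]]]].
have [kS|kS|/p_inj kS] := ltngtP (p k) (p S).
- exists j, k; apply/orP; right; apply/and5P; split=> //; last first.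
    by rewrite vjk.
  rewrite ltn_neqAle Smin andbT; apply/eqP => /v_inj e; have := congr1 p e; lia.
- have [bW|bW|/v_inj bW] := ltngtP (v b) (v W).
  + exists a, b; apply/orP; right; rewrite /quad4231 pab vab bW pb va !andbT /=.
    rewrite ltn_neqAle Wmin andbT; apply/eqP => /p_inj e; have := congr1 v e; lia.
  + exists b, k; apply/orP; left; rewrite /quad3412 pb kS vk bW !andbT /=.
    have := Wmin a; rewrite (leq_ltn_trans (Wmin a) pab) /= => _.
    by rewrite (leq_ltn_trans (Smin j) vjk).
  + by have := Wmin a; rewrite -bW; lia.
- by have := Smin j; rewrite -kS; lia.
Qed.

Lemma quad_bad W S a b A : quad W S a b -> quad_set W S a b \subset A ->
  bad_low p v A W /\ bad_high p v A S.
Proof.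
move=> q sA; split; apply: ascentS sA _; case/orP: q => /and5P[? ? ? ? /andP[? ?]].
- by exists S, b; split; rewrite ?inE ?eqxx ?orbT // /dominates; lia.
- by exists a, b; split; rewrite ?inE ?eqxx ?orbT // /dominates; lia.
- by exists W, a; split; rewrite ?inE ?eqxx ?orbT // /dominates; lia.
- by exists a, b; split; rewrite ?inE ?eqxx ?orbT // /dominates; lia.
Qed.

(** If [a] or [b] were above all of [L], it would be to the right of and above both
    [W] and [S], which no point of the quadruple is. *)
Lemma quad_below W S a b z L : quad W S a b -> z \notin quad_set W S a b ->
  W \in L -> S \in L ->
  (forall x y, x \in L -> y \notin L -> y != z -> (p x < p y) && (v x < v y)) ->
  quad_set W S a b \subset L.
Proof.
move=> q zA WL SL H.
have neq y : y \in quad_set W S a b -> y != z by apply: contraTneq => ->.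
have az : a != z by apply: neq; rewrite !inE eqxx !orbT.
have bz : b != z by apply: neq; rewrite !inE eqxx !orbT.
have aL : a \in L.
  apply/idPn => aL; have := H _ _ WL aL az; have := H _ _ SL aL az.
  by case/orP: q => /and5P[? ? ? ? /andP[? ?]]; lia.
have bL : b \in L.
  apply/idPn => bL; have := H _ _ WL bL bz; have := H _ _ SL bL bz.
  by case/orP: q => /and5P[? ? ? ? /andP[? ?]]; lia.
by apply/subsetP => y; rewrite !inE => /or4P[]/eqP->.
Qed.

(** Only [x] can come between two points of the quadruple, so the minimal inversions
    in [x |: quad_set W S a b] are those of a five-point pattern, and the cycles
    are listed according to the place of [x].  The one exception is the pattern
    3412 with [x] in its middle: all four inversions then factor through [x],
    and the covers form a star. *)
Lemma quad_cycle W S a b x : quad W S a b -> x \notin quad_set W S a b ->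
  (forall z y, z \notin quad_set W S a b -> z != x -> y \in quad_set W S a b ->
     ~~ inv z y) ->
  ~~ [&& dom W x, dom a x, dom x S & dom x b] ->
  exists2 c, graph_cycle cov c & {subset c <= x |: quad_set W S a b}.
Proof.
move=> q xA nbr ctr.
set A := quad_set W S a b in xA nbr *.
have covI y z : (y \in A) || (z \in A) -> dom y z ->
    [&& ~~ (dom y x && dom x z), ~~ (dom y W && dom W z), ~~ (dom y S && dom S z),
     ~~ (dom y a && dom a z) & ~~ (dom y b && dom b z)] -> cov y z /\ cov z y.
  move=> yzA dyz nb; suff H : (y, z) \in covers p v by rewrite /edge_rel /= H orbT.
  rewrite inE /= dyz /=; apply/existsP => -[t /andP[dyt dtz]].
  have [tA|tA] := boolP (t \in A).
    move: tA nb; rewrite !inE => /or4P[]/eqP Dt; rewrite -Dt dyt dtz /= ?andbF //.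
  have [tx|tx] := eqVneq t x; first by move: nb; rewrite -tx dyt dtz.
  case/orP: yzA => iA; first by have := nbr t y tA tx iA; rewrite /inverted dyt orbT.
  by have := nbr t z tA tx iA; rewrite /inverted dtz.
have xW : x <> W by move=> e; rewrite e !inE eqxx in xA.
have xS : x <> S by move=> e; rewrite e !inE eqxx !orbT in xA.
have xa : x <> a by move=> e; rewrite e !inE eqxx !orbT in xA.
have xb : x <> b by move=> e; rewrite e !inE eqxx !orbT in xA.
have inX : {subset [:: W; S; a; b; x] <= x |: A}.
  by move=> y; rewrite !inE => /or4P[||| /orP[]] ->; rewrite ?orbT.
have cyc (c : seq T) : uniq c -> 2 < size c -> all (mem [:: W; S; a; b; x]) c ->
    path.cycle cov c -> exists2 c, graph_cycle cov c & {subset c <= x |: A}.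
  move=> uc sc /allP cs cc; exists c; first by rewrite /graph_cycle sc /ucycleb cc uc.
  by move=> y /cs; apply: inX.
have covI' y z : (y \in A) || (z \in A) -> inv y z ->
    all (fun t => ~~ ((dom y t && dom t z) || (dom z t && dom t y))) [:: x; W; S; a; b] ->
    cov y z.
  move=> yzA /orP[d|d] /and5P[h1 h2 h3 h4 /andP[h5 _]];
    rewrite !negb_or in h1 h2 h3 h4 h5.
    apply: (proj1 (covI y z yzA d _)).
    by move: h1 h2 h3 h4 h5 => /andP[-> _] /andP[-> _] /andP[-> _] /andP[-> _] /andP[-> _].
  rewrite orbC in yzA; apply: (proj2 (covI z y yzA d _)).
  by move: h1 h2 h3 h4 h5 => /andP[_ ->] /andP[_ ->] /andP[_ ->] /andP[_ ->] /andP[_ ->].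
have neqp y z : p y != p z -> ((y == z) = false) * ((z == y) = false).
  by move=> h; have hyz : y != z; [apply: contraNneq h => -> | rewrite [z == y]eq_sym (negbTE hyz)].
have [nWS nWa nWb] : [/\ p W != p S, p W != p a & p W != p b].
  by case/orP: q => /and5P[? ? ? ? /andP[? ?]]; split; lia.
have [nSa nSb nab] : [/\ p S != p a, p S != p b & p a != p b].
  by case/orP: q => /and5P[? ? ? ? /andP[? ?]]; split; lia.
have neqx y : x <> y -> ((x == y) = false) * ((y == x) = false).
  by move=> h; split; apply/eqP => // e; apply: h.
have neqs := (neqx _ xW, neqx _ xS, neqx _ xa, neqx _ xb, (neqp _ _ nWS, neqp _ _ nWa,
  neqp _ _ nWb, neqp _ _ nSa, neqp _ _ nSb, neqp _ _ nab)).
Local Ltac edge covI' := apply: covI';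
  [by rewrite !inE !eqxx ?orbT | rewrite /inverted /dominates; lia
  | apply/and5P; split; [lia|lia|lia|lia|rewrite andbT; lia]].
Local Ltac close_cycle neqs cyc covI' c :=
  apply: (cyc c); [by rewrite /= !inE !neqs | done | by rewrite /= !inE !eqxx ?orbT
    | do ?[apply/andP; split]; try done; edge covI'].
clear covI nbr xA inX xW xS xa xb nWS nWa nWb nSa nSb nab neqp neqx.
rewrite /dominates in ctr covI' *.
case/orP: q => /and5P[q1 q2 q3 q4 /andP[q5 q6]].
  have [nb|] := boolP (~~ (dom W x || dom a x) || ~~ (dom x S || dom x b)).
    rewrite /dominates in nb.
close_cycle neqs cyc covI' [:: W; S; a; b].
  rewrite negb_or !negbK => /andP[up lo]; rewrite /dominates in up lo.
  have [uW|uW] := boolP (dom W x); rewrite /dominates in uW; last first.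
    have [lS|lS] := boolP (dom x S); rewrite /dominates in lS; last first.
     by close_cycle neqs cyc covI' [:: a; x; b; W; S].
    have [lb|lb] := boolP (dom x b); rewrite /dominates in lb; last first.
      by close_cycle neqs cyc covI' [:: a; x; S; W; b].
    by close_cycle neqs cyc covI' [:: x; S; W; b].
  clear up; have [ua|ua] := boolP (dom a x); rewrite /dominates in ua; last first.
    have [lS|lS] := boolP (dom x S); rewrite /dominates in lS; last first.
      have {}lo : (p x < p b) && (v b < v x) by lia.
      by close_cycle neqs cyc covI' [:: W; x; b; a; S].
    clear lo; have [lb|lb] := boolP (dom x b); rewrite /dominates in lb; last first.
      by close_cycle neqs cyc covI' [:: W; x; S; a; b].
    by close_cycle neqs cyc covI' [:: x; S; a; b].
  have [lS|lS] := boolP (dom x S); rewrite /dominates in lS; last first.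
    have {}lo : (p x < p b) && (v b < v x) by lia.
    by close_cycle neqs cyc covI' [:: W; x; a; S].
  have [lb|lb] := boolP (dom x b); rewrite /dominates in lb; last first.
    by close_cycle neqs cyc covI' [:: W; x; a; b].
  by exfalso; lia.
have [la|la] := boolP (dom x a); rewrite /dominates in la.
  have [uW|uW] := boolP (dom W x); rewrite /dominates in uW; last first.
    by close_cycle neqs cyc covI' [:: W; a; S; b].
  have [lb|lb] := boolP (dom x b); rewrite /dominates in lb.
    by close_cycle neqs cyc covI' [:: x; a; S; b].
  by close_cycle neqs cyc covI' [:: W; x; a; S; b].
have [lb|lb] := boolP (dom x b); rewrite /dominates in lb.
  have [uW|uW] := boolP (dom W x); rewrite /dominates in uW; last first.
    by close_cycle neqs cyc covI' [:: W; a; S; b].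
  by close_cycle neqs cyc covI' [:: W; x; b; S; a].
have [lS|lS] := boolP (dom x S); rewrite /dominates in lS; last first.
  by close_cycle neqs cyc covI' [:: W; a; S; b].
have [ua|ua] := boolP (dom a x); rewrite /dominates in ua;
  have [ub|ub] := boolP (dom b x); rewrite /dominates in ub.
- by close_cycle neqs cyc covI' [:: W; a; x; b].
- by close_cycle neqs cyc covI' [:: W; a; x; S; b].
- by close_cycle neqs cyc covI' [:: W; b; x; S; a].
- by close_cycle neqs cyc covI' [:: W; a; S; b].
Qed.
End Side.

(** * Large separated permutations *)

Section SideCycle.
Variables (T : finType) (p v : T -> nat).
Hypotheses (p_inj : injective p) (v_inj : injective v).
Implicit Types (A B D L : {set T}) (x y z r W S a b : T).
Local Notation dom := (dominates p v).
Local Notation inv := (inverted p v).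
Local Notation cov := (edge_rel (covers p v)).

Lemma below_ninv x y : (p x < p y) && (v x < v y) -> ~~ inv x y.
Proof. rewrite /inverted /dominates; lia. Qed.

Lemma below_ninv' x y : (p x < p y) && (v x < v y) -> ~~ inv y x.
Proof. rewrite /inverted /dominates; lia. Qed.

Lemma below_trans x y z : (p x < p y) && (v x < v y) ->
  (p y < p z) && (v y < v z) -> (p x < p z) && (v x < v z).
Proof. lia. Qed.

Lemma ninv_lt x y : x != y -> ~~ inv x y -> (p x < p y) = (v x < v y).
Proof.
move=> /eqP xy; have := pneq p_inj xy; have := vneq v_inj xy.
rewrite /inverted /dominates; lia.
Qed.

Lemma ninv_below x y : x != y -> ~~ inv x y -> ~~ (p x < p y) ->
  (p y < p x) && (v y < v x).
Proof.
move=> /eqP xy; have := pneq p_inj xy; have := vneq v_inj xy.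
rewrite /inverted /dominates; lia.
Qed.

(** [z] is a cut vertex of the inversion graph: [L] is the part below it, which
    contains [A], and the part above it contains [B]. *)
Definition splits z A B L :=
  [/\ A \subset L, z \notin L, (forall y, y \in B -> y \notin L),
      (forall x y, x \in L -> y \notin L -> y != z -> (p x < p y) && (v x < v y))
    & exists r, [/\ r \notin L, r != z & inv z r]].

(** If two outside points [z] and [x1] had neighbours in [A], each would lie in the
    lower part of the other; neighbours [r] of [x1] and [s] of [z] in the upper
    parts would then be below each other.  So [quad_cycle] applies to the only
    neighbour [x1] of [A].  It is not in the middle of a pattern 3412, since a
    neighbour of [x1] in the upper part would then be a second neighbour of
    [A], through [W] or [S]. *)
Lemma side_cycle W S a b B z0 y0 : quad p v W S a b ->
  let A := quad_set W S a b in
  connected_graph cov -> y0 \in B -> z0 \notin A -> z0 \notin B ->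
  (forall z, z \notin A -> z \notin B -> exists L, splits z A B L) ->
  exists2 x, x \notin B &
  exists2 c, graph_cycle cov c & {subset c <= x |: A}.
Proof.
move=> q A conn y0B z0A z0B H.
have disj y : y \in A -> y \notin B.
  move=> yA; have [L [AL _ BL _ _]] := H z0 z0A z0B.
  by apply/negP => /BL; rewrite (subsetP AL).
have noAB x y : x \in A -> y \in B -> ~~ inv x y.
  move=> xA yB; have [L [AL _ BL sep _]] := H z0 z0A z0B.
  have yz : y != z0 by apply: contraTneq yB => ->.
  by apply: below_ninv; apply: sep (subsetP AL _ xA) (BL y yB) yz.
have [x1 x1A [u uA ux1]] : exists2 x, x \notin A & exists2 u, u \in A & inv u x.
  case: (boolP [exists x, (x \notin A) && [exists u in A, inv u x]]).
    by case/existsP=> x /andP[xA /exists_inP[u uA ux]]; exists x => //; exists u.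
  rewrite negb_exists => /forallP noN; exfalso.
  have clo : closed cov (mem A).
    apply: (intro_closed (@edge_rel_csym _ _)) => x y cxy xA.
    apply: contraT => yA; have := noN y; rewrite yA /= => /exists_inP[].
    by exists x => //; apply: cov_inv.
  have WA : W \in A by rewrite !inE eqxx.
  have := closed_connect clo (conn W y0); rewrite WA => /esym/disj.
  by rewrite y0B.
have x1B : x1 \notin B by apply: contraL ux1; apply: noAB.
have uniq_nbr z : z \notin A -> z != x1 -> forall y, y \in A -> ~~ inv z y.
  move=> zA zx1 y yA; apply/negP => izy.
  have zB : z \notin B by apply: contraL izy => zB; rewrite inv_sym noAB.
  have [L [AL x1L BL sep [r [rL rx1 ir]]]] := H x1 x1A x1B.
  have [M [AM zM BM sepz [s [sM sz izs]]]] := H z zA zB.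
  have zL : z \in L.
    apply: contraLR izy => zL.
    by apply: below_ninv'; apply: sep (subsetP AL _ yA) zL zx1.
  have x1M : x1 \in M.
    apply: contraLR ux1 => x1M; rewrite eq_sym in zx1.
    by apply: below_ninv; apply: sepz (subsetP AM _ uA) x1M zx1.
  have rM : r \in M.
    apply: contraLR ir => rM; have rz : r != z by apply: contraNneq rL => ->.
    by apply: below_ninv; apply: sepz x1M rM rz.
  have sL : s \in L.
    apply: contraLR izs => sL; have sx1 : s != x1 by apply: contraNneq sM => ->.
    by apply: below_ninv; apply: sep zL sL sx1.
  have /andP[h1 _] := sep s r sL rL rx1; have /andP[h2 _] := sepz r s rM sM sz.
  by rewrite ltnNge (ltnW h1) in h2.
exists x1 => //; apply: (quad_cycle q x1A).
  by move=> z y zA zx1; apply: uniq_nbr.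
apply/negP => /and4P[Wx ax xS xb].
have [L [AL x1L BL sep [r [rL rx1 ir]]]] := H x1 x1A x1B.
have rA : r \notin A by apply: contra rL; apply: (subsetP AL).
have WA : W \in A by rewrite !inE eqxx.
have SA : S \in A by rewrite !inE eqxx !orbT.
have := uniq_nbr r rA rx1 W WA; have := uniq_nbr r rA rx1 S SA.
rewrite /inverted !negb_or => /andP[nrS _] /andP[_ nWr].
have trans t y z : dom t y -> dom y z -> dom t z by clear; rewrite /dominates; lia.
case/orP: ir => [x1r|rx].
  by rewrite (trans _ _ _ Wx x1r) in nWr.
by rewrite (trans _ _ _ rx xS) in nrS.
Qed.

Lemma cut_dec A : (exists D, cut p v A D) \/ (forall D, ~ cut p v A D).
Proof.
pose cutb (D : {set T}) := [&& [exists x in A, x \in D], [exists y in A, y \notin D] &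
   [forall x in A, forall y in A, (x \in D) ==> (y \notin D) ==>
      (p x < p y) && (v x < v y)]].
have cutP D : reflect (cut p v A D) (cutb D).
  apply: (iffP and3P) => [[/exists_inP[x xA xD] /exists_inP[y yA yD] /forall_inP h]|].
    split; [by exists x|by exists y|move=> a b aA bA aD bD].
    by have /forall_inP/(_ b bA) := h a aA; rewrite aD bD.
  case=> [[x xA xD] [y yA yD] h]; split.
  - by apply/exists_inP; exists x.
  - by apply/exists_inP; exists y.
  - apply/forall_inP=> a aA; apply/forall_inP=> b bA.
    by apply/implyP=> aD; apply/implyP => bD; apply: h.
have [/existsP[D /cutP]|] := boolP [exists D, cutb D]; first by left; exists D.
by rewrite negb_exists => /forallP h; right => D /cutP; apply/negP.
Qed.

End SideCycle.

Section Separated.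
Variables (T : finType) (p v : T -> nat).
Hypotheses (p_inj : injective p) (v_inj : injective v).
Variables W N S E : T.
Hypotheses (Wmin : forall x, p W <= p x) (Emax : forall x, p x <= p E).
Hypotheses (Smin : forall x, v S <= v x) (Nmax : forall x, v x <= v N).
Implicit Types (A B D L : {set T}) (x y z r a b : T).
Local Notation dom := (dominates p v).
Local Notation inv := (inverted p v).
Local Notation cov := (edge_rel (covers p v)).
Local Notation core := (core p v W N S E).

Hypothesis WE : W <> E.
Hypothesis coreT : core setT.
Hypothesis crit : forall A, A != setT -> core A -> tower_on p v A.
Hypothesis bigT : 9 <= #|T|.

(** The half turn exchanges [W] with [E] and [S] with [N], so that what holds for
    the quadruple around [W] and [S] also holds for the one around [E] and [N]. *)
Let p' x := p E - p x.
Let v' x := v N - v x.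

Let p'_inj : injective p'.
Proof. by move=> x y; rewrite /p' => e; apply: p_inj; have := Emax x; have := Emax y; lia. Qed.

Let v'_inj : injective v'.
Proof. by move=> x y; rewrite /v' => e; apply: v_inj; have := Nmax x; have := Nmax y; lia. Qed.

Let p'E x y : (p' x < p' y) = (p y < p x).
Proof. by have := Emax x; have := Emax y; rewrite /p'; lia. Qed.

Let v'E x y : (v' x < v' y) = (v y < v x).
Proof. by have := Nmax x; have := Nmax y; rewrite /v'; lia. Qed.

Let dom'E x y : dominates p' v' x y = dom y x.
Proof. by rewrite /dominates p'E v'E. Qed.

Let ascent' A P : ascent p v A P -> ascent p' v' A P.
Proof. by move=> [x [y [xA yA Px Py xy]]]; exists y, x; rewrite p'E v'E. Qed.

Let ascent'' A P : ascent p' v' A P -> ascent p v A P.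
Proof. by move=> [x [y [xA yA Px Py]]]; rewrite p'E v'E => xy; exists y, x. Qed.

Let ascent_eq A P Q : P =1 Q -> ascent p v A P -> ascent p v A Q.
Proof. by move=> PQ [x [y [xA yA Px Py xy]]]; exists x, y; rewrite -!PQ. Qed.

(** Deleting [z] outside the two quadruples leaves all corners bad, and a separated
    set is never a tower, so the rest has a cut; both quadruples are on one side
    of it by [quad_below]. *)
Lemma separated_covers : separated p v W N S E -> #|T| < #|covers p v|.
Proof.
move=> sep; have [cT [bW bN bS bE] nocut] := coreT.
have conn : connected_graph cov := connected_covers Wmin p_inj v_inj nocut.
have inv'E x y : inverted p' v' x y = inv x y by rewrite /inverted !dom'E orbC.
have [a [b q]] := quad_exists p_inj v_inj Wmin Smin bW bS.
have [c [d q']] : exists c d, quad p' v' E N c d.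
  apply: (quad_exists p'_inj v'_inj).
  - by move=> x; rewrite leqNgt p'E -leqNgt.
  - by move=> x; rewrite leqNgt v'E -leqNgt.
  - by apply: ascent'; apply: ascent_eq bE => x; rewrite dom'E.
  - by apply: ascent'; apply: ascent_eq bN => x; rewrite dom'E.
set A := quad_set W S a b; set B := quad_set E N c d.
have [z0 z0A z0B] : exists2 z, z \notin A & z \notin B.
  have : ~~ ([set: T] \subset A :|: B).
    apply: contraL bigT => /subset_leq_card; rewrite cardsT -ltnNge => h.
    apply: leq_ltn_trans h _; rewrite ltnS (leq_trans (leq_card_setU _ _)) //.
    by rewrite (@leq_add _ _ 4 4) // cardsE card_size.
  by case/subsetPn=> z _; rewrite inE negb_or => /andP[? ?]; exists z.
have cutz z : z \notin A -> z \notin B -> exists L,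
    [/\ splits p v z A B L & splits p' v' z B A (~: L :\ z)].
  move=> zA zB; set X := setT :\ z.
  have AX : A \subset X by apply/subsetP => y yA; rewrite !inE andbT; apply: contraTneq yA => ->.
  have BX : B \subset X by apply/subsetP => y yA; rewrite !inE andbT; apply: contraTneq yA => ->.
  have [WA SA] : W \in A /\ S \in A by rewrite !inE !eqxx !orbT.
  have [EB NB] : E \in B /\ N \in B by rewrite !inE !eqxx !orbT.
  have cX : corners_in W N S E X.
    by rewrite /corners_in (subsetP AX _ WA) (subsetP AX _ SA) (subsetP BX _ EB) (subsetP BX _ NB).
  have bX : bad_corners p v W N S E X.
    have [bW' bS'] := quad_bad q AX; have [bE' bN'] := quad_bad q' BX; split=> //.
      by move/ascent'': bN'; apply: ascent_eq => x; rewrite dom'E.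
    by move/ascent'': bE'; apply: ascent_eq => x; rewrite dom'E.
  have [[D cutD]|ncut] := cut_dec p v X; last first.
    have /crit : X != setT by apply: contraTneq (in_setT z) => <-; rewrite !inE eqxx.
    have cX' : core X by split.
    case/(_ cX')/(tower_corners p_inj v_inj Wmin Emax Smin Nmax cX) => NS _ _.
    by move: sep; rewrite /separated ltnNge (ltnW NS).
  have [WD SD ND ED] := cut_corners Wmin Emax Smin Nmax cX cutD.
  have [_ _ HD] := cutD.
  pose L := D :\ z; exists L.
  have zL : z \notin L by rewrite !inE eqxx.
  have sepL x y : x \in L -> y \notin L -> y != z -> (p x < p y) && (v x < v y).
    rewrite !inE => /andP[xz xD] yL yz; apply: HD; rewrite ?inE ?xz ?yz //.
    by rewrite yz in yL.
  have WL : W \in L by rewrite !inE WD andbT; apply: contraTneq WA => ->.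
  have SL : S \in L by rewrite !inE SD andbT; apply: contraTneq SA => ->.
  have NL : N \notin L by rewrite !inE (negbTE ND) andbF.
  have EL : E \notin L by rewrite !inE (negbTE ED) andbF.
  have Ez : E != z by apply: contraTneq EB => ->.
  have AL : A \subset L by apply: quad_below q zA WL SL sepL.
  have sepL' x y : x \in ~: L :\ z -> y \notin ~: L :\ z -> y != z ->
      (p' x < p' y) && (v' x < v' y).
    rewrite !in_setD1 !in_setC p'E v'E => /andP[xz xL]; rewrite negb_and !negbK.
    by move=> /orP[/eqP->|yL yz]; [rewrite eqxx|apply: sepL].
  have Nz : N != z by apply: contraTneq NB => ->.
  have BL : B \subset ~: L :\ z.
    by apply: quad_below q' zB _ _ sepL'; rewrite !in_setD1 !in_setC ?Ez ?Nz ?EL ?NL.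
  have [r [rL rz izr]] : exists r, [/\ r \notin L, r != z & inv z r].
    case: (boolP [exists r, [&& r \notin L, r != z & inv z r]]).
      by case/existsP=> r /and3P[? ? ?]; exists r.
    rewrite negb_exists => /forallP no; exfalso.
    have no' r : r \notin L -> r != z -> ~~ inv r z.
      by move=> rL rz; have := no r; rewrite rL rz /= inv_sym.
    case: (boolP [exists r, [&& r \notin L, r != z & p r < p z]]) => [|].
      case/existsP=> r /and3P[rL rz prz].
      have brz : (p r < p z) && (v r < v z) by rewrite -(ninv_lt p_inj v_inj rz (no' r rL rz)) prz.
      apply: (nocut L); split; [by exists W|by exists E|].
      move=> x y _ _ xL yL; have [->|yz] := eqVneq y z; last exact: sepL.
      exact: below_trans (sepL x r xL rL rz) brz.
    rewrite negb_exists => /forallP ge.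
    apply: (nocut (z |: L)); split; [by exists W => //; rewrite inE WL orbT| |].
      by exists E => //; rewrite !in_setU1 negb_or Ez EL.
    move=> x y _ _; rewrite !in_setU1 negb_or => /orP[/eqP->|xL] /andP[yz yL]; last exact: sepL.
    have := ge y; rewrite yL yz /=; apply: (ninv_below p_inj v_inj) => //; exact: no'.
  have [l [lL izl]] : exists l, l \in L /\ inv z l.
    case: (boolP [exists l, (l \in L) && inv z l]).
      by case/existsP=> l /andP[? ?]; exists l.
    rewrite negb_exists => /forallP no; exfalso.
    have Lz l : l \in L -> l != z by apply: contraTneq => ->.
    have no' l : l \in L -> ~~ inv z l by move=> lL; have := no l; rewrite lL.
    case: (boolP [exists l, (l \in L) && (p z < p l)]) => [|].
      case/existsP=> l /andP[lL pzl]; have zl : z != l by rewrite eq_sym Lz.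
      have bzl : (p z < p l) && (v z < v l) by rewrite -(ninv_lt p_inj v_inj zl (no' l lL)) pzl.
      apply: (nocut (z |: L)); split; [by exists W => //; rewrite inE WL orbT| |].
        by exists E => //; rewrite !in_setU1 negb_or Ez EL.
      move=> x y _ _; rewrite !in_setU1 negb_or => /orP[/eqP->|xL] /andP[yz yL]; last exact: sepL.
      exact: below_trans bzl (sepL l y lL yL yz).
    rewrite negb_exists => /forallP ge.
    apply: (nocut L); split; [by exists W|by exists E|].
    move=> x y _ _ xL yL; have [->|yz] := eqVneq y z; last exact: sepL.
    have := ge x; rewrite xL /=; apply: (ninv_below p_inj v_inj); last exact: no'.
    by rewrite eq_sym Lz.
  split; split=> //.
  - by move=> y /(subsetP BL); rewrite in_setD1 in_setC => /andP[].
  - by exists r.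
  - by rewrite !inE eqxx.
  - by move=> y yA; rewrite in_setD1 in_setC (subsetP AL) ?andbF.
  exists l; rewrite inv'E in_setD1 in_setC lL andbF; split=> //.
  by apply: contraTneq lL => ->.
have [x xB [c1 c1P c1s]] : exists2 x, x \notin B &
    exists2 c, graph_cycle cov c & {subset c <= x |: A}.
  apply: (side_cycle q conn (y0 := E) (z0 := z0)) => //.
    by rewrite !inE eqxx.
  by move=> z zA zB; have [L []] := cutz z zA zB; exists L.
have cov'E : edge_rel (covers p' v') =2 cov.
  move=> y z; rewrite /edge_rel /= !inE /= !dom'E orbC.
  have ex y' z' : [exists t, dominates p' v' y' t && dominates p' v' t z'] =
      [exists t, dom z' t && dom t y'].
    by apply: eq_existsb => t; rewrite !dom'E andbC.
  by rewrite !ex.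
have conn' : connected_graph (edge_rel (covers p' v')).
  by move=> y z; rewrite (eq_connect cov'E).
have [y yA [c2 c2P c2s]] : exists2 x, x \notin A &
    exists2 c, graph_cycle (edge_rel (covers p' v')) c & {subset c <= x |: B}.
  apply: (side_cycle q' conn' (y0 := W) (z0 := z0)) => //.
    by rewrite !inE eqxx.
  by move=> z zB zA; have [L []] := cutz z zA zB; exists (~: L :\ z).
have {}c2P : graph_cycle cov c2.
  move: c2P; rewrite /graph_cycle /ucycleb.
  by case: c2 {c2s} => // t c2; rewrite /= (eq_path cov'E).
have T0 : 0 < #|T| by apply: leq_trans bigT.
apply: (two_cycles_card T0 (@covers_oriented _ p v) conn c1P c2P).
have AB t : t \in A -> t \notin B.
  move=> tA; have [L [[AL _ BL _ _] _]] := cutz z0 z0A z0B.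
  by apply/negP => /BL; rewrite (subsetP AL).
suff one t : t \in c1 -> t \in c2 -> t = x by move=> t u t1 u1 t2 u2; rewrite (one t t1 t2) (one u u1 u2).
move=> /c1s/setU1P[-> //|tA] /c2s/setU1P[ty|tB].
  by rewrite -ty tA in yA.
by move: (AB t tA); rewrite tB.
Qed.

End Separated.

(** * Permutations of size at most eight *)

(** The list predicates [has] and [all], the order [ltn] and the connective [&&]
    in forms that stop early when evaluated by value, since the branches of a
    conditional are evaluated on demand. *)
Fixpoint some (I : Type) (P : pred I) (s : seq I) : bool :=
  if s is x :: s' then if P x then true else some P s' else false.

Fixpoint every (I : Type) (P : pred I) (s : seq I) : bool :=
  if s is x :: s' then if P x then every P s' else false else true.

Fixpoint below (m n : nat) : bool :=
  if n is n'.+1 then if m is m'.+1 then below m' n' else true else false.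

Local Notation "b1 &&& b2" := (if b1 then b2 else false) (at level 41, right associativity).

Lemma someE I P s : @some I P s = has P s.
Proof. by elim: s => //= x s ->; case: (P x). Qed.

Lemma everyE I P s : @every I P s = all P s.
Proof. by elim: s => //= x s ->; case: (P x). Qed.

Lemma belowE m n : below m n = (m < n).
Proof. by elim: n m => [|n IHn] [|m] //=; rewrite IHn. Qed.

Arguments below : simpl never.

Section FiniteCheck.
Variable f : nat -> nat.
Implicit Types (A : seq nat) (P : pred nat).

(** Executable versions of the notions above for the points [(i, f i)], with
    [i] in an increasing list [A]. *)
Definition ndom i j := below i j &&& below (f j) (f i).

Definition nascent A P :=
  some (fun x => P x &&&
          some (fun y => below x y &&& P y &&& below (f x) (f y)) A) A.

(** It suffices to look at the cuts into the elements before some [t] and the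
    others. *)
Definition nno_cut A :=
  every (fun t => some (fun x => below x t &&&
          some (fun y => below t y.+1 &&& below (f y) (f x)) A) A)
      (behead A).

Definition ncore w no so e A :=
  nascent A (ndom w) &&& nascent A (ndom no) &&& nascent A (ndom^~ so) &&&
  nascent A (ndom^~ e) &&& nno_cut A.

Definition ncover A ij :=
  ndom ij.1 ij.2 &&& ~~ some (fun t => ndom ij.1 t &&& ndom t ij.2) A.

Definition compatible (q : seq nat) (xb yc : nat * nat) :=
  eqb (below (f xb.1) (f yc.1)) (below (nth 0 q xb.2) (nth 0 q yc.2)).

(** The labellings of [A] by indices of [q] that are allowed in an inflation, when
    [b] is the label of the element before [A].  A label that conflicts with
    the labels after it is discarded at once. *)
Fixpoint labellings (q : seq nat) (b : nat) A : seq (seq (nat * nat)) :=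
  if A is x :: A' then
    let extend c := if below c (size q) then
      [seq (x, c) :: l | l <- labellings q c A' & every (compatible q (x, c)) l]
      else [::] in
    extend b ++ extend b.+1
  else if below b.+1 (size q) then [::] else [:: [::]].

Definition ntower_base A q :=
  if A is x :: A' then some (every (compatible q (x, 0))) (labellings q 0 A') else false.

Definition ntower A := some (ntower_base A) tower_bases.

(** In a core that is not a tower and has too few minimal inversions, the deletion
    of one well-chosen point already contradicts [critical_sub]. *)
Definition ncheck (pairs : seq (nat * nat)) A w no so e : bool :=
  if ncore w no so e A then
    if below (size A) (size (filter (ncover A) pairs)) then true else
    if ntower A then true else
    some (fun d => if d \in [:: w; no; so; e] then false else
            if ncore w no so e (rem d A) then ~~ ntower (rem d A) else false) A
  else true.
End FiniteCheck.

(** The permutations of [rest] are built in reverse in front of [w]. *)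
Fixpoint all_words (m : nat) (w rest : seq nat) (P : pred (seq nat)) : bool :=
  if m is m'.+1 then every (fun x => all_words m' (x :: w) (rem x rest) P) rest
  else P w.

Definition check_size n :=
  let A := iota 0 n in let pairs := [seq (i, j) | i <- A, j <- A] in
  all_words n [::] A (fun u => ncheck (nth 0 u) pairs A 0 (index n.-1 u) (index 0 u) n.-1).

Lemma all_wordsP (m : nat) w rest P : all_words m w rest P -> size rest = m ->
  forall u, perm_eq u rest -> P (catrev u w).
Proof.
elim: m w rest => [|m IHm] w rest /=; rewrite ?everyE.
  by move=> Pw /eqP/nilP-> u /perm_nilP->.
move=> /allP H sr u; case: u => [|x u] pu; first by have := perm_size pu; rewrite sr.
have xr : x \in rest by rewrite -(perm_mem pu) mem_head.
apply: IHm (H x xr) _ _ _; first by rewrite size_rem // sr.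
rewrite -(perm_cons x); apply: perm_trans pu _; exact: perm_to_rem.
Qed.

(** An exhaustive computation over the permutations of size at most 8. *)
Lemma check_sizeP n : n <= 8 -> check_size n.
Proof.
have : every check_size (iota 0 9) by vm_compute.
by rewrite everyE => /allP H n8; apply: H; rewrite mem_iota.
Qed.

Section CheckSpec.
Variable f : nat -> nat.
Implicit Types (A : seq nat) (P : pred nat).

Lemma ndomE i j : ndom f i j = (i < j) && (f j < f i).
Proof. by rewrite /ndom !belowE. Qed.

Lemma nascentP A P :
  reflect (exists x y, [/\ x \in A, y \in A, P x, P y & (x < y) && (f x < f y)])
          (nascent f A P).
Proof.
rewrite /nascent someE; apply: (iffP hasP) => [[x xA]|[x [y [xA yA Px Py /andP[xy fxy]]]]].
  rewrite someE; case: ifP => // Px /hasP[y yA]; rewrite !belowE.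
  case: ifP => // xy; case: ifP => // Py fxy.
  by exists x, y; rewrite xy.
by exists x; rewrite // Px someE; apply/hasP; exists y; rewrite // !belowE xy Py.
Qed.

Lemma nno_cutP A : reflect
  (forall t, t \in behead A -> exists x y, [/\ x \in A, y \in A, x < t <= y & f y < f x])
  (nno_cut f A).
Proof.
rewrite /nno_cut everyE; apply: (iffP allP) => H t /H.
  rewrite someE => /hasP[x xA]; rewrite belowE someE; case: ifP => // xt /hasP[y yA].
  by rewrite !belowE ltnS; case: ifP => // ty fyx; exists x, y; rewrite xt.
move=> [x [y [xA yA /andP[xt ty] fyx]]]; rewrite someE; apply/hasP; exists x => //.
by rewrite belowE xt someE; apply/hasP; exists y; rewrite // !belowE ltnS ty.
Qed.

Definition nblocks A q g :=
  [/\ forall x, x \in A -> g x < size q,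
      forall j, j < size q -> exists2 x, x \in A & g x = j
    & {in A &, forall x y, x < y ->
        g x <= g y /\ (f x < f y) = (nth 0 q (g x) < nth 0 q (g y))}].

(** Consecutive labels of a surjective nondecreasing labelling grow by at most 1. *)
Definition step : rel nat := fun c c' => (c' == c) || (c' == c.+1).

Lemma step_leq w b : path step b w -> path leq b w.
Proof. by apply: sub_path => c c' /orP[]/eqP->. Qed.

Lemma step_last w b : path step b w -> b <= last b w.
Proof.
elim: w b => //= c w IHw b /andP[bc /IHw]; apply: leq_trans.
by case/orP: bc => /eqP->.
Qed.

Lemma step_mem w b j : path step b w -> b <= j <= last b w -> j \in b :: w.
Proof.
elim: w b => [|c w IHw] b /=.
  by move=> _ /anti_leq->; rewrite mem_head.
move=> /andP[bc pw] /andP[bj jl]; rewrite inE; case: eqVneq => //= jb.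
by apply: IHw => //; rewrite jl andbT; case/orP: bc => /eqP->; lia.
Qed.

Lemma labellings_sound q b A l : l \in labellings f q b A -> b < size q ->
  [/\ map fst l = A, pairwise (compatible f q) l, path step b (map snd l)
    & last b (map snd l) = (size q).-1].
Proof.
elim: A b l => [|x A IHA] b l /=.
  rewrite belowE; case: ltnP => [_|bs]; rewrite ?in_nil // mem_seq1 => /eqP-> lb.
  by split=> //=; lia.
have ext c : l \in (if below c (size q) then
    [seq (x, c) :: l' | l' <- labellings f q c A & every (compatible f q (x, c)) l']
      else [::]) -> step b c -> b < size q ->
    [/\ map fst l = x :: A, pairwise (compatible f q) l, path step b (map snd l)
    & last b (map snd l) = (size q).-1].
  rewrite belowE; case: ifP => // cs /mapP[l']; rewrite mem_filter everyE.
  move=> /andP[cl /IHA/(_ cs)[<- pl pth lst] ->] bc _.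
  by split=> //=; rewrite ?cl ?pl ?bc ?pth.
by rewrite mem_cat => /orP[]/ext; apply; rewrite /step eqxx ?orbT.
Qed.

Lemma labellings_complete q b A (g : nat -> nat) :
  path step b (map g A) -> last b (map g A) = (size q).-1 -> 0 < size q ->
  pairwise (compatible f q) [seq (x, g x) | x <- A] ->
  [seq (x, g x) | x <- A] \in labellings f q b A.
Proof.
elim: A b => [|x A IHA] b /=; first by move=> _ -> q0; rewrite belowE prednK // ltnn inE.
move=> /andP[bx px] lx q0 /andP[ax pa]; set l := [seq _ | _ <- A].
have gs : g x < size q by rewrite -(prednK q0) ltnS -lx step_last.
have ext c : c = g x -> (x, g x) :: l \in (if below c (size q) then
    [seq (x, c) :: l' | l' <- labellings f q c A & every (compatible f q (x, c)) l']
      else [::]).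
  move=> ->; rewrite belowE gs; apply/mapP; exists l => //.
  by rewrite mem_filter everyE ax; apply: IHA.
by rewrite mem_cat; apply/orP; case/orP: bx => /eqP e; [left|right]; apply: ext.
Qed.

Lemma ntower_blocks A : sorted ltn A -> ntower f A ->
  exists2 q, q \in tower_bases & exists g, nblocks A q g.
Proof.
move=> sA; rewrite /ntower someE => /hasP[q qb H]; exists q => //.
have q0 : 0 < size q by have /andP[] := base_size qb; lia.
case: A sA H => [|a A] sA //=; rewrite someE => /hasP[l lL]; rewrite everyE => al.
have [lA pl pth lst] := labellings_sound lL q0.
pose w := 0 :: map snd l; exists (fun x => nth 0 w (index x (a :: A))).
have sw : size w = size (a :: A) by rewrite /= -lA !size_map.
have sow : sorted leq w by apply: step_leq.
have uA : uniq (a :: A) by apply: sorted_uniq sA => //; [exact: ltn_trans|exact: ltnn].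
have leqlast i : i < size w -> nth 0 w i <= (size q).-1.
  move=> iw; have -> : (size q).-1 = nth 0 w (size w).-1 by rewrite nth_last.
  apply: (sorted_leq_nth leq_trans leqnn 0 sow); rewrite ?inE //; lia.
split=> [x xA|j js|x y xA yA xy].
- by rewrite -[X in _ < X](prednK q0) ltnS leqlast // sw index_mem.
- have : j \in w by apply: step_mem pth _; rewrite lst /=; lia.
  move/(nthP 0) => [i iw <-]; exists (nth 0 (a :: A) i); rewrite ?mem_nth -?sw //.
  by rewrite index_uniq -?sw.
have ij : index x (a :: A) < index y (a :: A).
  rewrite ltnNge; apply/negP => yx.
  have sl : sorted leq (a :: A) by apply: sub_sorted sA => i j /ltnW.
  have := sorted_leq_nth leq_trans leqnn 0 sl (index y (a :: A)) (index x (a :: A)).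
  by rewrite !inE !index_mem => /(_ yA xA yx); rewrite !nth_index // leqNgt xy.
split.
  by apply: (sorted_leq_nth leq_trans leqnn 0 sow); rewrite ?inE ?sw ?index_mem // ltnW.
have pw : pairwise (compatible f q) ((a, 0) :: l) by rewrite /= al.
have n1 i : i < size w -> nth (0, 0) ((a, 0) :: l) i = (nth 0 (a :: A) i, nth 0 w i).
  case: i => //= i; rewrite size_map ltnS -lA => il.
  by rewrite !(nth_map (0, 0)) //; case: (nth _ _ _).
have sl : size ((a, 0) :: l) = size w by rewrite /= size_map.
move/(pairwiseP (0, 0)): pw => /(_ (index x (a :: A)) (index y (a :: A))).
rewrite !inE sl sw !index_mem => /(_ xA yA ij).
rewrite !n1 ?sw ?index_mem // !nth_index // /compatible /= !belowE.
by move/eqP.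
Qed.

Lemma blocks_ntower A q g : sorted ltn A -> q \in tower_bases -> nblocks A q g ->
  ntower f A.
Proof.
move=> sA qb [bs sur mon].
have q0 : 0 < size q by have /andP[] := base_size qb; lia.
have uA : uniq A by apply: sorted_uniq sA => //; [exact: ltn_trans|exact: ltnn].
have ltn_nthA i j : i < j -> j < size A -> nth 0 A i < nth 0 A j.
  by move=> ij js; rewrite (sorted_ltn_nth ltn_trans 0 sA) ?inE //; apply: ltn_trans js.
have leq_g i j : i <= j -> j < size A -> g (nth 0 A i) <= g (nth 0 A j).
  rewrite leq_eqVlt => /orP[/eqP-> //|ij] js.
  have is_ := ltn_trans ij js.
  by have [] := mon _ _ (mem_nth 0 is_) (mem_nth 0 js) (ltn_nthA _ _ ij js).
have steps : sorted step (map g A).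
  apply/(sortedP 0) => i; rewrite size_map => iS; rewrite !(nth_map 0) //; last exact: ltnW.
  have le := leq_g i i.+1 (leqnSn i) iS; rewrite /step.
  case: eqVneq => //= ne.
  have [|z zA gz] := sur (g (nth 0 A i)).+1.
    apply: leq_trans (bs _ (mem_nth 0 iS)); rewrite ltnS ltn_neqAle le andbT.
    by rewrite eq_sym.
  move: zA => /(nthP 0)[k kS Dz]; rewrite -{}Dz in gz.
  have [ki|ik] := leqP k i.
    by have := leq_g k i ki (ltnW iS); rewrite gz ltnn.
  have := leq_g _ _ ik kS; rewrite gz eqn_leq => ->.
  by rewrite ltn_neqAle eq_sym ne le.
have [a0 a0A ga0] := sur 0 q0.
case: A => [|a A] // in sA uA ltn_nthA leq_g steps a0A bs sur mon *.
have ga : g a = 0.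
  move: a0A => /(nthP 0)[k kS Dz]; have := leq_g 0 k isT kS.
  by rewrite Dz ga0 leqn0 => /eqP.
have lst : last 0 (map g A) = (size q).-1.
  have [|z /(nthP 0)[k kS Dz] gz] := sur (size q).-1; first by rewrite prednK.
  have kA : k <= (size (a :: A)).-1 by rewrite -ltnS prednK.
  have := leq_g k (size (a :: A)).-1 kA (leqnn _).
  rewrite Dz gz nth_last /= -ga last_map => h; apply/eqP; rewrite eqn_leq h andbT.
  by rewrite -ltnS prednK // bs // mem_last.
have compat : pairwise (compatible f q) [seq (x, g x) | x <- a :: A].
  apply/(pairwiseP (0, 0)) => i j; rewrite !inE size_map => iS jS ij.
  rewrite !(nth_map 0) // /compatible !belowE /=.
  by apply/eqP; have [_ ->] := mon _ _ (mem_nth 0 iS) (mem_nth 0 jS) (ltn_nthA _ _ ij jS).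
rewrite /ntower someE; apply/hasP; exists q => //=; rewrite someE; apply/hasP.
move: compat steps; rewrite /= ga => /andP[ca cA] st.
exists [seq (x, g x) | x <- A]; last by rewrite everyE.
exact: labellings_complete.
Qed.

End CheckSpec.

Section SmallCase.
Variables (n : nat) (s : 'S_n).
Let p (i : 'I_n) : nat := i.
Let v (i : 'I_n) : nat := s i.
Variables W N S E : 'I_n.
Hypotheses (Wmin : forall x, p W <= p x) (Emax : forall x, p x <= p E).
Hypotheses (Smin : forall x, v S <= v x) (Nmax : forall x, v x <= v N).

Let word := [seq v i | i <- enum 'I_n].
Let f := nth 0 word.

Let fE i : f (p i) = v i.
Proof. by rewrite /f /word /p (nth_map i) ?size_enum_ord ?ltn_ord // nth_ord_enum. Qed.

Section Restrict.
Variables (X : {set 'I_n}) (A : seq nat).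
Hypotheses (AX : forall i, (p i \in A) = (i \in X)) (An : forall x, x \in A -> x < n).
Hypothesis (sA : sorted ltn A).

Let lift x : x \in A -> exists2 i, i \in X & x = p i.
Proof.
by move=> xA; exists (Ordinal (An xA)) => //; rewrite -AX.
Qed.

Lemma nascent_ascent P : reflect (ascent p v X (P \o p)) (nascent f A P).
Proof.
apply: (iffP (nascentP f A P)) => [[x [y [xA yA Px Py xy]]]|[i [j [iX jX Pi Pj ij]]]].
  have [i iX Di] := lift xA; have [j jX Dj] := lift yA.
  by exists i, j; rewrite -!fE /= -Di -Dj.
by exists (p i), (p j); rewrite !AX !fE.
Qed.

Lemma ndom_dom i j : ndom f (p i) (p j) = dominates p v i j.
Proof. by rewrite ndomE !fE. Qed.

Lemma no_cut_nno_cut : (forall D, ~ cut p v X D) -> nno_cut f A.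
Proof.
move=> nocut; apply/nno_cutP => t tA.
case HA : A tA => [|a A'] //= tA.
have tX : t \in A by rewrite HA inE tA orbT.
have at_ : a < t.
  move: sA; rewrite HA /= path_sortedE; last exact: ltn_trans.
  by case/andP => /allP/(_ t tA).
rewrite -HA; case: (boolP [exists i in X, exists j in X, (p i < t <= p j) && (v j < v i)]).
  case/exists_inP=> i iX /exists_inP[j jX /andP[ij vji]].
  by exists (p i), (p j); rewrite !AX !fE.
rewrite negb_exists => /forallP noij; case: (nocut [set i | p i < t]).
have [i iX Di] : exists2 i, i \in X & a = p i by apply: lift; rewrite HA mem_head.
have [j jX Dj] := lift tX.
split; [by exists i; rewrite ?inE -?Di|by exists j; rewrite ?inE -?Dj ?ltnn|].
move=> k l kX lX; rewrite !inE -leqNgt => kt tl.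
rewrite (leq_trans kt tl) /= ltnNge leq_eqVlt negb_or.
have := noij k; rewrite kX /= negb_exists => /forallP/(_ l); rewrite lX kt tl /= => ->.
rewrite andbT; apply: contraL kt => /eqP/val_inj/perm_inj <-.
by rewrite -leqNgt.
Qed.

Lemma nno_cut_no_cut : nno_cut f A -> forall D, ~ cut p v X D.
Proof.
move=> /nno_cutP nc D [[i iX iD] [j jX jD] H].
have ex : exists m, [exists k in X, (k \notin D) && (p k == m)].
  by exists (p j); apply/exists_inP; exists j; rewrite ?jD /=.
case: (ex_minnP ex) => m /exists_inP[k kX /andP[kD /eqP Dm]] kmin; subst m.
have kA : p k \in behead A.
  have : p k \in A by rewrite AX.
  case: (A) sA (AX i) => [|a A'] //= pA; rewrite iX !inE => iA /orP[/eqP pka|//].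
  have /andP[ik _] := H i k iX kX iD kD.
  move: pA; rewrite path_sortedE; last exact: ltn_trans.
  case/andP => /allP aA _; case/orP: iA => [/eqP|/aA]; rewrite -pka.
    by move=> e; rewrite e ltnn in ik.
  by move=> ki; rewrite ltnNge (ltnW ki) in ik.
have [x [y [xA yA /andP[xk ky] fyx]]] := nc _ kA.
have [a aX Da] := lift xA; have [b bX Db] := lift yA; subst x y.
rewrite !fE in fyx.
have aD : a \in D.
  apply: contraLR xk => aD; rewrite -leqNgt; apply: kmin.
  by apply/exists_inP; exists a; rewrite ?aD /=.
have [bD|bD] := boolP (b \in D).
  by have /andP[bk _] := H b k bX kX bD kD; rewrite leqNgt bk in ky.
by have /andP[_ ab] := H a b aX bX aD bD; rewrite ltnNge (ltnW ab) in fyx.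
Qed.

Lemma ncoreP : corners_in W N S E X ->
  reflect (core p v W N S E X) (ncore f (p W) (p N) (p S) (p E) A).
Proof.
move=> cX.
have lowP d : reflect (bad_low p v X d) (nascent f A (ndom f (p d))).
  apply: (iffP (nascent_ascent _)) => -[x [y [xX yX Px Py xy]]]; exists x, y;
    by rewrite /= ?ndom_dom // -?ndom_dom.
have highP d : reflect (bad_high p v X d) (nascent f A ((ndom f)^~ (p d))).
  apply: (iffP (nascent_ascent _)) => -[x [y [xX yX Px Py xy]]]; exists x, y;
    by rewrite /= ?ndom_dom // -?ndom_dom.
rewrite /ncore; apply: (iffP idP).
  case: (lowP W) => // bW; case: (lowP N) => // bN; case: (highP S) => // bS.
  case: (highP E) => // bE nc.
  by split=> //; apply: nno_cut_no_cut.
case=> _ [/lowP-> /lowP-> /highP-> /highP->]; exact: no_cut_nno_cut.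
Qed.

Lemma ntowerP : reflect (tower_on p v X) (ntower f A).
Proof.
apply: (iffP idP) => [/(ntower_blocks sA)[q qb [g [bs sur mon]]]|[q qb [b [bs sur mon]]]].
  exists q => //; exists (g \o p); split=> [i iX|j js|i j iX jX ij] /=.
  - by apply: bs; rewrite AX.
  - by have [x xA gx] := sur j js; have [i iX Di] := lift xA; exists i; rewrite //= -Di.
  - by rewrite -!fE; apply: mon; rewrite ?AX.
pose g x := if insub x is Some i then b i else 0.
have gE i : g (p i) = b i.
  by rewrite /g insubT ?ltn_ord // => h; congr b; apply: val_inj.
apply: (@blocks_ntower f A q g) => //; split=> [x xA|j js|x y xA yA].
- by have [i iX ->] := lift xA; rewrite gE bs.
- by have [i iX bi] := sur j js; exists (p i); rewrite ?AX // gE.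
- have [i iX ->] := lift xA; have [j jX ->] := lift yA; rewrite !gE !fE.
  exact: mon.
Qed.

End Restrict.

Lemma ncovers_card : size [seq ij <- [seq (i, j) | i <- iota 0 n, j <- iota 0 n]
    | ncover f (iota 0 n) ij] <= #|covers p v|.
Proof.
rewrite cardE -(size_map (fun e => (p e.1, p e.2))); apply: uniq_leq_size.
  by rewrite filter_uniq // allpairs_uniq ?iota_uniq // => -[? ?] [? ?].
move=> ij; rewrite mem_filter => /andP[cij /allpairsP[[x y] /= [xn yn Dij]]].
rewrite {}Dij in cij *; rewrite !mem_iota !add0n /= in xn yn.
pose i := Ordinal xn; pose j := Ordinal yn.
apply/mapP; exists (i, j) => //; rewrite mem_enum inE /=.
move: cij; rewrite /ncover /= -[x]/(p i) -[y]/(p j) ndom_dom; case: ifP => //= _.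
apply: contra => /existsP[t /andP[it tj]]; rewrite someE; apply/hasP.
exists (p t); first by rewrite mem_iota; apply: ltn_ord.
by rewrite -[x]/(p i) -[y]/(p j) !ndom_dom it.
Qed.

(** Were the conclusion false, [check_size] would provide a proper core that is
    not a tower. *)
Lemma small_covers : n <= 8 -> core p v W N S E setT -> ~ tower_on p v setT ->
  (forall A, A != setT -> core p v W N S E A -> tower_on p v A) ->
  n < #|covers p v|.
Proof.
move=> n8 coreT ntowerT crit.
have n0 : 0 < n by apply: leq_ltn_trans (ltn_ord W).
have pW : p W = 0 by apply/eqP; rewrite -leqn0; apply: (Wmin (Ordinal n0)).
have nP : n.-1 < n by rewrite prednK.
have pE : p E = n.-1.
  by apply/eqP; rewrite eqn_leq (Emax (Ordinal nP)) andbT -ltnS prednK //; apply: ltn_ord.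
have vS : v S = 0.
  by apply/eqP; rewrite -leqn0; have := Smin (s^-1%g (Ordinal n0)); rewrite /v permKV.
have vN : v N = n.-1.
  apply/eqP; rewrite eqn_leq -{1}ltnS prednK // ltn_ord /=.
  by have := Nmax (s^-1%g (Ordinal nP)); rewrite /v permKV.
have uw : uniq word.
  by rewrite map_inj_uniq ?enum_uniq // => i j /val_inj/perm_inj.
have sw : size word = n by rewrite size_map size_enum_ord.
have idx i : index (v i) word = p i by rewrite -fE index_uniq // sw ltn_ord.
have pw : perm_eq word (iota 0 n).
  apply: uniq_perm; rewrite ?iota_uniq //.
  have sub : {subset word <= iota 0 n}.
    by move=> x /mapP[i _ ->]; rewrite mem_iota; apply: ltn_ord.
  by have [|_ eqw] := uniq_min_size uw sub; rewrite ?sw ?size_iota.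
(* [all_words] adds the letters of a word from right to left. *)
have prw : perm_eq (rev word) (iota 0 n) by rewrite perm_rev.
have := all_wordsP (check_sizeP n8) (size_iota 0 n) prw.
rewrite -/(rev (rev word)) revK -/f => chk.
have {chk} : ncheck f [seq (i, j) | i <- iota 0 n, j <- iota 0 n] (iota 0 n) (p W) (p N) (p S) n.-1.
  by rewrite -(idx N) -(idx S) vN vS pW.
have A0 i : (p i \in iota 0 n) = (i \in [set: 'I_n]) by rewrite mem_iota inE ltn_ord.
have An x : x \in iota 0 n -> x < n by rewrite mem_iota.
rewrite /ncheck (_ : ncore _ _ _ _ _ _ = true); last first.
  rewrite -pE; apply/(ncoreP A0 An (iota_ltn_sorted 0 n)) => //.
  by rewrite /corners_in !inE.
case: ifP => [|_]; first by rewrite belowE size_iota => h _; apply: leq_trans h ncovers_card.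
case: ifP => [/(ntowerP A0 An (iota_ltn_sorted 0 n)) //|_].
rewrite someE => /hasP[x]; rewrite mem_iota /= => xn.
rewrite -[x]/(p (Ordinal xn)); set d := Ordinal xn.
rewrite !inE; case: ifP => // dc.
pose X := [set: 'I_n] :\ d; pose A := rem (p d) (iota 0 n).
have AX i : (p i \in A) = (i \in X).
  by rewrite /A rem_filter ?iota_uniq // mem_filter /= A0 !inE.
have {}An y : y \in A -> y < n by move=> /mem_rem; apply: An.
have sA : sorted ltn A
  by rewrite /A rem_filter ?iota_uniq // sorted_filter ?iota_ltn_sorted //; apply: ltn_trans.
have XT : X != setT by apply: contraTneq (in_setT d) => <-; rewrite !inE eqxx.
have cX : corners_in W N S E X.
  move/negbT: dc; rewrite -pE !negb_or => /and4P[dW dN dS dE].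
  have ne C : p d != p C -> C \in X by move=> h; rewrite !inE andbT; apply: contraNneq h => ->.
  by apply/and4P; split; apply: ne.
rewrite -pE; case: ifP => // nc /negP ntX; have coreX := elimT (ncoreP AX An sA cX) nc.
by case: ntX; apply/(ntowerP AX An sA); apply: crit.
Qed.

End SmallCase.

(** * Inflations as block labellings *)

Section Inflation.

Lemma size_one_line n (s : 'S_n) : size (one_line s) = n.
Proof. by rewrite size_map size_enum_ord. Qed.

Lemma nth_one_line n (s : 'S_n) (i : 'I_n) : nth 0 (one_line s) i = (s i).+1.
Proof. by rewrite (nth_map i) ?size_enum_ord // nth_ord_enum. Qed.

Lemma one_line_of_seq (q : seq nat) : perm_eq q (iota 1 (size q)) ->
  exists q' : 'S_(size q), one_line q' = q.
Proof.
move=> pq; have uq : uniq q by rewrite (perm_uniq pq) iota_uniq.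
have qP j : j < size q -> 0 < nth 0 q j <= size q.
  by move=> js; have := mem_nth 0 js; rewrite (perm_mem pq) mem_iota add1n ltnS.
have lt (j : 'I_(size q)) : (nth 0 q j).-1 < size q by have := qP j (ltn_ord j); lia.
have inj : injective (fun j => Ordinal (lt j)).
  move=> i j /(congr1 val) /= e; apply/val_inj/eqP.
  rewrite /= -(nth_uniq 0 (ltn_ord i) (ltn_ord j) uq).
  have /andP[i0 _] := qP i (ltn_ord i); have /andP[j0 _] := qP j (ltn_ord j).
  by rewrite -(prednK i0) -(prednK j0) e.
exists (perm inj); apply: (@eq_from_nth _ 0); first by rewrite size_one_line.
move=> j; rewrite size_one_line => js.
rewrite -[j]/(val (Ordinal js)) nth_one_line permE /=; have := qP j js; lia.
Qed.

Lemma card_sum_fibers (T : finType) k (b : T -> 'I_k) (P : pred 'I_k) :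
  \sum_(j < k | P j) #|[set x | b x == j]| = #|[set x | P (b x)]|.
Proof.
rewrite -[RHS]sum1_card (partition_big b P) => [|x]; last by rewrite inE.
apply: eq_bigr => j Pj; rewrite -sum1_card; apply: eq_bigl => x; rewrite !inE.
by case: eqP => [->|]; rewrite ?Pj ?andbF.
Qed.

(** Positions and values in an inflation are cardinals of sets of points; this
    splits such a cardinal according to the position of a point relative to
    a block. *)
Lemma card_set_add (T : finType) (P Q R : pred T) : (forall x, P x = Q x + R x :> nat) ->
  #|[set x | P x]| = #|[set x | Q x]| + #|[set x | R x]|.
Proof.
have E A : #|[set x : T | A x]| = \sum_x (A x : nat).
  by rewrite -sum1_card big_mkcond; apply: eq_bigr => x _; rewrite inE; case: (A x).
by move=> H; rewrite !E -big_split; apply: eq_bigr.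
Qed.

Lemma card_lt_ord n k : k <= n -> #|[set i : 'I_n | i < k]| = k.
Proof.
move=> kn; rewrite -sum1_card (eq_bigl (fun i : 'I_n => i < k)); last by move=> i; rewrite inE.
by rewrite -(big_ord_widen n (fun=> 1) kn) sum1_card card_ord.
Qed.

Variables (k : nat) (q : 'S_k) (l : 'I_k -> nat).

Let base (i : 'I_k) := \sum_(j < k | q j < q i) l j.
Let sh := [seq l i | i <- enum 'I_k].

Lemma shape_inflation :
  shape [seq rev (iota (\sum_(j < k | q j < q i) l j).+1 (l i)) | i <- enum 'I_k] = sh.
Proof.
by rewrite /shape -map_comp; apply: eq_map => i /=; rewrite size_rev size_iota.
Qed.

Lemma nth_shape (i : 'I_k) : nth 0 sh i = l i.
Proof. by rewrite (nth_map i) ?size_enum_ord // nth_ord_enum. Qed.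

Lemma sumn_shape : sumn sh = \sum_(i < k) l i.
Proof. by rewrite sumnE big_map big_enum. Qed.

Lemma sumn_take_shape m : m <= k -> sumn (take m sh) = \sum_(j < k | j < m) l j.
Proof.
move=> mk; rewrite -(map_nth_iota0 0); last by rewrite size_map -cardE card_ord.
rewrite sumnE big_map -{1}[m]subn0 big_mkord (big_ord_widen k (nth 0 sh) mk).
by apply: eq_bigr => j _; rewrite nth_shape.
Qed.

Lemma size_inflation : size (inflation q l) = \sum_(i < k) l i.
Proof. by rewrite size_flatten shape_inflation sumn_shape. Qed.

Lemma nth_inflation x (i : 'I_k) : reshape_index sh x = i ->
  reshape_offset sh x < l i ->
  nth 0 (inflation q l) x = base i + l i - reshape_offset sh x.
Proof.
move=> xi oi; rewrite /inflation nth_flatten shape_inflation xi.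
rewrite (nth_map i) ?size_enum_ord // nth_ord_enum nth_rev size_iota //.
rewrite nth_iota; last by lia.
by rewrite /base; lia.
Qed.

Lemma base_lt (i j : 'I_k) : q i < q j -> base i + l i <= base j.
Proof.
move=> qij; rewrite /base [X in _ <= X](bigD1 i) //= addnC leq_add2l.
rewrite [X in _ <= X]big_mkcond [X in X <= _]big_mkcond /=; apply: leq_sum => t _.
case: ifP => // qti; rewrite (ltn_trans qti qij) /=.
by case: eqP qti => [->|]; rewrite ?ltnn.
Qed.

End Inflation.

Section Towers.
Variables (n : nat) (s : 'S_n).
Let p (i : 'I_n) : nat := i.
Let v (i : 'I_n) : nat := s i.

(** The block of an entry is the part of the flattened list to which its index
    belongs. *)
Lemma tower_tower_on : tower s -> tower_on p v setT.
Proof.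
move=> [k [q [l [qb l0 sq]]]].
set sh := [seq l i | i <- enum 'I_k].
have szsh : size sh = k by rewrite size_map size_enum_ord.
have sn : sumn sh = n.
  by rewrite sumn_shape -(size_inflation q) -sq size_one_line.
have ri (x : 'I_n) : reshape_index sh x < k.
  by rewrite -[X in _ < X]szsh reshape_indexP // sn.
have ro (x : 'I_n) : reshape_offset sh x < l (Ordinal (ri x)).
  have xs : x < sumn sh by rewrite sn.
  by rewrite -(nth_shape l (Ordinal (ri x))); apply: reshape_offsetP.
have vE x : (v x).+1 = \sum_(j < k | q j < q (Ordinal (ri x))) l j + l (Ordinal (ri x))
    - reshape_offset sh x.
  by rewrite -nth_one_line sq (@nth_inflation _ _ _ _ (Ordinal (ri x))).
exists (one_line q) => //; exists (fun x : 'I_n => reshape_index sh x); split.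
- by move=> x _; rewrite size_one_line.
- move=> j; rewrite size_one_line => jk; pose j' := Ordinal jk.
  have l0' : 0 < nth 0 sh j by rewrite -[j]/(val j') nth_shape.
  have xs : flatten_index sh j 0 < n by rewrite -sn flatten_indexP.
  by exists (Ordinal xs); rewrite //= flatten_indexKl.
move=> x y _ _ pxy; split.
  by have := ltnW pxy; rewrite /p (reshape_leq sh x y) => /orP[/ltnW|/andP[/eqP-> _]].
rewrite -[reshape_index sh x]/(val (Ordinal (ri x))) -[reshape_index sh y]/(val (Ordinal (ri y))).
rewrite !nth_one_line ltnS.
have le : ~~ (y <= x) by rewrite -ltnNge.
have := vE x; have := vE y; have := ro x; have := ro y.
have [qxy|qyx|] := ltngtP (q (Ordinal (ri x))) (q (Ordinal (ri y))).
- have := base_lt l qxy; lia.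
- have := base_lt l qyx; lia.
move=> /val_inj/perm_inj e; rewrite -e.
move: le; rewrite (reshape_leq sh y x) negb_or.
have -> : reshape_index sh y = reshape_index sh x by case: e.
by rewrite ltnn eqxx /= -ltnNge; lia.
Qed.

(** The lengths of the blocks are the sizes of the fibres of [b].  The [o] points
    to the left of [i] in its block and the earlier blocks make up the position of
    [i]; the [o'] points to the right of it in its block and the blocks of smaller
    entries make up its value. *)
Lemma tower_on_tower : tower_on p v setT -> tower s.
Proof.
move=> [q qb [b [bs sur mon]]].
have [q' Dq] : exists q' : 'S_(size q), one_line q' = q.
  by apply: one_line_of_seq; move: q qb {b bs sur mon}; apply/allP.
pose b' (x : 'I_n) : 'I_(size q) := Ordinal (bs x (in_setT x)).
have qE x : nth 0 q (b x) = (q' (b' x)).+1 by rewrite -nth_one_line Dq.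
pose l i := #|[set x | b' x == i]|.
exists (size q), q', l; split; first by rewrite Dq.
  move=> i; have [x _ bx] := sur i (ltn_ord i); apply/card_gt0P; exists x.
  by rewrite inE; apply/eqP/val_inj.
have sn : \sum_(i < size q) l i = n.
  rewrite (card_sum_fibers b' predT) -[RHS]card_ord.
  by apply: eq_card => x; rewrite !inE.
apply: (@eq_from_nth _ 0) => [|x]; first by rewrite size_one_line size_inflation sn.
rewrite size_one_line => xn; pose i := Ordinal xn; rewrite -[x]/(val i) nth_one_line.
set sh := [seq l i | i <- enum 'I_(size q)].
pose o := #|[set y : 'I_n | (y < i) && (b' y == b' i)]|.
pose o' := #|[set y : 'I_n | (i < y) && (b' y == b' i)]|.
have lo : l (b' i) = o + 1 + o'.
  have e1 : #|[set y : 'I_n | (i <= y) && (b' y == b' i)]| = 1 + o'.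
    rewrite -(cards1 i) (_ : [set i] = [set y | y == i]); last by apply/setP=> y; rewrite !inE.
    apply: card_set_add => y; rewrite -[y == i](inj_eq val_inj) /=.
    by case: (ltngtP y i) => [//|//|yi]; rewrite (val_inj yi) eqxx.
  rewrite -addnA -e1; apply: card_set_add => y.
  by case: (ltngtP y i) => //= _; rewrite ?addn0.
have monb (y z : 'I_n) : y <= z -> b y <= b z.
  rewrite leq_eqVlt => /orP[/eqP/val_inj-> //|yz].
  by have [] := mon y z (in_setT y) (in_setT z) yz.
have iE : i = flatten_index sh (b' i) o :> nat.
  rewrite /flatten_index.
  have -> : sumn (take (b' i) sh) = #|[set y | b' y < b' i]|.
    rewrite -(card_sum_fibers b' (fun j => j < b' i)) -/l.
    exact: sumn_take_shape (ltnW (ltn_ord (b' i))).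
  rewrite -[LHS](@card_lt_ord n i) 1?ltnW //; apply: card_set_add => y.
  rewrite -(inj_eq val_inj) /=; case: (ltngtP (b y) (b i)) => byi.
  + by have -> : y < i by rewrite ltnNge; apply/negP => /monb; rewrite leqNgt byi.
  + by rewrite ltnNge; have -> : i <= y by rewrite leqNgt; apply/negP => /ltnW/monb; rewrite leqNgt byi.
  + by rewrite andbT.
have sE : s i = \sum_(j < size q | q' j < q' (b' i)) l j + o' :> nat.
  rewrite (card_sum_fibers b' (fun j => q' j < q' (b' i))).
  rewrite -[LHS](@card_lt_ord n (s i)) 1?ltnW // -(card_preimset _ (@perm_inj _ s)).
  rewrite (_ : _ @^-1: _ = [set y | s y < s i]); last by apply/setP => y; rewrite !inE.
  apply: card_set_add => y; rewrite -[nat_of_ord (s y)]/(v y) -[nat_of_ord (s i)]/(v i).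
  have [yi|iy|/val_inj->] := ltngtP y i; last by rewrite !ltnn.
    have [_] := mon y i (in_setT _) (in_setT _) yi.
    by rewrite !qE ltnS => ->; rewrite addn0.
  have [_] := mon i y (in_setT _) (in_setT _) iy; rewrite !qE ltnS => miy.
  have vyi : v y <> v i by move/val_inj/perm_inj => e; rewrite e ltnn in iy.
  have [e|ne] := eqVneq (b' y) (b' i); first by move: miy; rewrite e !ltnn; lia.
  have : q' (b' y) <> q' (b' i) :> nat by move/val_inj/perm_inj/eqP; apply/negP.
  by lia.
have oi : o < nth 0 sh (b' i) by rewrite nth_shape lo; lia.
have xE : x = flatten_index sh (b' i) o := iE.
have rx : reshape_index sh x = b' i by rewrite {1}xE flatten_indexKl.
have ox : reshape_offset sh x = o by rewrite {1}xE flatten_indexKr.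
have ol : reshape_offset sh x < l (b' i) by rewrite ox lo; lia.
by rewrite (nth_inflation q' rx ol) ox sE lo; lia.
Qed.

End Towers.

(** * Patterns and direct sums *)

Section Standardize.

(** The value at [x] is the number of smaller values of [s] in the range of
    [f]. *)
Lemma standardize m n (s : 'S_n) (f : 'I_m -> 'I_n) : injective f ->
  exists t : 'S_m, forall x y, (t x < t y) = (s (f x) < s (f y)).
Proof.
move=> f_inj; pose below x := [set y | s (f y) < s (f x)].
have lt x : #|below x| < m.
  rewrite -[X in _ < X]card_ord -cardsT; apply: proper_card; rewrite properE subsetT.
  by apply/negP => /subsetP/(_ x (in_setT x)); rewrite inE ltnn.
have mono x y : (#|below x| < #|below y|) = (s (f x) < s (f y)).
  have le z w : s (f z) <= s (f w) -> below z \subset below w.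
    by move=> zw; apply/subsetP => u; rewrite !inE => uz; apply: leq_trans uz zw.
  have [xy|yx] := ltnP (s (f x)) (s (f y)); last first.
    by apply/negbTE; rewrite -leqNgt subset_leq_card // le.
  apply: proper_card; rewrite properE le 1?ltnW //=.
  by apply/negP => /subsetP/(_ x); rewrite !inE ltnn => /(_ xy).
have inj : injective (fun x => Ordinal (lt x)).
  move=> x y /(congr1 val) /= e; apply/f_inj/(@perm_inj _ s)/val_inj/eqP => /=.
  by have := mono x y; have := mono y x; rewrite e ltnn; case: ltngtP.
by exists (perm inj) => x y; rewrite !permE /= mono.
Qed.

Lemma direct_sumP a b n (al : 'S_a) (be : 'S_b) (s : 'S_n) : is_direct_sum al be s ->
  [/\ n = a + b, forall (x : 'I_n) (h : x < a), s x = al (Ordinal h) :> nat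
    & forall (x : 'I_n) (y : 'I_b), x = a + y :> nat -> s x = be y + a :> nat].
Proof.
move=> ds; have := congr1 size ds; rewrite size_cat size_map !size_one_line => nab.
split=> // [x h|x y xy]; apply/succn_inj; rewrite -nth_one_line ds nth_cat size_one_line.
  by rewrite h -nth_one_line.
rewrite xy ltnNge leq_addr /= addKn (nth_map 0) ?size_one_line // nth_one_line.
by rewrite addSn.
Qed.

Lemma summand_pattern m n (t : 'S_m) (s : 'S_n) : indecomposable_summand t s ->
  is_pattern t s.
Proof.
case=> _ _ [a [b [c [al [be [ga [ds1 ds2]]]]]]].
have [nac _ H2] := direct_sumP ds2; have [cmb H1 _] := direct_sumP ds1.
have xs (x : 'I_m) : a + x < n by rewrite nac cmb; have := ltn_ord x; lia.
have xc (x : 'I_m) : x < c by rewrite cmb; have := ltn_ord x; lia.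
have E (x : 'I_m) : s (Ordinal (xs x)) = t x + a :> nat.
  rewrite (H2 _ (Ordinal (xc x))) //; congr (_ + a).
  by rewrite (H1 (Ordinal (xc x)) (ltn_ord x)); congr (t _ : nat); apply: val_inj.
exists (fun x => Ordinal (xs x)); split=> [x y xy|x y] /=; first by rewrite ltn_add2l.
by rewrite !E ltn_add2r.
Qed.

Lemma summand_proper m n (t : 'S_m) (s : 'S_n) : decomposable s ->
  indecomposable_summand t s -> m < n.
Proof.
move=> [a' [b' [al' [be' [a0' b0' ds']]]]].
case=> _ nt [a [b [c [al [be [ga [ds1 ds2]]]]]]].
have [nac _ _] := direct_sumP ds2; have [cmb _ _] := direct_sumP ds1.
rewrite ltnNge; apply/negP => nm; apply: nt.
have [a0 b0] : a = 0 /\ b = 0 by lia.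
exists a', b', al', be'; split=> //; rewrite /is_direct_sum -ds' ds2 ds1.
have -> : one_line al = [::] by apply/nilP; rewrite /nilp size_one_line a0.
have -> : one_line be = [::] by apply/nilP; rewrite /nilp size_one_line b0.
rewrite cats0 /= a0; elim: (one_line t) => //= v l <-.
by rewrite addn0.
Qed.

Lemma cut_at_decomposable n (s : 'S_n) a : 0 < a < n ->
  (forall x y : 'I_n, x < a <= y -> s x < s y) -> decomposable s.
Proof.
move=> /andP[a0 an] H.
have lo (x : 'I_n) : x < a -> s x < a.
  move=> xa; have sxn : (s x).+1 <= n by apply: ltn_ord.
  rewrite -(@card_lt_ord n _ sxn) -[X in _ <= X](@card_lt_ord n a (ltnW an)).
  rewrite -(card_preimset _ (@perm_inj _ s)); apply/subset_leq_card/subsetP => y.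
  by rewrite !inE ltnS => yx; rewrite ltnNge; apply/negP => ay; have := H x y; rewrite xa ay => /(_ isT); rewrite ltnNge yx.
have hi (x : 'I_n) : a <= x -> a <= s x.
  move=> ax; rewrite leqNgt; apply/negP => sxa.
  have /subset_leq_card : x |: [set y : 'I_n | y < a] \subset s @^-1: [set z : 'I_n | z < a].
    by apply/subsetP => y; rewrite !inE => /orP[/eqP->|/lo].
  rewrite cardsU1 inE ltnNge ax card_preimset; last exact: perm_inj.
  by rewrite card_lt_ord ?ltnn // ltnW.
have wa (x : 'I_a) : x < n by apply: ltn_trans (ltn_ord x) an.
have sa (x : 'I_a) : s (Ordinal (wa x)) < a by apply: lo => /=.
have inja : injective (fun x => Ordinal (sa x)).
  move=> x y /(congr1 val) /= /val_inj/perm_inj/(congr1 val) /= e; exact: val_inj.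
have wb (y : 'I_(n - a)) : a + y < n by have := ltn_ord y; lia.
have sb (y : 'I_(n - a)) : s (Ordinal (wb y)) - a < n - a.
  by have := ltn_ord (s (Ordinal (wb y))); lia.
have injb : injective (fun y => Ordinal (sb y)).
  move=> x y /(congr1 val) /= e.
  have := hi (Ordinal (wb x)) (leq_addr _ _); have := hi (Ordinal (wb y)) (leq_addr _ _) => h1 h2.
  have : s (Ordinal (wb x)) = s (Ordinal (wb y)) :> nat by lia.
  by move=> /val_inj/perm_inj/(congr1 val) /= /addnI e'; apply: val_inj.
exists a, (n - a), (perm inja), (perm injb); split; [by []|by rewrite subn_gt0|].
apply: (@eq_from_nth _ 0); first by rewrite size_cat size_map !size_one_line subnKC // ltnW.
move=> x; rewrite size_one_line => xn; rewrite -[x]/(val (Ordinal xn)) nth_one_line.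
rewrite nth_cat size_one_line; case: (ltnP x a) => xa.
  rewrite -[nth _ _ _]/(nth 0 (one_line (perm inja)) (val (Ordinal xa))).
  by rewrite nth_one_line permE /=; congr (nat_of_ord (s _)).+1; apply: val_inj.
have xb : x - a < n - a by lia.
rewrite (nth_map 0) ?size_one_line //.
rewrite -[x - a]/(val (Ordinal xb)) nth_one_line permE /= addSn subnK.
  by congr (nat_of_ord (s _)).+1; apply: val_inj; rewrite /= subnKC.
by apply: hi; rewrite /= leq_addr.
Qed.

End Standardize.

(** * Critical permutations as point sets *)

(** Good corners for sizes that are not syntactically successors, such as the
    cardinal of a subset. *)
Definition good_corner_at m (t : 'S_m) (d : 'I_m) : bool :=
     ((d == 0 :> nat) || (t d == m.-1 :> nat)) && decreasing_on t (window_WN t d)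
  || ((t d == 0 :> nat) || (d == m.-1 :> nat)) && decreasing_on t (window_SE t d).

Lemma pseudosmooth_inv m (t : 'S_m) : pseudosmooth t ->
  [\/ m <= 1, decomposable t, tower t | exists d, good_corner_at t d].
Proof.
case=> {m t}; try by move=> *; constructor 1.
- by move=> m t _ _ tt; constructor 3.
- by move=> m s c t _ _ gc _ _; constructor 4; exists c.
- by move=> m s ds _; constructor 2.
Qed.

(** The summands would be proper patterns, hence pseudosmooth, and so would be
    [s]. *)
Lemma critical_not_decomposable n (s : 'S_n) : critical s -> ~ decomposable s.
Proof.
move=> [ns ps] ds; apply: ns; apply: Pseudosmooth_sum => // m t st.
by apply: ps; [apply: summand_proper st|apply: summand_pattern st].
Qed.

Lemma critical_bad_corner n (s : 'S_n) d : 1 < n -> critical s -> ~ good_corner_at s d.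
Proof.
case: n s d => [|n] s d n1 // s_crit gd.
have [t tP] := @standardize n _ s (lift d) (@lift_inj _ d).
have lift_lt (x y : 'I_n) : x < y -> lift d x < lift d y.
  by rewrite /= /bump; case: (leqP d x) => ?; case: (leqP d y) => ?; lia.
apply: s_crit.1; apply: (@Pseudosmooth_corner n s d t) => //.
- exact: critical_not_decomposable.
- by apply: s_crit.2 => //; exists (lift d).
Qed.

Section Bridge.
Variables (n : nat) (s : 'S_n).
Let p (i : 'I_n) : nat := i.
Let v (i : 'I_n) : nat := s i.

Lemma position_inj : injective p. Proof. exact: val_inj. Qed.
Lemma value_inj : injective v. Proof. by move=> i j /val_inj/perm_inj. Qed.

Lemma not_decreasing_ascent (A : {set 'I_n}) : ~~ decreasing_on s A ->
  ascent p v setT (mem A).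
Proof.
rewrite negb_forall => /existsP[x]; rewrite negb_imply => /andP[xA].
rewrite negb_forall => /existsP[y]; rewrite !negb_imply => /and3P[yA xy].
rewrite -leqNgt leq_eqVlt => /orP[/eqP/value_inj e|vxy]; first by rewrite e ltnn in xy.
by exists x, y; rewrite xy vxy.
Qed.

Section Sub.
Variables (m : nat) (t : 'S_m) (f : 'I_m -> 'I_n) (A : {set 'I_n}).
Hypothesis f_lt : forall x y : 'I_m, (x < y) = (f x < f y).
Hypothesis f_ord : forall x y : 'I_m, (t x < t y) = (s (f x) < s (f y)).
Hypothesis fA : forall x, f x \in A.
Hypothesis Af : forall i, i \in A -> exists x, i = f x.

(** Here [t] is the pattern of [s] on [A], through the increasing enumeration [f] of
    [A]. *)
Lemma decomposable_cut : decomposable t -> exists D, cut p v A D.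
Proof.
move=> [a [b [al [be [a0 b0 ds]]]]]; have [mab H1 H2] := direct_sumP ds.
have lt0 : 0 < m by rewrite mab; lia.
have lta : a < m by rewrite mab; lia.
exists [set f x | x : 'I_m & x < a]; split.
- by exists (f (Ordinal lt0)) => //; apply: imset_f; rewrite inE.
- exists (f (Ordinal lta)) => //; apply/imsetP => -[x]; rewrite inE => xa.
  by move=> e; have := f_lt x (Ordinal lta); rewrite -e /= ltnn xa.
move=> i j /Af[x ->] /Af[y ->] /imsetP[z]; rewrite inE => za e ynD.
have xa : x < a.
  by apply: leq_ltn_trans za; rewrite leqNgt f_lt e ltnn.
have ya : a <= y by rewrite leqNgt; apply: contra ynD => ya; apply: imset_f; rewrite inE.
rewrite /p /v -f_lt -f_ord (leq_trans xa ya) /= (H1 x xa).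
have yb : y - a < b by have := ltn_ord y; lia.
rewrite (H2 y (Ordinal yb)); last by rewrite /= subnKC.
by apply: leq_trans (leq_addl _ _).
Qed.

Lemma tower_sub : tower t -> tower_on p v A.
Proof.
move=> /tower_tower_on[q qb [b [bs sur mon]]]; exists q => //.
have [g gP] : exists g : 'I_n -> nat, forall x, g (f x) = b x.
  have fi : injective f.
    move=> x y e; apply/val_inj/eqP => /=.
    by have := f_lt x y; have := f_lt y x; rewrite e ltnn; case: ltngtP.
  exists (fun i => if [pick x | f x == i] is Some x then b x else 0) => x.
  by case: pickP => [y /eqP/fi -> //|/(_ x)]; rewrite eqxx.
exists g; split.
- by move=> i /Af[x ->]; rewrite gP bs ?inE.
- by move=> j /sur[x _ bx]; exists (f x); rewrite ?gP.
move=> i j /Af[x ->] /Af[y ->]; rewrite /p /v -f_lt -f_ord !gP.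
exact: mon (in_setT x) (in_setT y).
Qed.

Variables W N S E : 'I_n.
Hypotheses (Wmin : forall x, p W <= p x) (Emax : forall x, p x <= p E).
Hypotheses (Smin : forall x, v S <= v x) (Nmax : forall x, v x <= v N).

Lemma good_corner_not_bad : corners_in W N S E A ->
  (exists d, good_corner_at t d) -> ~ bad_corners p v W N S E A.
Proof.
move=> /and4P[/Af[w Dw] /Af[no Dn] /Af[so Ds] /Af[e De]] [d gd] [bW bN bS bE].
have dt x : (t x <= m.-1) * (x <= m.-1).
  have m0 : 0 < m by apply: leq_ltn_trans (ltn_ord x).
  by split; rewrite -[X in _ <= X]/(m.-1) -ltnS prednK.
have low c : bad_low p v A (f c) -> ~~ decreasing_on t (window_WN t c).
  move=> [i [j [/Af[x ->] /Af[y ->] /andP[cx tx] /andP[cy ty] /andP[xy txy]]]].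
  apply/negP => /forall_inP/(_ x); rewrite inE f_lt f_ord cx tx => /(_ isT).
  move=> /forall_inP/(_ y); rewrite inE f_lt f_ord cy ty => /(_ isT).
  by rewrite f_lt xy f_ord ltnNge (ltnW txy).
have high c : bad_high p v A (f c) -> ~~ decreasing_on t (window_SE t c).
  move=> [i [j [/Af[x ->] /Af[y ->] /andP[cx tx] /andP[cy ty] /andP[xy txy]]]].
  apply/negP => /forall_inP/(_ x); rewrite inE f_lt f_ord cx tx => /(_ isT).
  move=> /forall_inP/(_ y); rewrite inE f_lt f_ord cy ty => /(_ isT).
  by rewrite f_lt xy f_ord ltnNge (ltnW txy).
case/orP: gd => /andP[/orP[/eqP Dd|/eqP Dd]]; apply/negP.
- apply: low; suff -> : f d = W by [].
  apply/val_inj/eqP; rewrite eqn_leq Wmin andbT leqNgt Dw -f_lt Dd.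
  by [].
- apply: low; suff -> : f d = N by [].
  apply/value_inj/eqP; rewrite eqn_leq Nmax /= leqNgt Dn -f_ord Dd -leqNgt.
  by rewrite dt.
- apply: high; suff -> : f d = S by [].
  apply/value_inj/eqP; rewrite eqn_leq Smin andbT leqNgt Ds -f_ord Dd.
  by [].
- apply: high; suff -> : f d = E by [].
  apply/val_inj/eqP; rewrite eqn_leq Emax /= leqNgt De -f_lt Dd -leqNgt.
  by rewrite dt.
Qed.

End Sub.

Lemma enum_val_lt (A : {set 'I_n}) (x y : 'I_#|A|) : (x < y) = (enum_val x < enum_val y).
Proof.
have srt : sorted (relpre val ltn) (enum A).
  rewrite {1}/enum_mem; apply: sorted_filter; first by move=> ? ? ?; apply: ltn_trans.
  by rewrite -enumT -sorted_map val_enum_ord iota_ltn_sorted.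
have mono (i j : 'I_#|A|) : i < j -> enum_val i < enum_val j.
  move=> ij; rewrite /enum_val (set_nth_default (enum_default j)) -?cardE //.
  by apply: (sorted_ltn_nth _ _ srt); rewrite ?inE -?cardE //; move=> ? ? ?; apply: ltn_trans.
have [xy|yx] := ltnP x y; first by rewrite mono.
apply/esym/negbTE; rewrite -leqNgt; move: yx; rewrite leq_eqVlt => /orP[/eqP/val_inj-> //|yx].
exact/ltnW/mono.
Qed.

Section Critical.
Variables W N S E : 'I_n.
Hypotheses (Wmin : forall x, p W <= p x) (Emax : forall x, p x <= p E).
Hypotheses (Smin : forall x, v S <= v x) (Nmax : forall x, v x <= v N).
Hypotheses (WE : W <> E) (s_crit : critical s).

Lemma critical_pattern m (t : 'S_m) (f : 'I_m -> 'I_n) : m < n ->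
  (forall x y : 'I_m, (x < y) = (f x < f y)) ->
  (forall x y : 'I_m, (t x < t y) = (s (f x) < s (f y))) -> pseudosmooth t.
Proof.
move=> mn f_lt f_ord; apply: (s_crit.2 _ t mn); exists f; split=> // x y.
by rewrite f_lt.
Qed.

(** The pattern on [A] is proper, hence pseudosmooth, and all reasons for
    pseudosmoothness but being a tower contradict that [A] is a core. *)
Lemma critical_sub (A : {set 'I_n}) : A != setT -> core p v W N S E A -> tower_on p v A.
Proof.
move=> AT [cA bA ncA].
have An : #|A| < n.
  by rewrite -[X in _ < X]card_ord -cardsT; apply: proper_card; rewrite properT.
pose f : 'I_#|A| -> 'I_n := enum_val.
have [t tP] := standardize s (f := f) enum_val_inj.
have f_lt : forall x y : 'I_#|A|, (x < y) = (f x < f y) by apply: enum_val_lt.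
have fA x : f x \in A by apply: enum_valP.
have Af i : i \in A -> exists x, i = f x.
  by move=> iA; exists (enum_rank_in iA i); rewrite /f enum_rankK_in.
case: (pseudosmooth_inv (critical_pattern An f_lt tP)).
- move=> A1; case: WE; case/and4P: cA => WA _ _ EA.
  by move/card_le1P: A1 => /(_ W WA E); rewrite EA inE => /esym/eqP.
- by move/(decomposable_cut f_lt tP fA Af) => [D /ncA].
- exact: tower_sub f_lt tP fA Af.
- by move/(good_corner_not_bad f_lt tP Af Wmin Emax Smin Nmax cA) => /(_ bA).
Qed.

Lemma critical_no_cut D : ~ cut p v setT D.
Proof.
move=> cD; apply: (critical_not_decomposable s_crit).
have [[x _ xD] [y _ yD] H] := cD.
have ex : exists m, [exists k : 'I_n, (k \notin D) && (p k == m)].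
  by exists (p y); apply/existsP; exists y; rewrite yD /=.
case: (ex_minnP ex) => a /existsP[k /andP[kD /eqP Dk]] kmin; subst a.
have lo (z : 'I_n) : z < k -> z \in D.
  move=> zk; apply/idPn => zD; have := kmin (p z); rewrite leqNgt zk => /(_ _)/negP[] //.
  by apply/existsP; exists z; rewrite zD /=.
have hi (z : 'I_n) : k <= z -> z \notin D.
  move=> kz; apply/negP => zD.
  by have := H z k (in_setT _) (in_setT _) zD kD; rewrite /p ltnNge kz.
apply: (@cut_at_decomposable n s k) => [|z w /andP[zk kw]].
  rewrite ltn_ord andbT lt0n; apply: contraTneq xD => k0; apply: hi.
  by rewrite k0.
by have /andP[] := H z w (in_setT _) (in_setT _) (lo z zk) (hi w kw).
Qed.

Lemma critical_core : core p v W N S E setT /\ ~ tower_on p v setT.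
Proof.
have n1 : 1 < n.
  rewrite ltnNge; apply/negP => n1; apply: WE; apply: val_inj => /=.
  by have := ltn_ord W; have := ltn_ord E; lia.
split; last first.
  move=> /tower_on_tower ts; apply: s_crit.1; apply: Pseudosmooth_tower => //.
  exact: critical_not_decomposable.
split; [by rewrite /corners_in !inE| |exact: critical_no_cut].
have n0 : 0 < n by lia.
have nP : n.-1 < n by rewrite prednK.
have pW : p W = 0 by apply/eqP; rewrite -leqn0; apply: (Wmin (Ordinal n0)).
have pE : p E = n.-1.
  by apply/eqP; rewrite eqn_leq (Emax (Ordinal nP)) andbT -ltnS prednK //; apply: ltn_ord.
have vS : v S = 0.
  by apply/eqP; rewrite -leqn0; have := Smin (s^-1%g (Ordinal n0)); rewrite /v permKV.
have vN : v N = n.-1.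
  apply/eqP; rewrite eqn_leq -{1}ltnS prednK // ltn_ord /=.
  by have := Nmax (s^-1%g (Ordinal nP)); rewrite /v permKV.
have asc (P : pred 'I_n) (A : {set 'I_n}) : (forall x, (x \in A) = P x) ->
    ~~ decreasing_on s A -> ascent p v setT P.
  by move=> AP /not_decreasing_ascent[x [y [? ? xA yA xy]]]; exists x, y; split; rewrite -?AP.
have good d := @critical_bad_corner _ s d n1 s_crit.
split.
- apply: (asc _ (window_WN s W)) => [x|]; first by rewrite inE.
  by apply/negP => dW; apply: (good W); rewrite /good_corner_at -[nat_of_ord W]/(p W) pW eqxx dW.
- apply: (asc _ (window_WN s N)) => [x|]; first by rewrite inE.
  by apply/negP => dW; apply: (good N); rewrite /good_corner_at -[nat_of_ord (s N)]/(v N) vN eqxx dW orbT.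
- apply: (asc _ (window_SE s S)) => [x|]; first by rewrite inE.
  by apply/negP => dW; apply: (good S); rewrite /good_corner_at -[nat_of_ord (s S)]/(v S) vS eqxx dW !orbT.
- apply: (asc _ (window_SE s E)) => [x|]; first by rewrite inE.
  by apply/negP => dW; apply: (good E); rewrite /good_corner_at -[nat_of_ord E]/(p E) pE eqxx dW !orbT.
Qed.

End Critical.
End Bridge.

(** * The number of minimal inversions *)

Lemma Cov_covers n (s : 'S_n) :
  Cov s = covers (fun i : 'I_n => i : nat) (fun i => s i : nat).
Proof.
apply/setP => -[i k]; rewrite !inE /minimal_inversion /inversion /dominates /=.
congr (_ && ~~ _); apply: eq_existsb => j.
by rewrite [s k < s j < s i]andbC andbACA.
Qed.

Lemma critical_gt1 n (s : 'S_n) : critical s -> 1 < n.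
Proof.
case: n s => [|[|n]] s // [ns _]; case: ns; constructor.
Qed.

Theorem critical_covers n (s : 'S_n) : critical s ->
  [/\ 1 < n, oriented (Cov s), connected_graph (edge_rel (Cov s)) & n < #|Cov s|].
Proof.
move=> s_crit; have n1 := critical_gt1 s_crit.
pose p (i : 'I_n) : nat := i; pose v (i : 'I_n) : nat := s i.
have n0 : 0 < n := ltnW n1.
have nP : n.-1 < n by rewrite prednK.
pose W := Ordinal n0; pose E := Ordinal nP.
pose S := (s^-1)%g W; pose N := (s^-1)%g E.
have Wmin x : p W <= p x by [].
have Emax x : p x <= p E by rewrite -ltnS /= prednK //; apply: ltn_ord.
have Smin x : v S <= v x by rewrite {1}/v permKV.
have Nmax x : v x <= v N by rewrite {2}/v permKV -ltnS /= prednK //; apply: ltn_ord.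
have WE : W <> E by move/(congr1 val) => /=; lia.
have [coreT ntower] := critical_core Wmin Emax Smin Nmax WE s_crit.
have crit A := @critical_sub _ s W N S E Wmin Emax Smin Nmax WE s_crit A.
rewrite Cov_covers -/p -/v; split=> //.
- exact: covers_oriented.
- by have [_ _ nocut] := coreT; apply: connected_covers Wmin (@position_inj n) (@value_inj n s) nocut.
have [n8|n9] := leqP n 8; first exact: small_covers coreT ntower crit.
have n9' : 9 <= #|'I_n| by rewrite card_ord.
have [sep|nsep] := boolP (separated p v W N S E).
  rewrite -[X in X < _]card_ord.
  exact: (separated_covers (@position_inj n) (@value_inj n s) Wmin Emax Smin Nmax).
by case: (@not_separated _ p v (@position_inj n) (@value_inj n s) W N S E).
Qed.

(** * Families of matrices as row vectors *)

Import GRing.Theory.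

Section NotPseudorigidOfCovers.
Import mpoly.
Local Open Scope ring_scope.

Section Flatten.
Variables (K : fieldType) (m : nat) (a b : nat -> nat).

Definition mx_family := forall v, 'M[K]_(a v, b v).
Definition entry : finType := {v : 'I_m & 'I_(a v) * 'I_(b v)}%type.

(** Rank arguments for linear maps between families of matrices need one vector
    space: families indexed by [v < m] are listed in a row vector. *)
Definition flat (h : mx_family) : 'rV[K]_#|entry| :=
  \row_k let e : entry := enum_val k in h (tag e) (tagged e).1 (tagged e).2.

Definition unflat (u : 'rV[K]_#|entry|) : mx_family := fun v =>
  match @idP (v < m)%N with
  | ReflectT vm => \matrix_(i, j)
      u 0 (enum_rank (Tagged (fun w : 'I_m => 'I_(a w) * 'I_(b w))%type
                             (i : 'I_(a (Ordinal vm)), j : 'I_(b (Ordinal vm)))))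
  | ReflectF _ => 0
  end.

Lemma flatK (h : mx_family) v : (v < m)%N \/ a v = 0%N \/ b v = 0%N -> unflat (flat h) v = h v.
Proof.
move=> hv; apply/matrixP => i j; rewrite /unflat; case: {-}_ / idP => [vm|nvm].
  by rewrite !mxE enum_rankK.
case: hv => [//|[a0|b0]].
  by have := ltn_ord i; rewrite [X in (_ < X)%N]a0.
by have := ltn_ord j; rewrite [X in (_ < X)%N]b0.
Qed.

Lemma unflatK u : flat (unflat u) = u.
Proof.
apply/rowP => k; rewrite mxE /unflat; case De: (enum_val k) => [[v vm] [i j]] /=.
case: {-}_ / idP => [vm'|//]; rewrite mxE (bool_irrelevance vm' vm).
by congr (u 0 _); apply: enum_val_inj; rewrite enum_rankK De.
Qed.

Lemma flat_eq (h1 h2 : mx_family) : (forall v, (v < m)%N -> h1 v = h2 v) -> flat h1 = flat h2.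
Proof. by move=> e; apply/rowP => k; rewrite !mxE /= e. Qed.

Lemma flat_linear c (h1 h2 h3 : mx_family) : (forall v, h3 v = c *: h1 v + h2 v) ->
  flat h3 = c *: flat h1 + flat h2.
Proof. by move=> e; apply/rowP => k; rewrite !mxE /= e !mxE. Qed.

Lemma unflat_linear c u1 u2 v : unflat (c *: u1 + u2) v = c *: unflat u1 v + unflat u2 v.
Proof.
by rewrite /unflat; case: {-}_ / idP => [vm|_]; apply/matrixP => i j; rewrite !mxE ?mulr0 ?addr0.
Qed.

Lemma unflat0 v : unflat 0 v = 0.
Proof.
by rewrite /unflat; case: {-}_ / idP => [vm|_] //; apply/matrixP => i j; rewrite !mxE.
Qed.

Lemma card_entry : #|entry| = (\sum_(v < m) a v * b v)%N.
Proof.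
rewrite card_tagged sumnE big_map big_enum /=.
by apply: eq_bigr => v _; rewrite card_prod !card_ord.
Qed.

End Flatten.

(** The trace form is the scalar product of the row vectors. *)
Lemma flat_trace (K : fieldType) m (a b : nat -> nat) (e : mx_family K a b) (f : mx_family K b a) :
  flat m e *m (flat m (fun v => (f v)^T))^T = (\sum_(v < m) \tr (f v *m e v))%:M.
Proof.
apply/matrixP => i j; rewrite !ord1 !mxE eqxx mulr1n.
transitivity (\sum_(x : entry m a b) e (tag x) (tagged x).1 (tagged x).2 *
    f (tag x) (tagged x).2 (tagged x).1).
  rewrite [RHS](reindex (fun k : 'I_#|entry m a b| => enum_val k)) /=; last first.
    by apply: onW_bij; apply: enum_val_bij.
  by apply: eq_bigr => k _; rewrite !mxE /= !mxE.
transitivity (\sum_(v < m) \sum_(ij : 'I_(a v) * 'I_(b v)) e v ij.1 ij.2 * f v ij.2 ij.1).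
  by rewrite sig_big_dep; apply: eq_big.
apply: eq_bigr => v _; rewrite -(pair_bigA _ (fun i j => e v i j * f v j i)) /=.
rewrite exchange_big; apply: eq_bigr => k _; rewrite mxE; apply: eq_bigr => l _.
by rewrite mulrC.
Qed.

(** * Regular functions and ranks on a Zariski closure *)

Section Regular.
Variables (K : fieldType) (d : nat -> nat).
Implicit Types (g : dblrep K d -> K) (S : dblrep K d -> Prop).

Definition regular g := exists m (p : {mpoly K[m]}) c, forall x, g x = polyfun p c x.

Lemma regular_ext g1 g2 : g1 =1 g2 -> regular g1 -> regular g2.
Proof. by move=> e [m [p [c H]]]; exists m, p, c => x; rewrite -e. Qed.

Lemma regular_coord c : regular (fun x => coord_val x c).
Proof.
by exists 1%N, 'X_ord0, (fun=> c) => x; rewrite /polyfun mevalXU.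
Qed.

Lemma regular_cst a : regular (fun=> a).
Proof.
have c : 'I_0 -> coordinate d by case.
by exists 0%N, (a%:MP_[0]), c => x; rewrite /polyfun mevalC.
Qed.

(** Polynomials in different coordinates are brought to a common list of
    variables. *)
Lemma regular_pair g1 g2 : regular g1 -> regular g2 ->
  exists m (p1 p2 : {mpoly K[m]}) c, (forall x, g1 x = polyfun p1 c x) /\
    (forall x, g2 x = polyfun p2 c x).
Proof.
move=> [m1 [p1 [c1 H1]]] [m2 [p2 [c2 H2]]].
exists (m1 + m2)%N, (p1 \mPo [tuple 'X_(lshift m2 i) | i < m1]),
  (p2 \mPo [tuple 'X_(rshift m1 i) | i < m2]),
  (fun i => match split i with inl j => c1 j | inr j => c2 j end).
split=> x; rewrite ?H1 ?H2 /polyfun comp_mpoly_meval; apply: meval_eq => i;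
  rewrite tnth_mktuple mevalXU.
  by rewrite (unsplitK (inl i)).
by rewrite (unsplitK (inr i)).
Qed.

Lemma regularD g1 g2 : regular g1 -> regular g2 -> regular (fun x => g1 x + g2 x).
Proof.
move=> h1 h2; have [m [p1 [p2 [c [H1 H2]]]]] := regular_pair h1 h2.
by exists m, (p1 + p2), c => x; rewrite H1 H2 /polyfun mevalD.
Qed.

Lemma regularM g1 g2 : regular g1 -> regular g2 -> regular (fun x => g1 x * g2 x).
Proof.
move=> h1 h2; have [m [p1 [p2 [c [H1 H2]]]]] := regular_pair h1 h2.
by exists m, (p1 * p2), c => x; rewrite H1 H2 /polyfun mevalM.
Qed.

Lemma regularN g : regular g -> regular (fun x => - g x).
Proof.
move=> /(regularM (regular_cst (-1))); apply: regular_ext => x.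
by rewrite mulN1r.
Qed.

Lemma regular_sum (I : Type) (r : seq I) (P : pred I) (g : I -> dblrep K d -> K) :
  (forall i, P i -> regular (g i)) -> regular (fun x => \sum_(i <- r | P i) g i x).
Proof.
move=> H; elim: r => [|i r IHr].
  by apply: regular_ext (regular_cst 0) => x; rewrite big_nil.
apply: (@regular_ext (fun x => (if P i then g i x else 0) + \sum_(j <- r | P j) g j x)).
  by move=> x; rewrite big_cons; case: (P i); rewrite ?add0r.
apply: regularD => //; case Pi: (P i); [exact: H | exact: regular_cst].
Qed.

Lemma regular_prod (I : Type) (r : seq I) (P : pred I) (g : I -> dblrep K d -> K) :
  (forall i, P i -> regular (g i)) -> regular (fun x => \prod_(i <- r | P i) g i x).
Proof.
move=> H; elim: r => [|i r IHr].
  by apply: regular_ext (regular_cst 1) => x; rewrite big_nil.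
apply: (@regular_ext (fun x => (if P i then g i x else 1) * \prod_(j <- r | P j) g j x)).
  by move=> x; rewrite big_cons; case: (P i); rewrite ?mul1r.
apply: regularM => //; case Pi: (P i); [exact: H | exact: regular_cst].
Qed.

Definition regular_mx m n (F : dblrep K d -> 'M[K]_(m, n)) :=
  forall i j, regular (fun x => F x i j).

Lemma regular_mx_cst m n (A : 'M[K]_(m, n)) : regular_mx (fun=> A).
Proof. by move=> i j; apply: regular_cst. Qed.

Lemma regular_mapT v : regular_mx (fun x => mapT x v).
Proof. by move=> i j; apply: (regular_coord (CoordT i j)). Qed.

Lemma regular_mapB v : regular_mx (fun x => mapB x v).
Proof. by move=> i j; apply: (regular_coord (CoordB i j)). Qed.

Lemma regular_mxM m n r (F : dblrep K d -> 'M[K]_(m, n)) (G : dblrep K d -> 'M[K]_(n, r)) :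
  regular_mx F -> regular_mx G -> regular_mx (fun x => F x *m G x).
Proof.
move=> hF hG i j; apply: (@regular_ext (fun x => \sum_k F x i k * G x k j)).
  by move=> x; rewrite mxE.
by apply: regular_sum => k _; apply: regularM.
Qed.

Lemma regular_mxD m n (F G : dblrep K d -> 'M[K]_(m, n)) :
  regular_mx F -> regular_mx G -> regular_mx (fun x => F x + G x).
Proof.
move=> hF hG i j; apply: (@regular_ext (fun x => F x i j + G x i j)).
  by move=> x; rewrite mxE.
exact: regularD.
Qed.

Lemma regular_mxB m n (F G : dblrep K d -> 'M[K]_(m, n)) :
  regular_mx F -> regular_mx G -> regular_mx (fun x => F x - G x).
Proof.
move=> hF hG i j; apply: (@regular_ext (fun x => F x i j + - G x i j)).
  by move=> x; rewrite !mxE.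
by apply: regularD => //; apply: regularN.
Qed.

Lemma regular_det n (F : dblrep K d -> 'M[K]_n) :
  regular_mx F -> regular (fun x => \det (F x)).
Proof.
move=> hF; rewrite /determinant; apply: regular_sum => s _; apply: regularM.
  exact: regular_cst.
exact: regular_prod.
Qed.

Lemma mxrank_minor m n (A : 'M[K]_(m, n)) r : (r <= \rank A)%N ->
  exists (P : 'M_(r, m)) (Q : 'M_(n, r)), P *m A *m Q = 1%:M.
Proof.
move=> rA; exists (pid_mx r *m invmx (col_ebase A)), (invmx (row_ebase A) *m pid_mx r).
rewrite -{2}(mulmx_ebase A) !mulmxA mulmxKV ?col_ebase_unit //.
rewrite -!mulmxA mulKVmx ?row_ebase_unit // mulmxA !mul_pid_mx.
rewrite -pid_mx_1; congr pid_mx.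
by have := rank_leq_row A; have := rank_leq_col A; lia.
Qed.

(** If the rank at [x] exceeded [r], some minor of size [r.+1], taken after a change
    of bases adapted to [F x], would not vanish at [x], but it vanishes on [S]. *)
Lemma closure_rank m n (F : dblrep K d -> 'M[K]_(m, n)) S r x : regular_mx F ->
  (forall y, S y -> \rank (F y) <= r)%N -> zariski_closure S x -> (\rank (F x) <= r)%N.
Proof.
move=> rF FS clx; rewrite leqNgt; apply/negP => /mxrank_minor[P [Q PQ]].
have rdet : regular (fun y => \det (P *m F y *m Q)).
  apply: regular_det; apply: regular_mxM; last exact: regular_mx_cst.
  by apply: regular_mxM => //; apply: regular_mx_cst.
have [k [p [c H]]] := rdet.
have /eqP : \det (P *m F x *m Q) = 0.
  rewrite H; apply: clx => y Sy; rewrite -H; apply/eqP; rewrite -[_ == 0]negbK.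
  apply/negP => detn0; have := FS y Sy; rewrite leqNgt => /negP; apply.
  have : (P *m F y *m Q) \in unitmx by rewrite unitmxE unitfE.
  rewrite -row_full_unit => /eqP <-.
  by apply: leq_trans (mxrankM_maxl _ _) _; apply: mxrankM_maxr.
by rewrite PQ det1 oner_eq0.
Qed.

End Regular.

(** * The complex computing extensions *)

Section Complex.
Variables (K : fieldType) (d : nat -> nat) (m : nat).
Hypotheses (d0 : d 0%N = 0%N) (dm : forall v, (m <= v)%N -> d v = 0%N).

Local Notation d' := (fun v => d v.+1).
Local Notation N0 := #|entry m d d|.
Local Notation NA := #|entry m d' d|.
Local Notation NC := #|entry m d d'|.
Local Notation N2 := #|entry m d' d'|.

Section Maps.
Variables x y : dblrep K d.

(** The two maps of the complex: [coboundary] measures how far a family of maps is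
    from a homomorphism from [x] to [y], and [relation_defect] how far the pair
    of the off-diagonal blocks [A], [C] is from defining a module extending [x]
    by [y]. *)
Definition coboundary (u : 'rV[K]_N0) : 'rV[K]_(NA + NC) :=
  let H := unflat u in
  row_mx (flat m (fun v => mapT y v *m H v - H v.+1 *m mapT x v))
         (flat m (fun v => mapB y v *m H v.+1 - H v *m mapB x v)).

Definition relation_defect (w : 'rV[K]_(NA + NC)) : 'rV[K]_N2 :=
  let A := unflat (lsubmx w) in let C := unflat (rsubmx w) in
  flat m (fun v => mapT y v *m C v + A v *m mapB x v
                   - (C v.+1 *m mapT x v.+1 + mapB y v.+1 *m A v.+1)).

Lemma coboundary_linear : linear coboundary.
Proof.
move=> c u1 u2; rewrite /coboundary scale_row_mx add_row_mx; congr row_mx;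
  apply: flat_linear => v; by rewrite !unflat_linear mulmxDl mulmxDr -scalemxAl -scalemxAr
    scalerBr opprD addrACA.
Qed.

Lemma relation_defect_linear : linear relation_defect.
Proof.
move=> c w1 w2; apply: flat_linear => v; rewrite !linearP /= !unflat_linear.
rewrite !mulmxDl !mulmxDr -!scalemxAl -!scalemxAr.
by rewrite scalerBr !scalerDr addrACA [X in _ - X = _]addrACA [X in _ + X = _]opprD [LHS]addrACA.
Qed.

HB.instance Definition _ :=
  GRing.isLinear.Build K _ _ *:%R coboundary coboundary_linear.
HB.instance Definition _ :=
  GRing.isLinear.Build K _ _ *:%R relation_defect relation_defect_linear.

Definition coboundary_mx := lin1_mx coboundary.
Definition relation_mx := lin1_mx relation_defect.

Lemma mul_coboundary_mx u : u *m coboundary_mx = coboundary u.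
Proof. exact: mul_rV_lin1. Qed.

Lemma mul_relation_mx w : w *m relation_mx = relation_defect w.
Proof. exact: mul_rV_lin1. Qed.

(** The block triangular module with off-diagonal blocks [A] and [C] is an
    extension; the off-diagonal block of an isomorphism to the direct sum is [H]. *)
Lemma ext_cocycle (A : mx_family K d' d) (C : mx_family K d d') :
  Lambda x -> Lambda y -> Ext1_eq0 x y ->
  (forall v, mapT y v *m C v + A v *m mapB x v =
     C v.+1 *m mapT x v.+1 + mapB y v.+1 *m A v.+1) ->
  exists H : mx_family K d d, forall v,
    A v = mapT y v *m H v - H v.+1 *m mapT x v /\
    C v = mapB y v *m H v.+1 - H v *m mapB x v.
Proof.
move=> Lx Ly ext0 rel.
pose E := @DblRep K (fun v => (d v + d v)%N)
  (fun v => block_mx (mapT y v) (A v) 0 (mapT x v))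
  (fun v => block_mx (mapB y v) (C v) 0 (mapB x v)).
have LE : Lambda E.
  move=> v; rewrite /= !mulmx_block !mul0mx !mulmx0 !addr0 !add0r Lx Ly.
  by rewrite rel addrC.
pose f v : 'M[K]_(d v + d v, d v) := col_mx 1%:M 0.
pose g v : 'M[K]_(d v, d v + d v) := row_mx 0 1%:M.
have [|h [[hT hB] hf gh]] := ext0 _ E f g LE.
  split.
  - by split=> v; rewrite /= mul_block_col mul_col_mx !mulmx1 !mulmx0 !mul0mx !mul1mx !addr0.
  - by split=> v; rewrite /= mul_row_block mul_mx_row !mulmx1 !mulmx0 !mul0mx !mul1mx !add0r.
  - by move=> v u1 u2; rewrite !mul_col_mx !mul1mx => /eq_col_mx[].
  - by move=> v w; exists (col_mx 0 w); rewrite mul_row_col mulmx0 mul1mx add0r.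
  move=> v u; split=> [|[w ->]].
    rewrite -[u]vsubmxK mul_row_col mul0mx mul1mx add0r => ->.
    by exists (usubmx u); rewrite mul_col_mx mul1mx mul0mx.
  by rewrite mulmxA mul_row_col mulmx0 mul0mx addr0 mul0mx.
pose H v : 'M_(d v) := ursubmx (h v).
have hE v : h v = block_mx 1%:M (H v) 0 1%:M.
  rewrite -[h v]submxK; congr block_mx => //.
  - have := hf v; rewrite -{1}[h v]submxK mul_block_col !mulmx1 !mulmx0 !addr0.
    by move/eq_col_mx => [].
  - have := hf v; rewrite -{1}[h v]submxK mul_block_col !mulmx1 !mulmx0 !addr0.
    by move/eq_col_mx => [].
  - have := gh v; rewrite -{1}[h v]submxK mul_row_block !mul1mx !mul0mx !add0r.
    by move/eq_row_mx => [].
exists H => v; split.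
  have := hT v; rewrite !hE /= !mulmx_block !mulmx1 !mul1mx !mulmx0 !mul0mx.
  case/eq_block_mx => _ e _ _; move: e; rewrite !addr0 => <-; by rewrite addrK.
have := hB v; rewrite !hE /= !mulmx_block !mulmx1 !mul1mx !mulmx0 !mul0mx.
case/eq_block_mx => _ e _ _; move: e; rewrite !addr0 => <-; by rewrite addrK.
Qed.

(** The kernel of the second map is contained in the image of the first. *)
Lemma ext_rank : Lambda x -> Lambda y -> Ext1_eq0 x y ->
  (NA + NC <= \rank coboundary_mx + \rank relation_mx)%N.
Proof.
move=> Lx Ly ext0; rewrite [X in (_ <= X)%N]addnC -leq_subLR -mxrank_ker; apply: mxrankS.
apply/row_subP => i; set w := row i _.
have w0 : relation_defect w = 0.
  by rewrite -mul_relation_mx -row_mul mulmx_ker row0.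
pose A := unflat (lsubmx w); pose C := unflat (rsubmx w).
have rel v : mapT y v *m C v + A v *m mapB x v =
     C v.+1 *m mapT x v.+1 + mapB y v.+1 *m A v.+1.
  have [vm|mv] := ltnP v m; last first.
    apply/matrixP => k; have := ltn_ord k; by rewrite [X in (_ < X)%N]dm // ltnW.
  apply/eqP; rewrite -subr_eq0; apply/eqP.
  pose e : mx_family K d' d' := fun v => mapT y v *m C v + A v *m mapB x v
                   - (C v.+1 *m mapT x v.+1 + mapB y v.+1 *m A v.+1).
  have fe : flat m e = 0 by exact: w0.
  by rewrite -[LHS]/(e v) -(flatK e (or_introl vm)) fe unflat0.
have [H HP] := ext_cocycle Lx Ly ext0 rel.
apply/submxP; exists (flat m H); rewrite mul_coboundary_mx /coboundary.
have HK v : unflat (flat m H) v = H v.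
  by apply: flatK; have [|mv] := ltnP v m; [left|right; left; apply: dm].
rewrite -[LHS]hsubmxK -(unflatK (lsubmx w)) -(unflatK (rsubmx w)).
by congr row_mx; apply: flat_eq => v vm; rewrite !HK; have [] := HP v.
Qed.

End Maps.

Lemma dim0_mx a b (M : 'M[K]_(a, b)) : a = 0%N -> M = 0.
Proof. by move=> a0; apply/matrixP => i; have := ltn_ord i; rewrite [X in (_ < X)%N]a0. Qed.

Section HomRank.
Variables (x y : dblrep K d) (r p : nat) (h : 'rV[K]_r -> mx_family K d d).
Hypothesis h_linear : forall c u1 u2 v, h (c *: u1 + u2) v = c *: h u1 v + h u2 v.
Hypothesis h_inj : forall u, h u p = 0 -> u = 0.

Lemma flatK_dim (f : mx_family K d d) v : unflat (flat m f) v = f v.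
Proof. by apply: flatK; have [|mv] := ltnP v m; [left|right; left; apply: dm]. Qed.

(** The family [h] embeds a space of dimension [r] in the kernel. *)
Lemma coboundary_rank_le : (forall u, pihom x y (h u)) ->
  (\rank (coboundary_mx x y) + r <= N0)%N.
Proof.
move=> h_hom; pose Zf u : 'rV[K]_N0 := flat m (h u).
have Zlin : linear Zf by move=> c u1 u2; apply: flat_linear => v; apply: h_linear.
pose Zp := GRing.isLinear.Build K _ _ *:%R Zf Zlin.
pose Zl : {linear 'rV_r -> 'rV_N0} := HB.pack Zf Zp.
pose Z := lin1_mx Zl.
have ZE u : u *m Z = flat m (h u) by rewrite (mul_rV_lin1 Zl).
have rZ : \rank Z = r.
  apply/eqP; apply: inj_row_free => u; rewrite ZE => hu0.
  by apply: h_inj; rewrite -(flatK_dim (h u)) hu0 unflat0.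
suff ZL0 : Z *m coboundary_mx x y = 0.
  by rewrite addnC; have := mulmx0_rank_max ZL0; rewrite rZ.
apply/row_matrixP => i; rewrite row0 row_mul rowE ZE mul_coboundary_mx /coboundary; have [hT hB] := h_hom (delta_mx 0 i).
rewrite -[RHS](row_mx0 _ 1 NA NC); congr row_mx; apply/rowP => k;
  by rewrite !mxE /= !flatK_dim ?hT ?hB !subrr mxE.
Qed.

(** The image of the second map is orthogonal to Hom(y, x) under the trace form:
    pairing a homomorphism [f] with [relation_defect] gives a telescoping sum of
    traces whose end terms vanish.  The last term of the complex starts at the
    vertex 1, whence the assumption on [p]. *)
Lemma relation_rank_le : p.-1.+1 = p -> (forall u, pihom y x (h u)) ->
  (\rank (relation_mx x y) + r <= N2)%N.
Proof.
move=> p0 h_hom; pose Zf u : 'rV[K]_N2 := flat m (fun v => (h u v.+1)^T : 'M_(d v.+1, d v.+1)).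
have Zlin : linear Zf.
  by move=> c u1 u2; apply: flat_linear => v; rewrite h_linear linearP.
pose Zp := GRing.isLinear.Build K _ _ *:%R Zf Zlin.
pose Zl : {linear 'rV_r -> 'rV_N2} := HB.pack Zf Zp.
pose Z := lin1_mx Zl.
have ZE u : u *m Z = Zf u by rewrite (mul_rV_lin1 Zl).
have rZ : \rank Z = r.
  apply/eqP; apply: inj_row_free => u; rewrite ZE => hu0.
  apply: h_inj; rewrite -p0; apply: (@trmx_inj K).
  pose f : mx_family K d' d' := fun v => (h u v.+1)^T.
  rewrite trmx0 -[LHS]/(f p.-1) -(@flatK _ m _ _ f) ?[flat m f]hu0 ?unflat0 //.
  by have [|mv] := ltnP p.-1 m; [left|right; left; apply: dm; apply: ltnW].
suff ZL0 : relation_mx x y *m Z^T = 0.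
  by have := mulmx0_rank_max ZL0; rewrite mxrank_tr rZ.
apply/row_matrixP => i; rewrite row0 row_mul; apply: trmx_inj; rewrite trmx_mul trmxK trmx0.
apply/row_matrixP => j; rewrite row0 row_mul rowE ZE rowE mul_relation_mx.
apply: trmx_inj; rewrite trmx_mul trmxK trmx0; set w := delta_mx 0 i.
rewrite /relation_defect; set A := unflat (lsubmx w); set C := unflat (rsubmx w).
set f := h (delta_mx 0 j); have [hT hB] := h_hom (delta_mx 0 j).
rewrite (@flat_trace K m d' d' _ (fun v => f v.+1)).
pose S v := \tr (mapT x v *m f v *m C v) + \tr (mapB x v *m f v.+1 *m A v).
rewrite (eq_bigr (fun v : 'I_m => S v - S v.+1)) => [|v _]; last first.
  rewrite mulmxBr !mulmxDr linearB /= !linearD /= !mulmxA -/f hT hB.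
  by congr (_ + _ - (_ + _)); rewrite mxtrace_mulC mulmxA.
have S0 v : d v = 0%N -> S v = 0.
  move=> dv; rewrite /S (dim0_mx (f v) dv) (dim0_mx (mapB x v) dv).
  by rewrite mulmx0 !mul0mx !mxtrace0 addr0.
rewrite (eq_bigr (fun v : 'I_m => - (S v.+1 - S v))) => [|v _]; last by rewrite opprB.
rewrite sumrN -(big_mkord xpredT (fun v => S v.+1 - S v)) telescope_sumr //.
by rewrite (S0 _ (dm (leqnn m))) (S0 _ d0) subrr oppr0 raddf0.
Qed.

End HomRank.

Lemma regular_flat a b (F : dblrep K d -> mx_family K a b) :
  (forall v, regular_mx (fun x => F x v)) -> regular_mx (fun x => flat m (F x)).
Proof.
move=> rF i k; apply: regular_ext (rF _ (tagged (enum_val k : entry m a b)).1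
  (tagged (enum_val k : entry m a b)).2) => x.
by rewrite mxE.
Qed.

Lemma regular_row_mx a b (F : dblrep K d -> 'rV[K]_a) (G : dblrep K d -> 'rV[K]_b) :
  regular_mx F -> regular_mx G -> regular_mx (fun x => row_mx (F x) (G x)).
Proof.
move=> rF rG i k; case: (splitP k) => j Dk.
  apply: regular_ext (rF i j) => x.
  by rewrite (_ : k = lshift b j) ?row_mxEl //; apply: val_inj.
apply: regular_ext (rG i j) => x.
by rewrite (_ : k = rshift a j) ?row_mxEr //; apply: val_inj.
Qed.

Lemma regular_coboundary_src y : regular_mx (fun x => coboundary_mx x y).
Proof.
move=> i j; apply: (@regular_ext _ _ (fun x => coboundary x y (delta_mx 0 i) 0 j)).
  by move=> x; rewrite [RHS]mxE.
apply: regular_row_mx; apply: regular_flat => v; apply: regular_mxB;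
  by do ?[apply: regular_mxM|apply: regular_mx_cst|apply: regular_mapT|apply: regular_mapB].
Qed.

Lemma regular_coboundary_tgt x : regular_mx (fun y => coboundary_mx x y).
Proof.
move=> i j; apply: (@regular_ext _ _ (fun y => coboundary x y (delta_mx 0 i) 0 j)).
  by move=> y; rewrite [RHS]mxE.
apply: regular_row_mx; apply: regular_flat => v; apply: regular_mxB;
  by do ?[apply: regular_mxM|apply: regular_mx_cst|apply: regular_mapT|apply: regular_mapB].
Qed.

Lemma regular_relation_src y : regular_mx (fun x => relation_mx x y).
Proof.
move=> i j; apply: (@regular_ext _ _ (fun x => relation_defect x y (delta_mx 0 i) 0 j)).
  by move=> x; rewrite [RHS]mxE.
apply: regular_flat => v; apply: regular_mxB; apply: regular_mxD;
  by do ?[apply: regular_mxM|apply: regular_mx_cst|apply: regular_mapT|apply: regular_mapB].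
Qed.

Lemma regular_relation_tgt x : regular_mx (fun y => relation_mx x y).
Proof.
move=> i j; apply: (@regular_ext _ _ (fun y => relation_defect x y (delta_mx 0 i) 0 j)).
  by move=> y; rewrite [RHS]mxE.
apply: regular_flat => v; apply: regular_mxB; apply: regular_mxD;
  by do ?[apply: regular_mxM|apply: regular_mx_cst|apply: regular_mapT|apply: regular_mapB].
Qed.

End Complex.

(** * The representation M *)

Section Structure.
Variables (K : fieldType) (n : nat) (s : 'S_n).

Definition alive (i : 'I_n) (v : nat) : bool := (i.+1 <= v <= n.*2 - (s i).+1)%N.

(** The summand to which a basis vector at [v] belongs. *)
Definition support_index v : 'I_(Vdim s v) -> 'I_n := @tagnat.sig1 n _.
Local Notation phi := support_index.

Lemma support_index_alive v (j : 'I_(Vdim s v)) : alive (phi j) v.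
Proof.
have := leq_ltn_trans (leq0n _) (ltn_ord (tagnat.sig2 j)).
by rewrite /interval_dim lt0b.
Qed.

Lemma support_index_inj v : injective (@support_index v).
Proof.
move=> j k e; have z (l : 'I_(Vdim s v)) : tagnat.sig2 l = 0%N :> nat.
  have l1 : (tagnat.sig2 l < 1)%N.
    by apply: leq_trans (ltn_ord _) _; rewrite /interval_dim leq_b1.
  by case: (nat_of_ord _) l1.
apply/val_inj/eqP; rewrite -(tagnat.sig2K j) -(tagnat.sig2K k) tagnat.eq_Rank !z eqxx andbT.
exact/eqP.
Qed.

Lemma support_index_onto v i : alive i v -> exists j : 'I_(Vdim s v), phi j = i.
Proof.
move=> iv; have k0 : (0 < interval_dim i.+1 (n.*2 - (s i).+1) v)%N.
  by rewrite /interval_dim -/(alive i v) iv.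
exists (@tagnat.Rank n (fun i : 'I_n => interval_dim i.+1 (n.*2 - (s i).+1) v) i (Ordinal k0)).
exact: tagnat.Rank1K.
Qed.

Lemma MrepE v (j : 'I_(Vdim s v.+1)) (k : 'I_(Vdim s v)) :
  @Mrep K n s v j k = (phi j == phi k)%:R.
Proof.
rewrite mxE -/(phi j) -/(phi k); case: eqP => [e|_]; last by rewrite mxE.
move: (tagnat.sig2 j) (tagnat.sig2 k); rewrite -/(phi j) -/(phi k) -e => a b.
by rewrite conform_mx_id mxE.
Qed.

(** The [n] summands of M have at most one dimension at each vertex, and exactly one
    at the central vertex [n]; [incl] and [proj] compare the space at [v] with the
    space at the centre, so that all maps become [n] by [n] matrices. *)
Definition incl v : 'M[K]_(n, Vdim s v) := \matrix_(i, j) (i == phi j)%:R.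
Definition proj v : 'M[K]_(Vdim s v, n) := (incl v)^T.

Lemma proj_incl v : proj v *m incl v = 1%:M.
Proof.
apply/matrixP => j k; rewrite !mxE (bigD1 (phi j)) //= !mxE eqxx mul1r.
rewrite big1 ?addr0 ?(inj_eq (@support_index_inj v)) // => i /negbTE ne.
by rewrite !mxE ne mul0r.
Qed.

Lemma Mrep_incl v : @Mrep K n s v = proj v.+1 *m incl v.
Proof.
apply/matrixP => j k; rewrite MrepE !mxE (bigD1 (phi j)) //= !mxE eqxx mul1r.
rewrite big1 ?addr0 // => i /negbTE ne; by rewrite !mxE ne mul0r.
Qed.

Lemma incl_proj v : incl v *m proj v = diag_mx (\row_i (alive i v)%:R).
Proof.
apply/matrixP => i k; rewrite !mxE.
have [->|ne] := eqVneq i k; last first.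
  rewrite mulr0n big1 // => j _; rewrite !mxE.
  by case: eqVneq => [ij|_]; rewrite ?mul0r // -ij eq_sym (negbTE ne) mulr0.
rewrite mulr1n; have [kv|nkv] := boolP (alive k v); last first.
  rewrite big1 // => j _; rewrite !mxE; case: eqP => [e|]; rewrite ?mul0r //.
  by rewrite e support_index_alive in nkv.
have [j <-] := support_index_onto kv.
rewrite (bigD1 j) //= !mxE eqxx mulr1 big1 ?addr0 // => l lj.
by rewrite !mxE (inj_eq (@support_index_inj v)) eq_sym (negbTE lj) mul0r.
Qed.

Lemma alive_center i : alive i n.
Proof. by rewrite /alive; have := ltn_ord i; have := ltn_ord (s i); lia. Qed.

Lemma incl_proj_center : incl n *m proj n = 1%:M.
Proof.
rewrite incl_proj; apply/matrixP => i j; rewrite !mxE alive_center.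
by [].
Qed.

Lemma Vdim0 : Vdim s 0 = 0%N.
Proof. by rewrite /Vdim /qsum_dim big1. Qed.

Lemma Vdim_out v : (n.*2 <= v)%N -> Vdim s v = 0%N.
Proof.
move=> nv; rewrite /Vdim /qsum_dim big1 // => i _; apply/eqP; rewrite eqb0.
by have := ltn_ord i; lia.
Qed.

Lemma Vdim_card v : Vdim s v = #|[set i | alive i v]|.
Proof.
rewrite -sum1_card big_mkcond; apply: eq_bigr => i _; rewrite inE /interval_dim /alive.
by case: (_ <= _ <= _)%N.
Qed.

Lemma Vdim_low v : (v <= n)%N -> Vdim s v = v.
Proof.
move=> vn; rewrite Vdim_card -[RHS](card_lt_ord vn); apply: eq_card => i.
by rewrite !inE /alive; have := ltn_ord i; have := ltn_ord (s i); lia.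
Qed.

Lemma Vdim_high v : (n <= v <= n.*2)%N -> Vdim s v = (n.*2 - v)%N.
Proof.
move=> vn; have kn : (n.*2 - v <= n)%N by lia.
rewrite Vdim_card -[RHS](card_lt_ord kn) -[RHS](card_preimset _ (@perm_inj _ s)).
apply: eq_card => i.
by rewrite !inE /alive; have := ltn_ord i; have := ltn_ord (s i); lia.
Qed.

(** The dimension vector is (1, 2, ..., n, ..., 2, 1). *)
Lemma Vdim_tits : (\sum_(v < n.*2) Vdim s v * Vdim s v =
  \sum_(v < n.*2) Vdim s v.+1 * Vdim s v + n)%N.
Proof.
rewrite -addnn !big_split_ord /=.
have e1 : (\sum_(i < n) Vdim s i.+1 * Vdim s i =
   \sum_(i < n) Vdim s i * Vdim s i + \sum_(i < n) i)%N.
  rewrite -big_split; apply: eq_bigr => i _ /=.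
  by rewrite !Vdim_low ?mulSn 1?addnC // ltnW.
have e2 : (\sum_(i < n) Vdim s (n + i) * Vdim s (n + i) =
   \sum_(i < n) Vdim s (n + i).+1 * Vdim s (n + i) + \sum_(i < n) (n - i))%N.
  rewrite -big_split; apply: eq_bigr => i _ /=.
  have := ltn_ord i => im; rewrite !Vdim_high -?addnn; try lia.
  have -> : (n + n - (n + i) = (n + n - (n + i).+1).+1)%N by lia.
  by rewrite mulSn addnC; congr (_ + _)%N; lia.
have e3 : (\sum_(i < n) (n - i) = \sum_(i < n) i + n)%N.
  rewrite (reindex_inj rev_ord_inj) /= -[X in (_ + X)%N](card_ord n) -sum1_card -big_split.
  by apply: eq_bigr => i _ /=; have := ltn_ord i; lia.
by rewrite e1 e2 e3 -!addnA; congr (_ + _)%N; rewrite addnCA.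
Qed.

End Structure.

(** * Backward maps over M *)

Section Backward.
Variables (K : fieldType) (n : nat) (s : 'S_n).
Local Notation d := (Vdim s).
Local Notation M := (@Mrep K n s).
Local Notation incl := (@incl K n s).
Local Notation proj := (@proj K n s).

(** The preprojective relations for backward maps [B], when the forward maps are
    those of M. *)
Definition compatible_back (B : mx_family K d (fun v => d v.+1)) :=
  forall v, M v *m B v = B v.+1 *m M v.+1.

Definition extended (B : mx_family K d (fun v => d v.+1)) v : 'M[K]_n :=
  incl v *m B v *m proj v.+1.

Lemma extended_inj (B : mx_family K d (fun v => d v.+1)) v : extended B v = 0 -> B v = 0.
Proof.
move=> B0; have -> : B v = proj v *m extended B v *m incl v.+1.
  by rewrite /extended !mulmxA proj_incl mul1mx -mulmxA proj_incl mulmx1.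
by rewrite B0 mulmx0 mul0mx.
Qed.

Section OneFamily.
Variable B : mx_family K d (fun v => d v.+1).
Hypothesis BM : compatible_back B.

Lemma extended_alive v i j : extended B v i j != 0 -> alive s i v && alive s j v.+1.
Proof.
have -> : extended B v = incl v *m proj v *m extended B v *m (incl v.+1 *m proj v.+1).
  rewrite /extended -!mulmxA (mulmxA (proj v.+1)) proj_incl mul1mx.
  by rewrite (mulmxA (proj v)) proj_incl mul1mx.
rewrite !incl_proj mul_diag_mx mul_mx_diag !mxE.
by case: (alive s i v); case: (alive s j v.+1); rewrite ?mul0r ?mulr0 ?eqxx.
Qed.

(** An entry of [B] does not change from one vertex to the next as long as both
    intervals last. *)
Lemma extended_step v i j :
  (alive s i v.+1)%:R * extended B v i j = extended B v.+1 i j * (alive s j v.+1)%:R.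
Proof.
have /matrixP/(_ i j) : diag_mx (\row_i (alive s i v.+1)%:R) *m extended B v =
    extended B v.+1 *m diag_mx (\row_i (alive s i v.+1)%:R).
  rewrite -!incl_proj /extended.
  transitivity (incl v.+1 *m (M v *m B v) *m proj v.+1).
    by rewrite Mrep_incl !mulmxA.
  by rewrite BM Mrep_incl !mulmxA.
by rewrite mul_diag_mx mul_mx_diag !mxE.
Qed.

Lemma extended_up v i j : extended B v i j != 0 -> (v.+1 <= n.*2 - (s i).+1)%N ->
  extended B v.+1 i j != 0.
Proof.
move=> bn vp; have /andP[/andP[iv _] _] := extended_alive bn.
have iv1 : alive s i v.+1 by rewrite /alive vp ltnW.
move: (extended_step v i j); rewrite iv1 mul1r => e.
by apply: contraNneq bn => b0; rewrite e b0 mul0r.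
Qed.

Lemma extended_down v i j : extended B v.+1 i j != 0 -> (j.+1 <= v.+1)%N ->
  extended B v i j != 0.
Proof.
move=> bn vp; have /andP[_ /andP[_ jv]] := extended_alive bn.
have jv1 : alive s j v.+1 by rewrite /alive vp ltnW.
move: (extended_step v i j); rewrite jv1 mulr1 => e.
by apply: contraNneq bn => b0; rewrite -e b0 mulr0.
Qed.

(** Following an entry up to the end of the interval of [i] shows that the interval
    of [j] ends later, and following it down to the start of the interval of [j]
    shows that the interval of [i] starts earlier. *)
Lemma extended_inversion v i j : extended B v i j != 0 -> inversion s i j.
Proof.
move=> bn; have /andP[/andP[iv vi] /andP[jv vj]] := extended_alive bn.
have si := ltn_ord (s i); have sj := ltn_ord (s j); have li := ltn_ord i; have lj := ltn_ord j.
have up k : (v + k <= n.*2 - (s i).+1)%N -> extended B (v + k) i j != 0.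
  elim: k => [|k IHk] h; first by rewrite addn0.
  by rewrite addnS; apply: extended_up; [apply: IHk|]; lia.
have down k : (j <= v - k)%N -> extended B (v - k) i j != 0.
  elim: k => [|k IHk] h; first by rewrite subn0.
  have [kv|vk] := ltnP k v; last first.
    have E : (v - k.+1 = v - k)%N by lia.
    by rewrite E in h *; apply: IHk.
  have E : (v - k = (v - k.+1).+1)%N by lia.
  by apply: extended_down; rewrite -E; [apply: IHk|]; lia.
apply/andP; split.
  have := down (v - j)%N; have -> : (v - (v - j) = j)%N by lia.
  by move=> /(_ (leqnn _))/extended_alive/andP[/andP[]].
have := up (n.*2 - (s i).+1 - v)%N; rewrite subnKC // => /(_ (leqnn _)).
move/extended_alive => /andP[_ /andP[_]] h; clear -si sj h; rewrite -!addnn in h; lia.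
Qed.

(** Following an entry towards the centre, where all intervals are present. *)
Lemma extended_center v i j : extended B v i j != 0 -> extended B n i j != 0.
Proof.
move=> bn; have /andP[/andP[iv vi] /andP[jv vj]] := extended_alive bn.
have si := ltn_ord (s i); have sj := ltn_ord (s j); have li := ltn_ord i; have lj := ltn_ord j.
have [vn|nv] := leqP v n.
  have up k : (v + k <= n)%N -> extended B (v + k) i j != 0.
    elim: k => [|k IHk] h; first by rewrite addn0.
    by rewrite addnS; apply: extended_up; [apply: IHk|]; lia.
  by have := up (n - v)%N; rewrite subnKC // => /(_ (leqnn _)).
have down k : (k <= v - n)%N -> extended B (v - k) i j != 0.
  elim: k => [|k IHk] h; first by rewrite subn0.
  have E : (v - k = (v - k.+1).+1)%N by lia.
  by apply: extended_down; rewrite -E; [apply: IHk|]; lia.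
by have := down (v - n)%N; rewrite subKn ?(ltnW nv) // => /(_ (leqnn _)).
Qed.

Lemma center_determines : extended B n = 0 -> forall v, B v = 0.
Proof.
move=> B0 v; apply: extended_inj; apply/matrixP => i j; rewrite [RHS]mxE.
by apply/eqP/negPn/negP => /extended_center; rewrite B0 mxE eqxx.
Qed.

End OneFamily.

End Backward.

(** * Homomorphisms supported on inversions *)

Section HomSpace.
Variables (K : fieldType) (n : nat) (s : 'S_n).
Local Notation d := (Vdim s).
Local Notation M := (@Mrep K n s).
Local Notation incl := (@incl K n s).
Local Notation proj := (@proj K n s).

Lemma incl_projl v (A : 'M[K]_n) i j :
  (incl v *m proj v *m A) i j = (alive s i v)%:R * A i j.
Proof. by rewrite incl_proj mul_diag_mx !mxE. Qed.

Lemma incl_projr v (A : 'M[K]_n) i j :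
  (A *m (incl v *m proj v)) i j = A i j * (alive s j v)%:R.
Proof. by rewrite incl_proj mul_mx_diag !mxE. Qed.

Definition inversion_supported (c : 'M[K]_n) := forall i j, c i j != 0 -> inversion s i j.

(** A matrix supported on inversions is a radical endomorphism of M: a nonzero map
    between distinct intervals that all contain the centre exists, in one
    direction, exactly when they form an inversion. *)
Definition nilp_end (c : 'M[K]_n) v : 'M[K]_(d v) := proj v *m c *m incl v.

Lemma nilp_end_Mrep c v : inversion_supported c ->
  nilp_end c v.+1 *m M v = M v *m nilp_end c v.
Proof.
move=> ci; rewrite /nilp_end Mrep_incl.
have e : (incl v.+1 *m proj v.+1) *m c *m (incl v.+1 *m proj v.+1) *m (incl v *m proj v) =
   (incl v.+1 *m proj v.+1) *m ((incl v *m proj v) *m c) *m (incl v *m proj v).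
  apply/matrixP => i j; rewrite !(incl_projl, incl_projr).
  have [->|cij] := eqVneq (c i j) 0; first by rewrite !(mul0r, mulr0).
  have /andP[lij lsij] := ci i j cij.
  have h : alive s i v.+1 && alive s j v.+1 && alive s j v =
           alive s i v.+1 && alive s i v && alive s j v.
    have := ltn_ord (s i); have := ltn_ord (s j); have := ltn_ord i; have := ltn_ord j.
    by clear -lij lsij; rewrite /alive -!addnn; lia.
  move: h; case: (alive s i v.+1); case: (alive s j v.+1); case: (alive s j v);
    by case: (alive s i v) => //= _; rewrite ?(mul0r, mulr0, mul1r, mulr1).
transitivity (proj v.+1 *m ((incl v.+1 *m proj v.+1) *m c *m (incl v.+1 *m proj v.+1) *m
   (incl v *m proj v)) *m incl v).
  by rewrite !mulmxA proj_incl mul1mx -(mulmxA _ (proj v) (incl v)) proj_incl mulmx1.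
by rewrite e !mulmxA proj_incl mul1mx -(mulmxA _ (proj v) (incl v)) proj_incl mulmx1.
Qed.

Section TwoModules.
Variables (x y : dblrep K d) (gx gy : forall v, 'M[K]_(d v)).
Hypotheses (Lx : Lambda x) (Ly : Lambda y).
Hypotheses (ux : forall v, gx v \in unitmx) (uy : forall v, gy v \in unitmx).
Hypotheses (hx : forall v, gx v.+1 *m mapT x v = M v *m gx v).
Hypotheses (hy : forall v, gy v.+1 *m mapT y v = M v *m gy v).

(** The backward maps of a module [z], rewritten over M through the isomorphism
    [g]. *)
Definition transported (z : dblrep K d) (g : forall v, 'M[K]_(d v)) :
    mx_family K d (fun v => d v.+1) :=
  fun v => g v *m mapB z v *m invmx (g v.+1).

Lemma transported_compatible z g : Lambda z -> (forall v, g v \in unitmx) ->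
  (forall v, g v.+1 *m mapT z v = M v *m g v) -> compatible_back (transported z g).
Proof.
move=> Lz ug hg v; rewrite /transported !mulmxA -hg -(mulmxA _ (mapT z v)) Lz.
have -> : M v.+1 = g v.+2 *m mapT z v.+1 *m invmx (g v.+1) by rewrite hg mulmxK.
by rewrite !mulmxA mulmxKV.
Qed.

Local Notation bx := (transported x gx).
Local Notation by' := (transported y gy).

(** By [center_determines] the endomorphism [c] commutes with the backward maps as
    soon as it does so at the centre; the right factor restricts to the intervals
    that contain the source [n.+1] of the backward map at [n]. *)
Definition center_defect (c : 'M[K]_n) : 'M[K]_n :=
  c *m extended bx n - extended by' n *m c *m (incl n.+1 *m proj n.+1).

Definition hom_of (c : 'M[K]_n) v : 'M[K]_(d v) :=
  invmx (gy v) *m nilp_end c v *m gx v.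

Lemma hom_ofP c : inversion_supported c -> center_defect c = 0 ->
  pihom x y (hom_of c).
Proof.
move=> ci c0.
have Hb v : nilp_end c v *m bx v = by' v *m nilp_end c v.+1.
  apply/eqP; rewrite -subr_eq0; apply/eqP.
  pose D : mx_family K d (fun v => d v.+1) :=
    fun v => nilp_end c v *m bx v - by' v *m nilp_end c v.+1.
  have BD : compatible_back D.
    have cbx := transported_compatible Lx ux hx; have cby := transported_compatible Ly uy hy.
    move=> w; rewrite /D mulmxBr mulmxBl; congr (_ - _).
      rewrite (mulmxA (M w)) -nilp_end_Mrep // -(mulmxA (nilp_end c w.+1) (M w)) cbx.
      by rewrite (mulmxA (nilp_end c w.+1) (bx w.+1)).
    rewrite (mulmxA (M w)) cby -(mulmxA (by' w.+1) (M w.+1)) -nilp_end_Mrep //.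
    by rewrite (mulmxA (by' w.+1) (nilp_end c w.+2)).
  apply: (center_determines BD); rewrite -c0 /center_defect /D /extended /nilp_end.
  rewrite mulmxBr mulmxBl; congr (_ - _); last by rewrite !mulmxA.
  by rewrite !mulmxA incl_proj_center mul1mx.
have ex v : gx v *m mapB x v = bx v *m gx v.+1 by rewrite /transported mulmxKV.
have ey v : mapB y v *m invmx (gy v.+1) = invmx (gy v) *m by' v.
  by rewrite /transported !mulmxA mulVmx // mul1mx.
have eT v : mapT y v *m invmx (gy v) = invmx (gy v.+1) *m M v.
  by rewrite -[M v](mulmxK (uy v)) -hy !mulmxA mulVmx // mul1mx.
rewrite /hom_of; move: (nilp_end c) (fun v => nilp_end_Mrep v ci) Hb => N hM.
move: bx by' ex ey => bx' by'' ex ey Hb; split=> v.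
- by rewrite -!mulmxA hx (mulmxA (N v.+1)) hM !mulmxA eT.
- by rewrite -!mulmxA ex (mulmxA (N v)) Hb !mulmxA ey.
Qed.

Lemma hom_of_inj c : hom_of c n = 0 -> c = 0.
Proof.
move=> h0; have : gy n *m hom_of c n *m invmx (gx n) = 0 by rewrite h0 mulmx0 mul0mx.
rewrite /hom_of !mulmxA mulmxV // mul1mx mulmxK // => e.
have -> : c = incl n *m (proj n *m c *m incl n) *m proj n.
  by rewrite !mulmxA incl_proj_center mul1mx -mulmxA incl_proj_center mulmx1.
by rewrite e mulmx0 mul0mx.
Qed.

(** The middle index of a nonzero term of the product is a position between the two
    others, with value between the two others. *)
Lemma product_support (a b : 'M[K]_n) i j : inversion_supported a -> inversion_supported b ->
  (a *m b) i j != 0 -> inversion s i j && ((i, j) \notin Cov s).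
Proof.
move=> ai bi; rewrite mxE => ab.
have [k] : exists k, a i k * b k j != 0.
  apply/existsP; apply: contraNT ab; rewrite negb_exists => /forallP h.
  by rewrite big1 // => k _; apply/eqP/negPn.
rewrite mulf_eq0 negb_or => /andP[/ai/andP[ik ski] /bi/andP[kj sjk]].
have ij : inversion s i j by rewrite /inversion (ltn_trans ik kj) (ltn_trans sjk ski).
rewrite ij inE /minimal_inversion /= ij negbK; apply/existsP; exists k.
by rewrite ik kj ski sjk.
Qed.

Lemma center_defect_support c i j : inversion_supported c -> center_defect c i j != 0 ->
  inversion s i j && ((i, j) \notin Cov s).
Proof.
move=> ci; have cbx := transported_compatible Lx ux hx; have cby := transported_compatible Ly uy hy.
have bxi : inversion_supported (extended bx n) by move=> a b; apply: extended_inversion.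
have byi : inversion_supported (extended by' n) by move=> a b; apply: extended_inversion.
rewrite mxE [X in _ + X]mxE incl_projr => nz.
have [e1|] := eqVneq ((c *m extended bx n) i j) 0; last exact: product_support.
rewrite e1 add0r oppr_eq0 mulf_eq0 negb_or in nz; have /andP[nz' _] := nz.
exact: product_support nz'.
Qed.

Let inversions : {set 'I_n * 'I_n} := [set e | inversion s e.1 e.2].

Definition support_mx (u : 'rV[K]_#|inversions|) : 'M[K]_n :=
  \matrix_(i, j) \sum_k u 0 k *+ (enum_val k == (i, j)).

Lemma support_mx_linear : linear support_mx.
Proof.
move=> a u w; apply/matrixP => i j; rewrite !mxE mulr_sumr -big_split.
by apply: eq_bigr => k _; rewrite !mxE mulrnDl mulrnAr.
Qed.

Lemma support_mx_supported u : inversion_supported (support_mx u).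
Proof.
move=> i j; rewrite mxE; apply: contraR => nij; rewrite big1 // => k _.
case: eqP => // e; have := enum_valP k; rewrite inE e /=.
by rewrite (negbTE nij).
Qed.

Lemma support_mx_inj u : support_mx u = 0 -> u = 0.
Proof.
move=> /matrixP u0; apply/rowP => k; rewrite [RHS]mxE.
have := u0 (enum_val k).1 (enum_val k).2; rewrite !mxE -surjective_pairing.
rewrite (bigD1 k) //= eqxx big1 ?addr0 // => l /negbTE lk.
by rewrite (inj_eq enum_val_inj) lk.
Qed.

Lemma center_defect_linear a c1 c2 :
  center_defect (a *: c1 + c2) = a *: center_defect c1 + center_defect c2.
Proof.
rewrite /center_defect mulmxDr !mulmxDl -scalemxAr -!scalemxAl scalerBr opprD addrACA.
by [].
Qed.

Lemma hom_of_linear a c1 c2 v : hom_of (a *: c1 + c2) v = a *: hom_of c1 v + hom_of c2 v.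
Proof.
by rewrite /hom_of /nilp_end !(mulmxDr, mulmxDl) -!(scalemxAr, scalemxAl).
Qed.

(** The unknowns are the entries at inversions; the equations [center_defect c = 0]
    only concern the inversions that are not minimal. *)
Lemma hom_space : exists r (h : 'rV[K]_r -> mx_family K d d),
  [/\ (#|Cov s| <= r)%N,
      (forall a u1 u2 v, h (a *: u1 + u2) v = a *: h u1 v + h u2 v),
      (forall u, h u n = 0 -> u = 0)
    & (forall u, pihom x y (h u))].
Proof.
pose nonmin := inversions :\: Cov s.
pose G (u : 'rV[K]_#|inversions|) : 'rV[K]_#|nonmin| :=
  \row_l center_defect (support_mx u) (enum_val l).1 (enum_val l).2.
have Glin : linear G.
  move=> a u w; apply/rowP => l; have GE t : G t 0 l = center_defect (support_mx t)
    (enum_val l).1 (enum_val l).2 by rewrite mxE.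
  rewrite GE support_mx_linear center_defect_linear [LHS]mxE [X in X + _]mxE -!GE.
  by rewrite [RHS]mxE [X in _ = X + _]mxE.
pose Gp := GRing.isLinear.Build K _ _ *:%R G Glin.
pose Gl : {linear 'rV_#|inversions| -> 'rV_#|nonmin|} := HB.pack G Gp.
pose A := kermx (lin1_mx Gl).
exists (\rank A), (fun u => hom_of (support_mx (u *m row_base A))); split.
- rewrite mxrank_ker.
  have -> : #|Cov s| = (#|inversions| - #|nonmin|)%N.
    have sub : Cov s \subset inversions.
      by apply/subsetP => e; rewrite !inE => /andP[].
    by rewrite cardsDS // subKn // subset_leq_card.
  by apply: leq_sub2l; apply: rank_leq_col.
- move=> a u1 u2 v; rewrite mulmxDl -scalemxAl support_mx_linear; exact: hom_of_linear.
- move=> u /hom_of_inj/support_mx_inj/eqP.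
  by rewrite mulmx_free_eq0 ?row_base_free // => /eqP.
move=> u; apply: hom_ofP; first exact: support_mx_supported.
set w := u *m row_base A; apply/matrixP => i j; rewrite [RHS]mxE.
apply/eqP/negPn/negP => nz.
have /andP[ij nc] := center_defect_support (@support_mx_supported w) nz.
have lP : (i, j) \in nonmin by rewrite inE nc inE.
have Gw : G w = 0.
  rewrite -[G w]/(Gl w) -mul_rV_lin1; apply/sub_kermxP.
  by apply: submx_trans (submxMl _ _) _; rewrite eq_row_base.
move/rowP: Gw => /(_ (enum_rank_in lP (i, j))); rewrite [LHS]mxE [RHS]mxE enum_rankK_in //= => e.
by rewrite e eqxx in nz.
Qed.

End TwoModules.
End HomSpace.

(** * Pseudorigidity *)

Section NotPseudorigid.
Variables (K : fieldType) (n : nat) (s : 'S_n).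
Local Notation d := (Vdim s).
Local Notation m := (n.*2).
Local Notation dense x := (Lambda x /\ qrep_iso (mapT x) (@Mrep K n s)).
Implicit Types x y : dblrep K d.

Let dm := @Vdim_out n s.
Let d0 := @Vdim0 n s.

(** On the dense part of the component the space of [hom_space] lies in Hom(x, y). *)
Lemma dense_rank x y : (0 < n)%N -> dense x -> dense y ->
  (\rank (coboundary_mx m x y) + #|Cov s| <= #|entry m d d|)%N /\
  (\rank (relation_mx m y x) + #|Cov s| <= #|entry m (fun v => d v.+1) (fun v => d v.+1)|)%N.
Proof.
move=> n0 [Lx [gx ux hx]] [Ly [gy uy hy]].
have [r [h [covr hlin hinj hhom]]] := hom_space Lx Ly ux uy hx hy.
have n1 : n.-1.+1 = n by rewrite prednK.
have := coboundary_rank_le dm hlin hinj hhom.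
have := relation_rank_le d0 dm hlin hinj n1 hhom.
by lia.
Qed.

(** A rank bound passes to the closure in one variable and then in the other. *)
Lemma closure_rank2 a b (F : dblrep K d -> dblrep K d -> 'M[K]_(a, b)) r
    (P : dblrep K d -> Prop) x y :
  (forall y, regular_mx (fun x => F x y)) -> (forall x, regular_mx (F x)) ->
  (forall x y, P x -> P y -> \rank (F x y) <= r)%N ->
  zariski_closure P x -> zariski_closure P y -> (\rank (F x y) <= r)%N.
Proof.
move=> rx ry FP clx cly; apply: (closure_rank (rx y) _ clx) => z Pz.
by apply: (closure_rank (ry z) _ cly) => w Pw; apply: FP.
Qed.

(** With [N0] the sum of the squares of the dimensions, both ranks are at most
    [N0 - n.+1], whereas their sum would have to be at least
    [NA + NC = N0 + N0 - n.*2]. *)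
Lemma not_pseudorigid_pair x y : (1 < n < #|Cov s|)%N ->
  component x -> component y -> ~ Ext1_eq0 x y.
Proof.
move=> /andP[n1 ncov] [Lx clx] [Ly cly] ext0.
have n0 : (0 < n)%N by exact: ltnW.
have := ext_rank dm Lx Ly ext0.
set NA := #|entry m (fun v => d v.+1) d|; set NC := #|entry m d _|.
pose N0 := #|entry m d d|; pose N2 := #|entry m (fun v => d v.+1) (fun v => d v.+1)|.
have r1 : (\rank (coboundary_mx m x y) <= N0 - n.+1)%N.
  apply: (closure_rank2 (F := coboundary_mx m)) clx cly.
  - exact: regular_coboundary_src.
  - exact: regular_coboundary_tgt.
  by move=> z w Pz Pw; have [+ _] := dense_rank n0 Pz Pw; rewrite -/N0; lia.
have r2 : (\rank (relation_mx m x y) <= N2 - n.+1)%N.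
  apply: (closure_rank2 (F := relation_mx m)) clx cly.
  - exact: regular_relation_src.
  - exact: regular_relation_tgt.
  by move=> z w Pz Pw; have [_ +] := dense_rank n0 Pw Pz; rewrite -/N2; lia.
have eA : N0 = (NA + n)%N by rewrite /N0 /NA !card_entry Vdim_tits.
have eC : NC = NA.
  by rewrite /NC /NA !card_entry; apply: eq_bigr => v _; rewrite mulnC.
have e2 : N2 = N0.
  rewrite /N0 /N2 !card_entry.
  transitivity (\sum_(v < m.+1) d v * d v)%N.
    by rewrite big_ord_recl /= d0 mul0n add0n.
  by rewrite big_ord_recr /= (dm (leqnn m)) muln0 addn0.
have big : (n * n <= N0)%N.
  have nm : (n < m)%N by lia.
  by rewrite /N0 card_entry (bigD1 (Ordinal nm)) //= Vdim_low // leq_addr.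
(* The subtractions in the rank bounds are therefore not truncated. *)
have {big} big : (n < N0)%N by apply: leq_trans big; nia.
move=> ext; move: (leq_trans ext (leq_add r1 r2)); rewrite e2 eC.
by move: big; rewrite eA; lia.
Qed.

End NotPseudorigid.

End NotPseudorigidOfCovers.

Theorem theorem7p2 (n : nat) (s : 'S_n) (s_critical : critical s) :
  [/\ connected_graph (cover_graph s),
      ~ pseudotree (cover_graph s),
      (n.+1 <= #|Cov s|)%N
    & forall K : closedFieldType, ~ pseudorigid K s].
Proof.
have [n1 oC cC ltC] := critical_covers s_critical.
split=> // [|K [x [y [cx cy]]]]; last by apply: not_pseudorigid_pair; rewrite ?n1.
by apply: not_pseudotree; rewrite ?card_ord // ltnW.
Qed.
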